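(* The Riemann hypothesis is true if and only if, for every $\delta$ with $\frac12<\delta<1$, the equation $$\sum_{n=1}^\infty d(n) \left[(\mathcal{K}_n f)(x)- 4 (\mathcal{K}_{2n} f)(x)+ 4 (\mathcal{K}_{4n} f)(x)\right]=0\quad\text{for all } x\in\mathbb{R},$$ where $$(\mathcal{K}_n f)(x)= \int_{-\infty}^\infty e^{- \delta u} K_0\left(2\sqrt {n}\, e^{(x-u)/2}\right)f(u)\,du,$$ has no nontrivial solutions $f$ in the class of bounded measurable functions on $\mathbb{R}$.
   Context: The Riemann hypothesis is the statement that the Riemann zeta-function $\zeta(s)$ has no zeros in the strip $1/2<\operatorname{Re}s<1$. $d(n)$ is the number of positive divisors of $n$ (including $1$ and $n$). $K_0$ is the modified Bessel function of the second kind (Macdonald function) of order zero, $K_0(x)=\int_0^\infty e^{-x\cosh u}\,du$, $x>0$. A solution is trivial if it is zero almost everywhere.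
   Formalization: The series, which summed bracket by bracket over n diverges for f=1 and f=e^{-ibu} since ∑d(n)n^{-s} diverges for Re s<1, is summed in order of operator index: the N-th partial sum takes all terms in K_1 f,...,K_N f; it then converges for every bounded measurable f. *)

(* Defs.v *)
From mathcomp Require Import all_boot all_order all_algebra.
From mathcomp Require Import complex.
From mathcomp Require Import all_classical all_reals all_analysis.

Set Implicit Arguments.
Unset Strict Implicit.
Unset Printing Implicit Defensive.

Import Order.TTheory GRing.Theory Num.Theory.
Import numFieldNormedType.Exports.
Import Normc.

Local Open Scope classical_set_scope.
Local Open Scope ring_scope.
Local Open Scope complex_scope.

Definition cintegral (R : realType) (D : set R) (g : R -> R[i]) : R[i] :=
  Rintegral lebesgue_measure D (fun u => complex.Re (g u)) +i*
  Rintegral lebesgue_measure D (fun u => complex.Im (g u)).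

(* The principal value of x ^ z for a positive real x. *)
Definition rcpow (R : realType) (x : R) (z : R[i]) : R[i] :=
  (expR (complex.Re z * ln x))%:C *
  (cos (complex.Im z * ln x) +i* sin (complex.Im z * ln x)).

(* The Riemann zeta-function in the half-plane Re s > 0, by the classical
   formula (Abel summation of the Dirichlet series, then continuation)
     zeta(s) = s / (s - 1) - s * \int_1^oo {x} x^(-s-1) dx.
   Outside this half-plane the value is meaningless. *)
Definition zeta (R : realType) (s : R[i]) : R[i] :=
  s / (s - 1) -
  s * cintegral `[1%R, +oo[
        (fun x : R => (x - (Num.floor x)%:~R)%:C * rcpow x (- s - 1)).

Definition RiemannHypothesis (R : realType) : Prop :=
  forall s : R[i], 2^-1 < complex.Re s < 1 -> zeta s <> 0.

Definition num_divisors (n : nat) : nat := size (divisors n).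

Definition cosh (R : realType) (u : R) : R := (expR u + expR (- u)) / 2.

Definition BesselK0 (R : realType) (x : R) : R :=
  Rintegral lebesgue_measure `[0%R, +oo[ (fun u => expR (- (x * cosh u))).

Definition opK (R : realType) (delta : R) (n : nat) (f : R -> R[i]) (x : R) :
    R[i] :=
  cintegral [set: R] (fun u =>
    (expR (- (delta * u)) *
     BesselK0 (2 * Num.sqrt n%:R * expR ((x - u) / 2)))%:C * f u).

Definition opK_upto (R : realType) (delta : R) (N m : nat) (f : R -> R[i])
    (x : R) : R[i] :=
  if (m <= N)%N then opK delta m f x else 0.

(* The N-th partial sum of \sum_n d(n) [K_n f - 4 K_{2n} f + 4 K_{4n} f].
   The operators K_m are summed in the order of their index m, i.e. the N-th
   partial sum collects exactly the terms in K_1 f, ..., K_N f.  Keeping whole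
   brackets instead would not define an operator on bounded functions: K_m 1
   is a positive multiple of m ^ (- delta), so for f = 1 the n-th bracket is a
   positive multiple of n ^ (- delta), and \sum_n d(n) n ^ (- delta) diverges
   for delta < 1.  Ordered by m, the partial sums converge for every bounded
   measurable f when 1/2 < delta, since the coefficients of K_1, ..., K_N add
   up to O(N ^ (1/2)); their limit is the integral operator whose kernel is
   the (absolutely convergent) sum of the kernels. *)
Definition eqn_psum (R : realType) (delta : R) (f : R -> R[i]) (x : R)
    (N : nat) : R[i] :=
  \sum_(1 <= n < N.+1) (num_divisors n)%:R *
    (opK_upto delta N n f x - 4 * opK_upto delta N (2 * n)%N f x
     + 4 * opK_upto delta N (4 * n)%N f x).

Definition solves_eqn (R : realType) (delta : R) (f : R -> R[i]) : Prop :=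
  forall x : R, (fun N => normc (eqn_psum delta f x N)) @ \oo --> (0 : R).

Definition bounded_measurable (R : realType) (f : R -> R[i]) : Prop :=
  [/\ measurable_fun [set: R] (fun u => complex.Re (f u)),
      measurable_fun [set: R] (fun u => complex.Im (f u)) &
      exists M : R, forall u, normc (f u) <= M].

Definition trivial_fun (R : realType) (f : R -> R[i]) : Prop :=
  {ae (@lebesgue_measure R), forall u, f u = 0}.

(* Main.v *)
(* The brackets group the divisor function into the Dirichlet convolution
   square of the alternating sign eps(n) = (-1)^(n-1): the coefficient of K_m is
   a = eps * eps, whose Dirichlet series is eta(s)^2 = (1 - 2^(1-s))^2 zeta(s)^2.
   The hyperbola method gives |a(1) + ... + a(N)| <= 3 sqrt N, hence convergence
   to eta(s)^2 for Re s > 1/2 and, by Abel summation against the decreasing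
   kernel K_0, an exponentially decaying limit kernel.  In the variable x - u the
   equation is therefore a convolution equation H * f = 0, and the Fourier
   transform of H at b is M(s) eta(s)^2 with s = delta + ib, where
   M(s) = Gamma(s)^2 / 2 is the transform of K_0 and never vanishes.
   If zeta(s) = 0, then f(u) = exp(-ibu) is a solution.
   If the transform of H has no zero, then dividing that of a Fejer kernel by it
   gives a C^2 function on a compact interval, the transform of some integrable
   psi with H * psi the Fejer kernel.  So Fejer kernels annihilate f, and
   their concentration at 0 forces f = 0. *)

Require Import Defs.
From mathcomp Require Import all_boot all_order all_algebra.
From mathcomp Require Import complex.
From mathcomp Require Import all_classical all_reals all_analysis.
From mathcomp Require Import measurable_realfun ring lra zify.

Set Implicit Arguments.
Unset Strict Implicit.
Unset Printing Implicit Defensive.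

Import Order.TTheory GRing.Theory Num.Theory.
Import numFieldNormedType.Exports.
Local Open Scope classical_set_scope.
Local Open Scope ring_scope.

(** * The Lebesgue integral on the line *)

(** All analysis is done on real functions: the kernels are real, so the real and the imaginary part
    of a solution satisfy the equation separately, and a Fourier transform is the pair [cosT],
    [sinT], nonzero when the sum of squares is. The strict inequality 1/2 < delta is what keeps
    Wiener's theorem elementary: the partial kernels can be dominated with exponents slightly below
    and slightly above delta, so the limit kernel decays exponentially in both directions and its
    transform is smooth. Dividing by it is then plain calculus, and the quotient has a transform of
    size O((1 + t^2)^-1). A bounded measurable [f] need not be continuous anywhere, so concentration
    of the Fejer kernels is applied to a smoothed [f], and Lebesgue differentiation undoes the
    smoothing. Gamma has no zero because one at s would propagate to all s + n, against the
    concentration of its integrand for large real part. Inside the strip the zeros of eta are those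
    of zeta, as 1 - 2^(1-s) vanishes only on Re s = 1. *)

Section LebesgueIntegral.
Context {R : realType}.
Local Notation mu := (@lebesgue_measure R).
Implicit Types f g : R -> R.
Local Notation L1 f := (mu.-integrable setT (EFin \o f)).

(** Lebesgue measure is determined by its values on half-open intervals, so only those are
    compared. *)
Lemma lebesgue_measure_translation (a : R) (A : set R) : measurable A ->
  pushforward mu ((fun x => x + a) : R -> measurableTypeR R) A = mu A.
Proof.
move=> mA; apply/esym/lebesgue_measure_unique => //=.
  by apply: measurable_funD => //.
move=> ? _ [[b c]] _ <-.
rewrite /pushforward.
have -> : (fun x => x + a) @^-1` [set` `]b, c]] = [set` `]b - a, c - a]] .
  by apply/seteqP; split => x /=; rewrite !in_itv/= ltrBlDr lerBrDr.
rewrite !lebesgue_measure_itv/= !lte_fin ltrD2r -!EFinB.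
by case: ifP => // _; congr (_%:E); ring.
Qed.

Lemma integral_translation (a : R) (h : R -> \bar R) :
  (\int[pushforward mu ((fun x => (x + a)%R) : R -> measurableTypeR R)]_x h x =
   \int[mu]_x h x)%E.
Proof.
have mt : measurable_fun setT ((fun x => x + a) : R -> measurableTypeR R).
  by apply: measurable_funD.
apply: eq_measure_integral => //= A mA _.
exact: lebesgue_measure_translation.
Qed.

Lemma integral_reflection (h : R -> \bar R) :
  (\int[pushforward mu ((fun x => (- x)%R) : R -> measurableTypeR R)]_x h x =
   \int[mu]_x h x)%E.
Proof.
have mt : measurable_fun setT ((fun x => - x) : R -> measurableTypeR R).
  exact: measurable_funN.
apply: eq_measure_integral => //= A mA _.
exact: lebesgue_measureN.
Qed.

Lemma integrable_translate f (a : R) : L1 f -> L1 (fun x => f (x + a)).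
Proof.
move=> /integrableP[mf intf].
have mt : measurable_fun setT ((fun x => x + a) : R -> measurableTypeR R).
  by apply: measurable_funD.
apply/integrableP; split.
  exact: (@measurableT_comp _ _ _ _ _ _ (EFin \o f) _ (fun x : R => x + a)).
move: intf; rewrite -(integral_translation a).
rewrite ge0_integral_pushforward//=.
by apply/measurable_EFinP; apply: measurableT_comp => //; exact/measurable_EFinP.
Qed.

Lemma Rintegral_translate f (a : R) : L1 f ->
  (\int[mu]_x f (x + a) = \int[mu]_x f x)%R.
Proof.
move=> intf; have /integrableP[mf _] := intf.
have mt : measurable_fun setT ((fun x => x + a) : R -> measurableTypeR R).
  by apply: measurable_funD.
rewrite /Rintegral; congr fine.
rewrite -[RHS](integral_translation a).
by rewrite integral_pushforward//=; exact: integrable_translate.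
Qed.

Lemma integrable_reflect f : L1 f -> L1 (fun x => f (- x)).
Proof.
move=> /integrableP[mf intf].
have mt : measurable_fun setT ((fun x => - x) : R -> measurableTypeR R).
  exact: measurable_funN.
apply/integrableP; split.
  apply/measurable_EFinP; move/measurable_EFinP : mf => mf.
  exact: (measurableT_comp mf mt).
move: intf; rewrite -integral_reflection.
rewrite ge0_integral_pushforward//=.
by apply/measurable_EFinP; apply: measurableT_comp => //; exact/measurable_EFinP.
Qed.

Lemma Rintegral_reflect f : L1 f -> (\int[mu]_x f (- x) = \int[mu]_x f x)%R.
Proof.
move=> intf; have /integrableP[mf _] := intf.
rewrite /Rintegral; congr fine.
have mt : measurable_fun setT ((fun x => - x) : R -> measurableTypeR R).
  exact: measurable_funN.
rewrite -[RHS]integral_reflection.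
by rewrite integral_pushforward//=; exact: integrable_reflect.
Qed.

Lemma integrable_sub f (x : R) : L1 f -> L1 (fun u => f (x - u)).
Proof.
move=> /(integrable_translate x)/integrable_reflect.
by apply: eq_integrable => // u _ /=; rewrite addrC.
Qed.

Lemma Rintegral_sub f (x : R) : L1 f ->
  (\int[mu]_u f (x - u) = \int[mu]_u f u)%R.
Proof.
move=> intf; have e : \int[mu]_u f (x - u) = \int[mu]_u (fun v => f (v + x)) (- u).
  by apply: eq_Rintegral => u _; rewrite addrC.
rewrite e (@Rintegral_reflect (fun v => f (v + x))); last exact: integrable_translate.
exact: Rintegral_translate.
Qed.

Lemma L1_measurable f : L1 f -> measurable_fun setT f.
Proof. by move=> /integrableP[/measurable_EFinP]. Qed.

Lemma L1_le f g : measurable_fun setT f -> L1 g -> (forall x, `|f x| <= g x) ->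
  L1 f.
Proof.
move=> mf intg fg; apply: (le_integrable _ _ _ intg) => //.
  exact/measurable_EFinP.
move=> x _ /=; rewrite lee_fin (le_trans (fg x))//; exact: ler_norm.
Qed.

Lemma L1Zl f (c : R) : L1 f -> L1 (fun x => c * f x).
Proof. exact: integrableZl. Qed.

Lemma L1D f g : L1 f -> L1 g -> L1 (fun x => f x + g x).
Proof. exact: integrableD. Qed.

Lemma L1B f g : L1 f -> L1 g -> L1 (fun x => f x - g x).
Proof. exact: integrableB. Qed.

Lemma L1_bounded_mul f g (M : R) : L1 f -> measurable_fun setT g ->
  (forall x, `|g x| <= M) -> L1 (fun x => f x * g x).
Proof.
move=> intf mg gM; have mf := L1_measurable intf.
apply: (@L1_le _ (fun x => M * `|f x|)).
- exact: measurable_funM.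
- by apply: L1Zl; exact: integrable_norm.
- by move=> x; rewrite normrM mulrC ler_wpM2r.
Qed.

Lemma L1_sum (I : Type) (s : seq I) (P : pred I) (F : I -> R -> R) :
  (forall i, L1 (F i)) -> L1 (fun x => \sum_(i <- s | P i) F i x).
Proof.
move=> intF; elim: s => [|i s IH].
  have -> : (fun x => \sum_(i <- [::] | P i) F i x) = cst 0.
    by apply/funext => x; rewrite big_nil.
  exact: integrable0.
have -> : (fun x => \sum_(j <- i :: s | P j) F j x) =
    fun x => if P i then F i x + \sum_(j <- s | P j) F j x
             else \sum_(j <- s | P j) F j x.
  by apply/funext => x; rewrite big_cons.
by case: (P i) => //; exact: L1D.
Qed.

Lemma Rintegral_sum (I : Type) (s : seq I) (P : pred I) (F : I -> R -> R) :
  (forall i, L1 (F i)) ->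
  (\int[mu]_x (\sum_(i <- s | P i) F i x) = \sum_(i <- s | P i) \int[mu]_x F i x)%R.
Proof.
move=> intF; elim: s => [|i s IH].
  rewrite big_nil; transitivity (\int[mu]_(x in setT) (0 : R)).
    by apply: eq_Rintegral => x _; rewrite big_nil.
  by rewrite Rintegral_cst// mul0r.
rewrite big_cons.
transitivity (\int[mu]_x (if P i then F i x + \sum_(j <- s | P j) F j x
    else \sum_(j <- s | P j) F j x)).
  by apply: eq_Rintegral => x _; rewrite big_cons.
case: (P i) => //; rewrite RintegralD ?IH//; exact: L1_sum.
Qed.

Lemma Rintegral_le_norm f g : L1 f -> L1 g -> (forall x, `|f x| <= g x) ->
  `|(\int[mu]_x f x)%R| <= (\int[mu]_x g x)%R.
Proof.
move=> intf intg fg; apply: (le_trans (le_normr_Rintegral _ intf)) => //.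
by apply: le_Rintegral => //; exact: integrable_norm.
Qed.

Lemma Rintegral_dominated (F : nat -> R -> R) f g :
  (forall n, measurable_fun setT (F n)) -> (forall n x, `|F n x| <= g x) ->
  L1 g -> (forall x, F ^~ x @ \oo --> f x) ->
  L1 f /\ ((fun n => (\int[mu]_x F n x)%R) @ \oo --> (\int[mu]_x f x)%R).
Proof.
move=> mF Fg intg cF.
have mf : measurable_fun setT f by apply: (measurable_fun_cvg mF) => x _; exact: cF.
have [] := @dominated_convergence _ _ _ mu setT measurableT
  (fun n => EFin \o F n) (EFin \o f) (EFin \o g).
- by move=> n; apply/measurable_EFinP; exact: mF.
- exact/measurable_EFinP.
- by apply/aeW => x _; apply: cvg_EFin; [exact: nearW|exact: cF].
- exact: intg.
- by apply/aeW => x n _; rewrite lee_fin.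
move=> intf _ c; split => //.
have fi : (\int[mu]_x (EFin \o f) x)%E \is a fin_num by exact: integrable_fin_num.
move: c; rewrite -(fineK fi) => /fine_cvg.
exact.
Qed.

(** The majorant [P] of the inner absolute integrals gives Tonelli's criterion for integrability on
    the product. Each use takes for [P] a constant times an integrable function of the outer
    variable. *)
Lemma Rintegral_fubini (F : R * R -> R) (P : R -> R) :
  measurable_fun setT F ->
  (forall x, L1 (fun y => F (x, y))) -> (forall y, L1 (fun x => F (x, y))) ->
  L1 P -> (forall x, (\int[mu]_y `|F (x, y)|)%R <= P x) ->
  L1 (fun x => (\int[mu]_y F (x, y))%R) /\
  (\int[mu]_x (\int[mu]_y F (x, y)) = \int[mu]_y (\int[mu]_x F (x, y)))%R.
Proof.
move=> mF i1 i2 intP FP.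
have mEF : measurable_fun setT (EFin \o F) by exact/measurable_EFinP.
have iF : (mu \x mu)%E.-integrable setT (EFin \o F).
  apply/(@integrable12ltyP _ _ _ _ R mu mu _ mEF).
  have /integrableP[mP] := intP; apply: le_lt_trans.
  apply: ge0_le_integral => //.
  - by move=> x _; exact: integral_ge0.
  - apply: (@measurable_fun_fubini_tonelli_F _ _ _ _ R mu (abse \o (EFin \o F))) => //=.
    exact: measurableT_comp.
  - exact: measurableT_comp.
  move=> x _ /=; apply: (@le_trans _ _ (P x)%:E); last by rewrite lee_fin ler_norm.
  rewrite -(@fineK _ (\int[mu]_y _)%E); first by rewrite lee_fin; exact: FP.
  by have h := integrable_fin_num measurableT (integrable_norm (i1 x)); exact: h.
have e1 x : (\int[mu]_y (EFin \o F) (x, y))%E = ((\int[mu]_y F (x, y))%R)%:E.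
  by rewrite /Rintegral fineK//; exact: (integrable_fin_num measurableT (i1 x)).
have e2 y : (\int[mu]_x (EFin \o F) (x, y))%E = ((\int[mu]_x F (x, y))%R)%:E.
  by rewrite /Rintegral fineK//; exact: (integrable_fin_num measurableT (i2 y)).
split.
- have := integrable_fubini_F iF.
  by apply: eq_integrable => // x _; exact: e1.
- rewrite {1}/Rintegral [RHS]/Rintegral; congr fine.
  under eq_integral do rewrite -e1.
  under [RHS]eq_integral do rewrite -e2.
  exact: Fubini.
Qed.

End LebesgueIntegral.

(** * The Dirichlet hyperbola method *)

Section HyperbolaMethod.

Definition alt (j : nat) : int := (-1) ^+ j.+1.

(** [j] and [k] run independently up to [m], instead of over the divisors of [m], so that both
    ranges can be widened to a common [N] and the sums exchanged. The values are integers, cast to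
    [R] in the bounds and to [R[i]] in the Dirichlet series. *)
Definition altconv (m : nat) : int :=
  \sum_(1 <= j < m.+1) \sum_(1 <= k < m.+1 | (j * k == m)%N) alt j * alt k.

Lemma big_nat_vanish (V : nmodType) (n N : nat) (F : nat -> V) : (n <= N)%N ->
  (forall i, (n < i)%N -> F i = 0) ->
  \sum_(1 <= i < n.+1) F i = \sum_(1 <= i < N.+1) F i.
Proof.
move=> nN F0; rewrite (big_nat_widen _ n.+1 N.+1)//=.
rewrite big_mkcond/=; apply: eq_bigr => i _.
by rewrite ltnS leqNgt; case: ltnP => //= ni; rewrite F0.
Qed.

Lemma big_nat_pick (V : nmodType) (p N : nat) (F : nat -> V) : (0 < p)%N ->
  \sum_(1 <= m < N.+1) (if (p == m)%N then F m else 0) =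
  if (p <= N)%N then F p else 0.
Proof.
move=> p0; rewrite -big_mkcond/=.
under eq_bigl do rewrite eq_sym.
rewrite big_nat1_eq p0/=; by rewrite ltnS.
Qed.

Lemma sum_altconv (V : comNzRingType) (N : nat) (X : nat -> V) :
  \sum_(1 <= m < N.+1) (altconv m)%:~R * X m =
  \sum_(1 <= j < N.+1) \sum_(1 <= k < N.+1)
    if (j * k <= N)%N then (alt j)%:~R * (alt k)%:~R * X (j * k)%N else 0.
Proof.
transitivity (\sum_(1 <= m < N.+1) \sum_(1 <= j < N.+1) \sum_(1 <= k < N.+1)
    if (j * k == m)%N then (alt j)%:~R * (alt k)%:~R * X m else 0).
  apply: eq_big_nat => m /andP[m0 mN].
  rewrite /altconv (@big_nat_vanish _ m N)//; last first.
    move=> j mj; rewrite big_nat_cond big1// => k /andP[/andP[k0 _] /eqP jkm].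
    by move: mj; rewrite -jkm -{2}(muln1 j) ltn_mul2l; case: k k0 {jkm} => //= k _; rewrite andbF.
  rewrite rmorph_sum mulr_suml; apply: eq_big_nat => j /andP[j0 _].
  rewrite big_mkcond/= (@big_nat_vanish _ m N)//; last first.
    move=> k mk; case: eqP => // jkm.
    by move: mk; rewrite -jkm -{2}(mul1n k) ltn_mul2r; case: j j0 {jkm} => //= j _; rewrite andbF.
  rewrite rmorph_sum mulr_suml; apply: eq_bigr => k _.
  by case: ifP => _; rewrite ?rmorphM/= ?rmorph0 ?mul0r.
rewrite exchange_big/=; apply: eq_big_nat => j /andP[j0 _].
rewrite exchange_big/=; apply: eq_big_nat => k /andP[k0 _].
rewrite (@big_nat_pick _ (j * k) N (fun m => (alt j)%:~R * (alt k)%:~R * X m))//.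
by rewrite muln_gt0 j0.
Qed.

(** [num_divisors n] counts the factorisations n = jk. As [Z] vanishes beyond [N], the pairs may
    fill the whole square, without the constraint jk <= N. *)
Lemma sum_num_divisors (V : pzSemiRingType) (N : nat) (Z : nat -> V) :
  (forall n, (N < n)%N -> Z n = 0) ->
  \sum_(1 <= n < N.+1) (num_divisors n)%:R * Z n =
  \sum_(1 <= j < N.+1) \sum_(1 <= k < N.+1) Z (j * k)%N.
Proof.
move=> Z0.
transitivity (\sum_(1 <= n < N.+1) \sum_(1 <= j < N.+1) \sum_(1 <= k < N.+1)
    if (j * k == n)%N then Z n else 0).
  apply: eq_big_nat => n /andP[n0 nN].
  transitivity (\sum_(1 <= j < N.+1) if (j %| n)%N then Z n else 0).
    rewrite -big_mkcond/= big_const_seq iter_addr_0 mulr_natl; congr (_ *+ _).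
    rewrite /num_divisors -size_filter; apply: perm_size.
    apply: uniq_perm; rewrite ?filter_uniq ?iota_uniq ?divisors_uniq// => d.
    rewrite mem_filter mem_index_iota -dvdn_divisors//.
    case: (boolP (d %| n)%N) => //= dn.
    by rewrite (dvdn_gt0 n0 dn)/= (leq_ltn_trans (dvdn_leq n0 dn)).
  apply: eq_big_nat => j /andP[j0 jN].
  case: (boolP (j %| n)%N) => [/dvdnP[k nE]|jn].
    have k0 : (0 < k)%N by move: n0; rewrite nE muln_gt0 => /andP[].
    rewrite (eq_bigr (fun k' => if (k == k')%N then Z n else 0)); last first.
      by move=> i _; rewrite nE mulnC eqn_pmul2r// eq_sym.
    rewrite (@big_nat_pick _ k N (fun=> Z n))//.
    by rewrite (leq_trans _ (_ : n <= N)%N)// nE leq_pmulr.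
  rewrite big1// => k _; case: eqP => // jkn.
  by move: jn; rewrite -jkn dvdn_mulr.
rewrite exchange_big/=; apply: eq_big_nat => j /andP[j0 _].
rewrite exchange_big/=; apply: eq_big_nat => k /andP[k0 _].
rewrite (@big_nat_pick _ (j * k) N Z) ?muln_gt0 ?j0//.
by case: leqP => // /Z0.
Qed.

Lemma sum_even (V : nmodType) (N : nat) (Y : nat -> V) :
  (forall n, (N < n)%N -> Y n = 0) ->
  \sum_(1 <= j < N.+1 | ~~ odd j) Y j = \sum_(1 <= i < N.+1) Y (2 * i)%N.
Proof.
move=> Y0.
transitivity (\sum_(1 <= j < N.+1) \sum_(1 <= i < N.+1)
    if (2 * i == j)%N then Y j else 0).
  rewrite big_mkcond/=; apply: eq_big_nat => j /andP[j0 jN].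
  case: (boolP (odd j)) => /= oj.
    rewrite big1// => i _; case: eqP => // e.
    by move: oj; rewrite -e mul2n odd_double.
  have jE : j = (2 * j./2)%N by rewrite mul2n -[LHS]odd_double_half (negbTE oj).
  have h0 : (0 < j./2)%N by rewrite -(ltn_pmul2l (ltn0Sn 1)) muln0 -jE.
  rewrite (eq_bigr (fun i => if (j./2 == i)%N then Y j else 0)); last first.
    by move=> i _; rewrite {1}jE eqn_pmul2l// eq_sym.
  rewrite (@big_nat_pick _ _ N (fun=> Y j))//.
  by rewrite (leq_trans _ (_ : j <= N)%N)// {2}jE leq_pmull.
rewrite exchange_big/=; apply: eq_big_nat => i /andP[i0 _].
rewrite (@big_nat_pick _ _ N Y) ?muln_gt0//.
by case: leqP => // /Y0.
Qed.

Lemma sum_alt (V : comNzRingType) (N : nat) (Y : nat -> V) :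
  (forall n, (N < n)%N -> Y n = 0) ->
  \sum_(1 <= j < N.+1) (alt j)%:~R * Y j =
  \sum_(1 <= j < N.+1) Y j - 2 * \sum_(1 <= j < N.+1) Y (2 * j)%N.
Proof.
move=> Y0; rewrite -(sum_even Y0) [in X in _ - X]big_mkcond/= mulr_sumr -sumrB.
apply: eq_bigr => j _; rewrite /alt rmorphXn/= rmorphN1 -signr_odd/=.
by case: odd => /=; rewrite ?expr0 ?expr1; ring.
Qed.

(** With the dilation n -> 2n in the role of 2^(-s), this is (1 - 2 * 2^(-s))^2 = 1 - 4 * 2^(-s) + 4
    * 4^(-s): [sum_alt], applied in [k] and then in [j], supplies the two factors. [Z] is [X] cut
    off at [N], which is how [eqn_psum] truncates by the index of the operator. *)
Lemma sum_altconvE (V : comNzRingType) (N : nat) (X Z : nat -> V) :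
  (forall n, (N < n)%N -> Z n = 0) -> (forall n, (n <= N)%N -> Z n = X n) ->
  \sum_(1 <= n < N.+1) (num_divisors n)%:R *
    (Z n - 4 * Z (2 * n)%N + 4 * Z (4 * n)%N) =
  \sum_(1 <= m < N.+1) (altconv m)%:~R * X m.
Proof.
move=> Z0 ZX.
have large c m n : (0 < c)%N -> (0 < m)%N -> (N < n)%N -> (N < c * (m * n))%N.
  move=> c0 m0 Nn; apply: (leq_trans Nn).
  by rewrite mulnA leq_pmull// muln_gt0 c0.
pose S c := \sum_(1 <= j < N.+1) \sum_(1 <= k < N.+1) Z (c * (j * k))%N.
have SE c : (0 < c)%N ->
    \sum_(1 <= n < N.+1) (num_divisors n)%:R * Z (c * n)%N = S c.
  move=> c0; apply: (sum_num_divisors (Z := fun n => Z (c * n)%N)) => n Nn.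
  by rewrite Z0// (leq_trans Nn)// leq_pmull.
transitivity (S 1%N - 4 * S 2%N + 4 * S 4%N).
  rewrite -!SE// !mulr_sumr -sumrB -big_split/=; apply: eq_bigr => n _.
  by rewrite mul1n; ring.
rewrite sum_altconv.
transitivity (\sum_(1 <= j < N.+1) (alt j)%:~R *
    \sum_(1 <= k < N.+1) (alt k)%:~R * Z (j * k)%N); last first.
  apply: eq_bigr => j _; rewrite mulr_sumr; apply: eq_bigr => k _.
  by case: leqP => jk; [rewrite ZX//|rewrite Z0//]; ring.
rewrite (eq_big_nat _ _ (F2 := fun j => (alt j)%:~R *
    (\sum_(1 <= k < N.+1) Z (j * k)%N -
     2 * \sum_(1 <= k < N.+1) Z (2 * (j * k))%N))); last first.
  move=> j /andP[j0 _]; rewrite (sum_alt (Y := fun k => Z (j * k)%N)); last first.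
    by move=> n Nn; rewrite Z0// (leq_trans Nn)// leq_pmull.
  by under [in X in _ - 2 * X]eq_bigr do rewrite mulnCA.
rewrite (sum_alt (Y := fun j => \sum_(1 <= k < N.+1) Z (j * k)%N -
     2 * \sum_(1 <= k < N.+1) Z (2 * (j * k))%N)); last first.
  have z c n : (0 < c)%N -> (N < n)%N -> \sum_(1 <= k < N.+1) Z (c * (n * k))%N = 0.
    move=> c0 Nn; rewrite big_nat_cond big1// => k /andP[/andP[k0 _] _].
    by rewrite Z0// (mulnC n) large.
  move=> n Nn; rewrite (z 2%N)// mulr0 subr0 -[RHS](z 1%N n)//.
  by apply: eq_bigr => k _; rewrite mul1n.
have S2 : \sum_(1 <= j < N.+1) \sum_(1 <= k < N.+1) Z (2 * j * k)%N = S 2%N.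
  by apply: eq_bigr => j _; apply: eq_bigr => k _; rewrite mulnA.
have S4 : \sum_(1 <= j < N.+1) \sum_(1 <= k < N.+1) Z (2 * (2 * j * k))%N = S 4%N.
  by apply: eq_bigr => j _; apply: eq_bigr => k _; rewrite !mulnA.
have S1 : \sum_(1 <= j < N.+1) \sum_(1 <= k < N.+1) Z (j * k)%N = S 1%N.
  by apply: eq_bigr => j _; apply: eq_bigr => k _; rewrite mul1n.
by rewrite !sumrB -!mulr_sumr S1 S2 S4 -/(S 2%N); ring.
Qed.

(** If jk <= N then j <= q or k <= q, since N < (q + 1)^2. The pairs with j <= q and those with k <=
    q contribute equally by symmetry, and their overlap, all of [1, q]^2 because q^2 <= N, has been
    counted twice. *)
Lemma hyperbola (V : comNzRingType) (N q : nat) (u : nat -> V) :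
  (q ^ 2 <= N)%N -> (N < q.+1 ^ 2)%N ->
  \sum_(1 <= j < N.+1) \sum_(1 <= k < N.+1)
    (if (j * k <= N)%N then u j * u k else 0) =
  2 * \sum_(1 <= j < q.+1) u j * \sum_(1 <= k < (N %/ j).+1) u k
  - (\sum_(1 <= j < q.+1) u j) ^+ 2.
Proof.
move=> qN Nq.
have leqN : (q <= N)%N.
  by apply: leq_trans qN; rewrite expnS expn1; case: q {Nq} => // q; rewrite leq_pmulr.
pose T j k := if (j * k <= N)%N then u j * u k else 0.
have low : \sum_(1 <= j < q.+1) u j * \sum_(1 <= k < (N %/ j).+1) u k =
    \sum_(1 <= j < N.+1) \sum_(1 <= k < N.+1) if (j <= q)%N then T j k else 0.
  rewrite (big_nat_widen _ q.+1 N.+1)//= big_mkcond/=.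
  apply: eq_big_nat => j /andP[j0 jN].
  rewrite ltnS; case: (leqP j q) => jq; last by rewrite big1.
  have Nj : ((N %/ j).+1 <= N.+1)%N by rewrite ltnS leq_div.
  rewrite mulr_sumr (big_nat_widen _ (N %/ j).+1 N.+1)//= big_mkcond/=.
  by apply: eq_bigr => k _; rewrite ltnS leq_divRL// /T mulnC.
have sq : (\sum_(1 <= j < q.+1) u j) ^+ 2 =
    \sum_(1 <= j < N.+1) \sum_(1 <= k < N.+1)
       if ((j <= q) && (k <= q))%N then T j k else 0.
  rewrite expr2 mulr_suml (big_nat_widen _ q.+1 N.+1)//= big_mkcond/=.
  apply: eq_big_nat => j /andP[j0 jN].
  rewrite ltnS; case: (leqP j q) => jq /=; last by rewrite big1.
  rewrite mulr_sumr (big_nat_widen _ q.+1 N.+1)//= big_mkcond/=.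
  apply: eq_bigr => k _; rewrite ltnS; case: leqP => // kq.
  by rewrite /T (leq_trans _ qN)// expnS expn1 leq_mul.
have low' : \sum_(1 <= j < N.+1) \sum_(1 <= k < N.+1)
      (if (j <= q)%N then T j k else 0) =
    \sum_(1 <= j < N.+1) \sum_(1 <= k < N.+1) if (k <= q)%N then T j k else 0.
  rewrite exchange_big/=; apply: eq_bigr => j _; apply: eq_bigr => k _.
  by rewrite /T mulnC [u k * _]mulrC.
rewrite sq low mulr_natl mulr2n {2}low' -big_split -sumrB/=.
apply: eq_bigr => j _; rewrite -big_split -sumrB/=; apply: eq_bigr => k _.
rewrite -/(T j k); case: (leqP j q) => jq; case: (leqP k q) => kq /=.
- by rewrite addrK.
- by rewrite addr0 subr0.
- by rewrite add0r subr0.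
- rewrite addr0 subr0 /T ifF//; apply/negbTE; rewrite -ltnNge.
  by apply: (leq_trans Nq); rewrite expnS expn1 leq_mul.
Qed.

Lemma sum_alt_partial (n : nat) :
  \sum_(1 <= k < n.+1) alt k = (odd n)%:R.
Proof.
elim: n => [|n IH]; first by rewrite big_geq.
rewrite big_nat_recr//= IH /alt -signr_odd/=.
by case: odd => /=.
Qed.

Lemma exists_sqrtn (N : nat) : exists q, (q ^ 2 <= N)%N /\ (N < q.+1 ^ 2)%N.
Proof.
have e0 : exists q, (q ^ 2 <= N)%N by exists 0%N.
have eb q : (q ^ 2 <= N)%N -> (q <= N)%N.
  by move=> qN; apply: leq_trans qN; rewrite expnS expn1; case: q => // q; rewrite leq_pmulr.
have [q qN qmax] := ex_maxnP e0 eb; exists q; split => //.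
by rewrite ltnNge; apply/negP => /qmax; rewrite ltnn.
Qed.

(** Every inner sum in [hyperbola] is 0 or 1, so the double sum is at most 2q + 1 in absolute value,
    and 1 <= q <= sqrt N turns this into 3 sqrt N. *)
Lemma sum_altconv_le (R : rcfType) (N : nat) :
  `|\sum_(1 <= m < N.+1) (altconv m)%:~R : R| <= 3 * Num.sqrt N%:R.
Proof.
have [q [qN Nq]] := exists_sqrtn N.
have [->|N0] := posnP N; first by rewrite big_geq// normr0 mulr_ge0// sqrtr_ge0.
have q0 : (0 < q)%N by case: q Nq {qN} => //; rewrite exp1n ltnS leqn0 => /eqP N0'; rewrite N0' in N0.
have qs : q%:R <= Num.sqrt N%:R :> R.
  by rewrite -(@ger0_norm _ q%:R)// -sqrtr_sqr ler_wsqrtr// -natrX ler_nat.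
have -> : \sum_(1 <= m < N.+1) (altconv m)%:~R =
    \sum_(1 <= m < N.+1) (altconv m)%:~R * 1 :> R.
  by apply: eq_bigr => m _; rewrite mulr1.
rewrite (sum_altconv N (fun=> 1)).
under eq_bigr do under eq_bigr do rewrite mulr1.
rewrite (hyperbola (fun j => (alt j)%:~R) qN Nq).
have E n : \sum_(1 <= k < n.+1) (alt k)%:~R = (odd n)%:R :> R.
  by rewrite -rmorph_sum sum_alt_partial; case: odd.
rewrite E (le_trans (ler_normB _ _))//.
apply: (@le_trans _ _ (2 * q%:R + 1)).
  apply: lerD; last by case: odd; rewrite /= ?expr0n ?expr1n ?normr0 ?normr1.
  rewrite normrM ger0_norm// ler_wpM2l//.
  apply: (le_trans (ler_norm_sum _ _ _)).
  apply: (@le_trans _ _ (\sum_(1 <= j < q.+1) 1)).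
    apply: ler_sum => j _; rewrite E /alt rmorphXn/= rmorphN1 normrM normrX normrN1 expr1n mul1r.
    by case: odd; rewrite ?normr0 ?normr1.
  by rewrite big_const_nat subn1/= iter_addr_0.
have : 1 <= q%:R :> R by rewrite ler1n.
lra.
Qed.

End HyperbolaMethod.

(** * Complex powers and the zeta function *)

Local Open Scope complex_scope.

Section ComplexPower.
Context {R : realType}.
Local Notation Re := (@complex.Re R).
Local Notation Im := (@complex.Im R).
Local Notation normc := (@Normc.normc R).
Implicit Types (x y : R) (z w c : R[i]).

Lemma ReD z w : Re (z + w) = Re z + Re w.
Proof. by case: z; case: w. Qed.

Lemma ImD z w : Im (z + w) = Im z + Im w.
Proof. by case: z; case: w. Qed.

Lemma ReN z : Re (- z) = - Re z.
Proof. by case: z. Qed.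

Lemma ReM z w : Re (z * w) = Re z * Re w - Im z * Im w.
Proof. by case: z; case: w. Qed.

Lemma ImM z w : Im (z * w) = Re z * Im w + Im z * Re w.
Proof. by case: z; case: w. Qed.

Lemma Re_real (a : R) z : Re (a%:C * z) = a * Re z.
Proof. by rewrite ReM/= mul0r subr0. Qed.

Lemma Im_real (a : R) z : Im (a%:C * z) = a * Im z.
Proof. by rewrite ImM/= mul0r addr0. Qed.

Lemma complex_ext z w : Re z = Re w -> Im z = Im w -> z = w.
Proof. by case: z; case: w => /= ? ? ? ? -> ->. Qed.

(** Reduces statements about imaginary parts to real parts of a constant multiple; this is the
    purpose of the free constant [c] in the lemmas below. *)
Lemma ImE z : Im z = Re (- 'i * z).
Proof. by case: z => a b; rewrite ReM/=; ring. Qed.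

Lemma normcE z : normc z = Num.sqrt (Re z ^+ 2 + Im z ^+ 2).
Proof. by case: z. Qed.

Lemma normc_ge0 z : 0 <= normc z.
Proof. by rewrite normcE sqrtr_ge0. Qed.

Lemma normc_real (a : R) : normc a%:C = `|a|.
Proof. by rewrite normcE/= expr0n/= addr0 sqrtr_sqr. Qed.

Lemma normc_ReIm z : normc z <= `|Re z| + `|Im z|.
Proof.
rewrite normcE -[leRHS]ger0_norm ?addr_ge0// -sqrtr_sqr ler_wsqrtr//.
rewrite sqrrD !real_normK ?num_real// -addrA lerD2l lerDr.
by rewrite mulrn_wge0// mulr_ge0.
Qed.

Lemma normcB_le z w : normc (z - w) <= normc z + normc w.
Proof. by rewrite -(normcN w); exact: le_normcD. Qed.

Lemma normc_sum_le (I : Type) (s : seq I) (P : pred I) (F : I -> R[i]) :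
  normc (\sum_(i <- s | P i) F i) <= \sum_(i <- s | P i) normc (F i).
Proof.
elim/big_rec2 : _ => [|i a b _ ab]; first by rewrite normc_real normr0.
by rewrite (le_trans (le_normcD _ _))// lerD2l.
Qed.

Lemma Re_le_normc z : `|Re z| <= normc z.
Proof. by rewrite normcE -sqrtr_sqr ler_wsqrtr// lerDl sqr_ge0. Qed.

Lemma Im_le_normc z : `|Im z| <= normc z.
Proof. by rewrite normcE -sqrtr_sqr ler_wsqrtr// lerDr sqr_ge0. Qed.

Lemma rcpowD x z w : rcpow x (z + w) = rcpow x z * rcpow x w.
Proof.
apply: complex_ext; rewrite /rcpow !(ReM, ImM)/= !ReD !ImD !mulrDl expRD;
  rewrite ?cosD ?sinD; ring.
Qed.

Lemma rcpowM x y z : 0 < x -> 0 < y -> rcpow (x * y) z = rcpow x z * rcpow y z.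
Proof.
move=> x0 y0; apply: complex_ext; rewrite /rcpow !(ReM, ImM)/= lnM// !mulrDr expRD;
  rewrite ?cosD ?sinD; ring.
Qed.

Lemma normc_rcpow x z : normc (rcpow x z) = expR (Re z * ln x).
Proof.
rewrite /rcpow Normc.normcM normc_real ger0_norm ?expR_ge0//.
by rewrite normcE/= cos2Dsin2 sqrtr1 mulr1.
Qed.

Lemma rcpow_1l z : rcpow 1 z = 1.
Proof. by rewrite /rcpow ln1 !mulr0 expR0 cos0 sin0 mul1r. Qed.

Lemma rcpow_real x (a : R) : 0 < x -> rcpow x a%:C = (expR (a * ln x))%:C.
Proof. by move=> x0; rewrite /rcpow /= mul0r cos0 sin0 mulr1. Qed.

Lemma rcpow_1 x : 0 < x -> rcpow x 1 = x%:C.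
Proof. by move=> x0; rewrite (rcpow_real 1)// mul1r lnK. Qed.

Lemma is_derive_Re_rcpow c z x : 0 < x ->
  is_derive x 1 (fun y => Re (c * rcpow y z)) (Re (c * z * rcpow x (z - 1))).
Proof.
move=> x0; have dl := is_derive1_ln x0.
have -> : (fun y => Re (c * rcpow y z)) = (fun y => expR (Re z * ln y) *
    (Re c * cos (Im z * ln y) - Im c * sin (Im z * ln y))).
  by apply/funext => y; rewrite /rcpow !(ReM, ImM)/=; ring.
have dz a : is_derive x 1 (fun y => a * ln y) (a * x^-1).
  exact: is_deriveZ.
have de := is_derive1_comp (is_derive_expR _) (dz (Re z)).
have dc := is_derive1_comp (is_derive_cos _) (dz (Im z)).
have ds := is_derive1_comp (is_derive_sin _) (dz (Im z)).
have dk := is_deriveB (is_deriveZ (Re c) dc) (is_deriveZ (Im c) ds).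
apply: (is_derive_eq (is_deriveM de dk)).
rewrite rcpowD.
have -> : rcpow x (- 1) = (x^-1)%:C.
  have /(congr1 (fun u => u / x%:C)) : rcpow x (-1) * rcpow x 1 = 1.
    by rewrite -rcpowD addNr (rcpow_real 0)// mul0r expR0.
  rewrite rcpow_1// mulfK ?mul1r ?fmorphV//.
  by rewrite fmorph_eq0 gt_eqF.
rewrite /rcpow !(ReM, ImM)/= /GRing.scale/= !fctE/= /GRing.scale/=; ring.
Qed.

End ComplexPower.

(** * Fundamental theorem of calculus and integrals of power tails *)

Section FTC.
Context {R : realType}.
Local Notation mu := (@lebesgue_measure R).

Lemma is_derive_continuous (f : R -> R) (x df : R) :
  is_derive x 1 f df -> {for x, continuous f}.
Proof.
by move=> [dx _]; apply/differentiable_continuous; rewrite -derivable1_diffP.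
Qed.

Lemma Rintegral_FTC (f F : R -> R) (a b : R) : a < b ->
  (forall x, a <= x <= b -> is_derive x 1 F (f x)) ->
  (forall x, a <= x <= b -> {for x, continuous f}) ->
  \int[mu]_(x in `[a, b]) f x = F b - F a.
Proof.
move=> ab dF cf.
have Fa := is_derive_continuous (dF a _).
have Fb := is_derive_continuous (dF b _).
rewrite /Rintegral (@continuous_FTC2 _ f F)//.
- apply: continuous_in_subspaceT => x; rewrite inE/= in_itv/= => xab.
  exact: cf.
- split.
  + move=> x; rewrite in_itv/= => /andP[ax xb].
    have axb : a <= x <= b by rewrite !ltW.
    by have [] := dF x axb.
  + by apply: cvg_at_right_filter; apply: Fa; rewrite lexx ltW.
  + by apply: cvg_at_left_filter; apply: Fb; rewrite lexx ltW.
- move=> x; rewrite in_itv/= => /andP[ax xb].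
  have axb : a <= x <= b by rewrite !ltW.
  by rewrite derive1E; have [_ ->] := dF x axb.
Qed.

Lemma cvg_expRN_ln (a : R) : 0 < a -> expR (- (a * ln x)) @[x --> +oo] --> (0 : R).
Proof.
move=> a0; apply/cvgr0Pnorm_le => e e0; near=> x.
rewrite ger0_norm ?expR_ge0// -(@lnK _ e)// ler_expR lerNl.
rewrite -ler_pdivrMl// mulrC -ler_expR.
have x0 : 0 < x by near: x; exact: nbhs_pinfty_gt.
by rewrite (@lnK _ x)//; near: x; exact: nbhs_pinfty_ge.
Unshelve. all: by end_near. Qed.

Lemma cvg_expRN_lnn (a : R) : 0 < a ->
  (fun n : nat => expR (- (a * ln n%:R))) @ \oo --> (0 : R).
Proof.
move=> a0; apply: (cvg_comp (fun n : nat => n%:R) (fun x => expR (- (a * ln x)))).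
  exact: cvgr_idn.
exact: cvg_expRN_ln.
Qed.

Lemma is_derive_power_tail (a x : R) : 0 < a -> 0 < x ->
  is_derive x 1 (fun x => - (expR (- (a * ln x)) / a)) (expR (- ((a + 1) * ln x))).
Proof.
move=> a0 x0; have dl := is_derive1_ln x0.
have dz : is_derive x 1 (fun y => (- a) * ln y) (- a * x^-1) by exact: is_deriveZ.
have de := is_derive1_comp (is_derive_expR _) dz.
have dk := is_deriveZ (- a^-1) de.
have -> : (fun x => - (expR (- (a * ln x)) / a)) =
    (fun y => - a^-1 * expR (- a * ln y)).
  by apply/funext => y; rewrite !mulNr [_ / a]mulrC.
apply: (is_derive_eq dk); rewrite /GRing.scale/=.
rewrite mulrDl mul1r opprD expRD [expR (- ln x)]expRN lnK// !mulNr.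
by field; rewrite !gt_eqF.
Qed.

Lemma integral_power_tail (a b : R) : 0 < a -> 0 < b ->
  (\int[mu]_(x in `[b, +oo[) (expR (- ((a + 1) * ln x)))%:E =
   (expR (- (a * ln b)) / a)%:E)%E.
Proof.
move=> a0 b0; have dF x : 0 < x -> _ := is_derive_power_tail a0.
rewrite (@ge0_continuous_FTC2y _ _ (fun x => - (expR (- (a * ln x)) / a)) _ 0).
- by rewrite -EFinB sub0r opprK.
- by move=> x _; exact: expR_ge0.
- apply: continuous_in_subspaceT => x; rewrite inE/= in_itv/= andbT => bx.
  have x0 : 0 < x by exact: lt_le_trans bx.
  apply: (@continuous_comp _ _ _ (fun x => - ((a + 1) * ln x)) expR); last exact: continuous_expR.
  apply: cvgN; apply: cvgM; first exact: cvg_cst.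
  exact: continuous_ln.
- rewrite -oppr0; apply: cvgN; rewrite -(mul0r a^-1); apply: cvgM; last exact: cvg_cst.
  exact: cvg_expRN_ln.
- by move=> x bx; have [] := dF x (lt_trans b0 bx).
- by apply: cvg_at_right_filter; exact: is_derive_continuous (dF b b0).
- move=> x; rewrite in_itv/= andbT => bx.
  by rewrite derive1E; have [_ ->] := dF x (lt_trans b0 bx).
Qed.

End FTC.

(** * Partial sums of the zeta series in the critical strip *)

Section ZetaPartialSums.
Context {R : realType}.
Local Notation mu := (@lebesgue_measure R).
Local Notation Re := (@complex.Re R).
Local Notation Im := (@complex.Im R).
Local Notation normc := (@Normc.normc R).
Variable s : R[i].
Hypothesis s_gt0 : 0 < Re s.
Hypothesis s_lt1 : Re s < 1.

Let g (x : R) := (x - (Num.floor x)%:~R)%:C * rcpow x (- s - 1).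
Let G (c : R[i]) (x : R) := Re (c * g x).
Let tail (x : R) := expR (- ((Re s + 1) * ln x)).

Let s0 : s != 0.
Proof. by apply: contraTN s_gt0 => /eqP ->; rewrite ltxx. Qed.

Let s1 : 1 - s != 0.
Proof.
by rewrite subr_eq0; apply: contraTN s_lt1 => /eqP <-; rewrite ltxx.
Qed.

Let GE c x : G c x = (x - (Num.floor x)%:~R) * Re (c * rcpow x (- s - 1)).
Proof. by rewrite /G /g mulrCA Re_real. Qed.

Let measurable_Re_rcpow c z : measurable_fun setT (fun x : R => Re (c * rcpow x z)).
Proof.
have -> : (fun y => Re (c * rcpow y z)) = (fun y => expR (Re z * ln y) *
    (Re c * cos (Im z * ln y) - Im c * sin (Im z * ln y))).
  by apply/funext => y; rewrite /rcpow !(ReM, ImM)/=; ring.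
have ml a : measurable_fun setT (fun y : R => a * ln y).
  by apply: measurable_funM => //; exact: measurable_ln.
apply: measurable_funM.
  by apply: measurableT_comp => //; exact: measurable_expR.
by apply: measurable_funB; apply: measurable_funM => //; apply: measurableT_comp => //;
  apply: continuous_measurable_fun; [exact: continuous_cos|exact: continuous_sin].
Qed.

Let mG c : measurable_fun setT (G c).
Proof.
have -> : G c = fun x => (x - (Num.floor x)%:~R) * Re (c * rcpow x (- s - 1)).
  by apply/funext => x; exact: GE.
apply: measurable_funM; last exact: measurable_Re_rcpow.
apply: measurable_funB => //.
apply: nondecreasing_measurable => // x y xy.
by rewrite ler_int le_floor.
Qed.

Let G_le c x : `|G c x| <= normc c * tail x.
Proof.
rewrite GE normrM -[leRHS]mul1r ler_pM//.
  have /andP[fx fx1] := floor_itv x.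
  rewrite ger0_norm ?subr_ge0// lerBlDr addrC.
  by move: fx1; rewrite rmorphD => /ltW.
rewrite (le_trans (Re_le_normc _))// Normc.normcM normc_rcpow /tail.
by rewrite ReD !ReN/=; rewrite -opprD mulNr.
Qed.

Let int_tail (b : R) : 0 < b -> mu.-integrable `[b, +oo[ (EFin \o tail).
Proof.
move=> b0; apply/integrableP; split.
  apply/measurable_EFinP/measurable_funTS/(measurableT_comp (@measurable_expR R)).
  by apply: measurable_funN; apply: measurable_funM => //; exact: measurable_ln.
have e x : (`|(EFin \o tail) x| = (expR (- ((Re s + 1) * ln x)))%:E)%E.
  by rewrite /= ger0_norm// expR_ge0.
under eq_integral do rewrite e.
by rewrite integral_power_tail// ltry.
Qed.

Let int_G c (b : R) : 0 < b -> mu.-integrable `[b, +oo[ (EFin \o G c).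
Proof.
move=> b0.
have ig : mu.-integrable `[b, +oo[ (fun x => (normc c)%:E * (EFin \o tail) x)%E.
  by apply: integrableZl => //; exact: int_tail.
apply: (le_integrable _ _ _ ig) => //.
- by apply/measurable_EFinP; apply: measurable_funTS; exact: mG.
- move=> x _ /=; rewrite lee_fin (le_trans (G_le c x))// ler_norm//.
Qed.

(** On [n, n + 1[ the fractional part is x - n, so [g x] is x^(-s) - n x^(-s-1); this is an
    antiderivative of it. *)
Let F (n : nat) (x : R) :=
  rcpow x (1 - s) / (1 - s) + n%:R * (rcpow x (- s) / s).

Let G_step c (n : nat) : (0 < n)%N ->
  \int[mu]_(x in `[n%:R, n.+1%:R[) G c x = Re (c * (F n n.+1%:R - F n n%:R)).
Proof.
move=> n0.
(* The continuous version of [G c] on the closed interval: the floor jumps at n + 1, where the two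
   may differ. *)
pose h x := Re (c * rcpow x (- s)) - n%:R * Re (c * rcpow x (- s - 1)).
have hpos (x : R) : n%:R <= x -> 0 < x by apply: lt_le_trans; rewrite ltr0n.
have dh c' z (x : R) : n%:R <= x ->
    {for x, continuous (fun y => Re (c' * rcpow y z))}.
  by move=> /hpos x0; exact: is_derive_continuous (is_derive_Re_rcpow c' z x0).
have ch (x : R) : n%:R <= x -> {for x, continuous h}.
  move=> nx; apply: cvgB; first exact: dh.
  by apply: cvgM; [exact: cvg_cst|exact: dh].
have hG (x : R) : n%:R <= x < n.+1%:R -> G c x = h x.
  move=> nx; have x0 : 0 < x by apply: hpos; case/andP: nx.
  rewrite GE (@floor_def _ _ n%:Z); last by rewrite -[(_ + _)%R]/(n + 1)%N%:Z addn1.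
  have e : x * Re (c * rcpow x (- s - 1)) = Re (c * rcpow x (- s)).
    by rewrite -Re_real -(rcpow_1 x0) mulrCA -rcpowD addrC subrK.
  by rewrite mulrBl e.
have -> : \int[mu]_(x in `[n%:R, n.+1%:R[) G c x = \int[mu]_(x in `[n%:R, n.+1%:R[) h x.
  by apply: eq_Rintegral => x; rewrite inE/= in_itv/=; exact: hG.
have inth : mu.-integrable `[n%:R, n.+1%:R] (EFin \o h).
  apply: continuous_compact_integrable; first exact: segment_compact.
  apply: continuous_in_subspaceT => x; rewrite inE/= in_itv/= => /andP[nx _].
  exact: ch.
rewrite Rintegral_itv_bndo_bndc; last first.
  by apply: integrableS inth => //; apply: subset_itvl; rewrite bnd_simp.
have dF (x : R) : n%:R <= x <= n.+1%:R -> is_derive x 1 (fun x => Re (c / (1 - s) * rcpow x (1 - s)) +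
    Re (n%:R * c / s * rcpow x (- s))) (h x).
  move=> /andP[nx _]; have x0 := hpos _ nx.
  have d1 := is_derive_Re_rcpow (c / (1 - s)) (1 - s) x0.
  have d2 := is_derive_Re_rcpow (n%:R * c / s) (- s) x0.
  apply: (is_derive_eq (is_deriveD d1 d2)).
  rewrite /h -ReD.
  have -> : n%:R * Re (c * rcpow x (- s - 1)) = Re (n%:R * (c * rcpow x (- s - 1))).
    by rewrite -Re_real rmorph_nat.
  rewrite -ReN -ReD; congr Re.
  have -> : 1 - s - 1 = - s by ring.
  by field; rewrite s0 s1.
have lt_n : n%:R < n.+1%:R :> R by rewrite ltr_nat.
rewrite (Rintegral_FTC lt_n dF); last by move=> x /andP[nx _]; exact: ch.
rewrite -!ReD -ReN -ReD /F; congr Re; ring.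
Qed.

(** By [G_psum], [s] times the integral of [g] over [1, N[ in closed form. *)
Let X (N : nat) := s / (1 - s) * (rcpow N%:R (1 - s) - 1) + rcpow N%:R (1 - s) -
  \sum_(1 <= n < N.+1) rcpow n%:R (- s).

Let rcpowS (n : nat) : (0 < n)%N -> rcpow (n%:R : R) (1 - s) = n%:R * rcpow n%:R (- s).
Proof. by move=> n0; rewrite rcpowD rcpow_1 ?ltr0n// rmorph_nat. Qed.

Let Xstep (n : nat) : (0 < n)%N -> X n.+1 = X n + s * (F n n.+1%:R - F n n%:R).
Proof.
move=> n0; rewrite /X /F [in LHS]big_nat_recr//=.
rewrite !rcpowS// -natr1.
set S := \sum_(_ <= _ < _) _; set p := rcpow _ (- s); set q := rcpow _ (- s).
by field; rewrite s0 s1.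
Qed.

Let G_psum c (N : nat) : (0 < N)%N ->
  \int[mu]_(x in `[1, N%:R[) G c x = Re (c * (X N / s)).
Proof.
elim: N => // -[_ _|n IH _].
  rewrite /X big_nat1 rcpow_1l subrr mulr0 add0r rcpow_1l subrr mul0r mulr0/=.
  by rewrite set_itvco0 Rintegral_set0.
have n1 : 1 <= n.+1%:R :> R by rewrite ler1n.
rewrite (@itv_bndbnd_setU _ _ _ (BLeft n.+1%:R)) ?bnd_simp ?ler_nat//.
rewrite Rintegral_setU//=.
- rewrite IH// G_step// -ReD -mulrDr (Xstep (ltn0Sn n)); congr (Re (_ * _)).
  by apply: (mulIf s0); rewrite mulfVK // mulrDl mulfVK // [_ * s]mulrC.
- rewrite -itv_bndbnd_setU ?bnd_simp ?ler_nat//.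
  apply: integrableS (int_G c (@ltr01 R)) => //.
  by apply: subset_itvl.
- apply/disj_setPS => y [/=]; rewrite 2!in_itv/= => /andP[_ yx] /andP[].
  by rewrite leNgt yx.
Qed.

(** The difference is exactly [s] times the tail from [N] on of the integral that defines [zeta]. A
    fractional part is at most 1, so each component of the tail is at most N^(-Re s) / Re s; the 2
    counts the two components. *)
Lemma zeta_psum (N : nat) : (0 < N)%N ->
  normc (\sum_(1 <= n < N.+1) rcpow n%:R (- s) - rcpow N%:R (1 - s) / (1 - s) - zeta s)
  <= normc s * (2 / Re s) * expR (- (Re s * ln N%:R)).
Proof.
move=> N0; have N1 : 1 <= N%:R :> R by rewrite ler1n.
have NR : 0 < N%:R :> R by rewrite ltr0n.
pose T := (\int[mu]_(x in `[N%:R, +oo[) G 1 x) +i* (\int[mu]_(x in `[N%:R, +oo[) G (- 'i) x).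
have split c : \int[mu]_(x in `[1, +oo[) G c x =
    Re (c * (X N / s)) + \int[mu]_(x in `[N%:R, +oo[) G c x.
  rewrite -G_psum// (@itv_bndbnd_setU _ _ _ (BLeft N%:R)) ?bnd_simp//.
  rewrite Rintegral_setU//=.
    by rewrite -itv_bndbnd_setU ?bnd_simp//; exact: int_G.
  apply/disj_setPS => y [/=]; rewrite 2!in_itv/= => /andP[_ yx] /andP[].
  by rewrite leNgt yx.
have cE : cintegral `[1%R, +oo[ g = X N / s + T.
  apply: complex_ext; rewrite /cintegral ?ReD ?ImD/=.
    rewrite -(mul1r (X N / s)) -split; apply: eq_Rintegral => x _.
    by rewrite /G mul1r.
  rewrite [Im (X N / s)]ImE -split; apply: eq_Rintegral => x _.
  by rewrite /G -ImE.
have -> : \sum_(1 <= n < N.+1) rcpow n%:R (- s) - rcpow N%:R (1 - s) / (1 - s) - zeta s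
    = s * T.
  rewrite /zeta -/g cE /X.
  set S := \sum_(_ <= _ < _) _; set p := rcpow _ _.
  have s1' : s - 1 != 0 by rewrite -opprB oppr_eq0.
  by field; rewrite s0 s1 s1'.
rewrite Normc.normcM -mulrA ler_wpM2l ?normc_ge0//.
have tE : \int[mu]_(x in `[N%:R, +oo[) tail x = expR (- (Re s * ln N%:R)) / Re s.
  by rewrite /Rintegral integral_power_tail.
have bound c : normc c = 1 -> `|\int[mu]_(x in `[N%:R, +oo[) G c x| <= expR (- (Re s * ln N%:R)) / Re s.
  move=> c1; rewrite -tE (le_trans (le_normr_Rintegral _ (int_G c NR)))//.
  apply: le_Rintegral => //; [exact: integrable_norm (int_G c NR)|exact: int_tail|].
  by move=> x _; rewrite (le_trans (G_le c x))// c1 mul1r.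
rewrite (le_trans (normc_ReIm _))//=.
apply: (le_trans (lerD (bound 1 _) (bound (- 'i) _))).
- by rewrite normc_real normr1.
- by rewrite normcE/= oppr0 expr0n/= add0r sqrrN expr1n sqrtr1.
by rewrite le_eqVlt; apply/orP; left; apply/eqP; ring.
Qed.

End ZetaPartialSums.

(** * The alternating zeta function and the Dirichlet series of its square *)

Section EtaFunction.
Context {R : realType}.
Local Notation Re := (@complex.Re R).
Local Notation Im := (@complex.Im R).
Local Notation normc := (@Normc.normc R).
Variable s : R[i].
Hypothesis s_gt0 : 0 < Re s.
Hypothesis s_lt1 : Re s < 1.

Definition eta (z : R[i]) : R[i] := (1 - 2 * rcpow 2 (- z)) * zeta z.

Let pw (n : nat) : R := expR (- (Re s * ln n%:R)).

Let pw_gt0 n : 0 < pw n. Proof. exact: expR_gt0. Qed.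

Let pwM m n : (0 < m)%N -> (0 < n)%N -> pw (m * n) = pw m * pw n.
Proof.
by move=> m0 n0; rewrite /pw natrM lnM ?posrE ?ltr0n// mulrDr opprD expRD.
Qed.

Let pw_le m n : (0 < m)%N -> (m <= n)%N -> pw n <= pw m.
Proof.
move=> m0 mn; rewrite ler_expR lerN2 ler_pM2l// ler_ln ?ler_nat// posrE ltr0n//.
exact: leq_trans mn.
Qed.

(** Doubling the argument costs at most a factor 2 because Re s < 1. This absorbs the roundings in N
    / 2, N / j and sqrt N below. *)
Let pw_half m n : (0 < m)%N -> (n <= 2 * m)%N -> (0 < n)%N -> pw m <= 2 * pw n.
Proof.
move=> m0 nm n0.
have := pw_le n0 nm; rewrite pwM// => h.
have p2 : 1 <= 2 * pw 2.
  have e2 : expR (ln 2) = 2 :> R by rewrite lnK ?posrE.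
  have l2 : 0 <= ln 2 :> R by rewrite ln_ge0// ler1n.
  have : 1 <= expR (ln 2 - Re s * ln 2).
    have -> : ln 2 - Re s * ln 2 = (1 - Re s) * ln 2 by ring.
    by rewrite -[X in X <= _]expR0 ler_expR mulr_ge0// subr_ge0 ltW.
  by rewrite expRD e2.
apply: (@le_trans _ _ (2 * (pw 2 * pw m))); last by rewrite ler_wpM2l.
by rewrite mulrA ler_peMl// ltW.
Qed.

Let normc_pw n : normc (rcpow n%:R (- s)) = pw n.
Proof. by rewrite normc_rcpow ReN mulNr. Qed.

Let u (n : nat) : R[i] := (alt n)%:~R * rcpow n%:R (- s).

Let normc_alt n : normc ((alt n)%:~R) = 1.
Proof.
rewrite /alt rmorphXn/= rmorphN1 -signr_odd; case: odd.
  by rewrite expr1 normcN Normc.normc1.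
by rewrite expr0 Normc.normc1.
Qed.

Let normc_u n : normc (u n) = pw n.
Proof. by rewrite Normc.normcM normc_alt mul1r normc_pw. Qed.

Let s1 : 1 - s != 0.
Proof.
by rewrite subr_eq0; apply: contraTN s_lt1 => /eqP <-; rewrite ltxx.
Qed.

Let Z (N : nat) := \sum_(1 <= n < N.+1) rcpow (n%:R : R) (- s).

Let eta_even (M : nat) : (0 < M)%N ->
  \sum_(1 <= n < (2 * M).+1) u n = Z (2 * M) - 2 * rcpow 2 (- s) * Z M.
Proof.
move=> M0.
pose Y n := if (n <= 2 * M)%N then rcpow (n%:R : R) (- s) else 0.
transitivity (\sum_(1 <= j < (2 * M).+1) (alt j)%:~R * Y j).
  by apply: eq_big_nat => j /andP[_]; rewrite ltnS /u /Y => ->.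
rewrite sum_alt; last by move=> n nM; rewrite /Y leqNgt nM.
congr (_ - _).
  by apply: eq_big_nat => j /andP[_]; rewrite ltnS /Y => ->.
rewrite -mulrA; congr (_ * _).
rewrite mulr_sumr [RHS](@big_nat_widen _ _ _ _ _ (2 * M).+1) ?ltnS ?leq_pmull//.
rewrite [RHS]big_mkcond/=; apply: eq_big_nat => j /andP[j0 _].
rewrite /Y leq_pmul2l// ltnS; case: ifP => // _.
by rewrite natrM rcpowM// ltr0n.
Qed.

Lemma eta_psum : exists2 C, 0 <= C & forall N, (0 < N)%N ->
  normc (\sum_(1 <= n < N.+1) u n - eta s) <= C * pw N.
Proof.
pose C1 := normc s * (2 / Re s).
have C1_ge0 : 0 <= C1 by rewrite mulr_ge0 ?normc_ge0// divr_ge0// ltW.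
have even M : (0 < M)%N ->
    normc (\sum_(1 <= n < (2 * M).+1) u n - eta s) <= 3 * C1 * pw (2 * M).
  move=> M0; rewrite eta_even//.
  (* In the combination of [D (2 * M)] and [D M] below, the growing terms N^(1-s) / (1 - s) cancel,
     because (2M)^(1-s) = 2 * 2^(-s) * M^(1-s). *)
  pose D N := Z N - rcpow N%:R (1 - s) / (1 - s) - zeta s.
  have -> : Z (2 * M) - 2 * rcpow 2 (- s) * Z M - eta s =
      D (2 * M)%N - 2 * rcpow 2 (- s) * D M.
    rewrite /D /eta natrM rcpowM ?ltr0n// [rcpow 2 (1 - s)]rcpowD rcpow_1// rmorph_nat.
    by field; exact: s1.
  rewrite (le_trans (normcB_le _ _))// Normc.normcM [normc (2 * _)]Normc.normcM.
  have -> : normc 2 = 2 by rewrite -(rmorph_nat (real_complex R)) normc_real ger0_norm.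
  rewrite [normc (rcpow _ _)](normc_pw 2).
  have := zeta_psum s_gt0 s_lt1 M0.
  have := zeta_psum s_gt0 s_lt1 (_ : 0 < 2 * M)%N; rewrite muln_gt0 => /(_ M0).
  rewrite -/(D _) -/(D _) -/C1 -/(pw _) -/(pw _) => h1 h2.
  apply: (le_trans (lerD h1 (ler_wpM2l _ h2))).
    by rewrite mulr_ge0// ltW.
  by rewrite pwM// le_eqVlt; apply/orP; left; apply/eqP; ring.
(* 6 C1 is the 3 C1 of the even lengths doubled by [pw_half], 1 pays for the last term of a sum of
   odd length, and the last summand for N = 1. *)
exists (6 * C1 + 1 + normc (1 - eta s)).
  by rewrite !addr_ge0// ?normc_ge0// mulr_ge0.
move=> N N0.
have Npw : normc (1 - eta s) * pw N >= 0 by rewrite mulr_ge0 ?normc_ge0// ltW.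
have Cpw : 0 <= C1 * pw N by rewrite mulr_ge0// ltW.
have [M0|M0] := posnP N./2.
  have -> : N = 1%N by case: N N0 M0 {Npw Cpw} => // -[|n].
  rewrite big_nat1 /u /alt expr2 mulrNN mulr1 mul1r rcpow_1l /pw ln1 mulr0 oppr0 expR0 mulr1.
  by rewrite lerDr addr_ge0// mulr_ge0.
have h := even _ M0.
have M2 : pw (2 * N./2) <= 2 * pw N.
  apply: pw_half => //; first by rewrite muln_gt0.
  by rewrite -{1}(odd_double_half N) -mul2n mulnA; case: odd; lia.
have h' : normc (\sum_(1 <= n < (2 * N./2).+1) u n - eta s) <= 6 * C1 * pw N.
  rewrite (le_trans h)//.
  have : C1 * pw (2 * N./2) <= C1 * (2 * pw N) by rewrite ler_wpM2l.
  lra.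
have Pp : 0 < pw N by [].
have NE : N = (odd N + 2 * N./2)%N by rewrite mul2n odd_double_half.
case: (boolP (odd N)) => oN.
  have NE' : N = (2 * N./2).+1 by rewrite {1}NE oN.
  have NEp : pw (2 * N./2).+1 = pw N by rewrite -NE'.
  have -> : \sum_(1 <= n < N.+1) u n =
      \sum_(1 <= n < (2 * N./2).+1) u n + u (2 * N./2).+1.
    by rewrite {1}NE' big_nat_recr.
  rewrite addrAC.
  rewrite (le_trans (le_normcD _ _))// normc_u NEp.
  nra.
rewrite {1}NE (negbTE oN) add0n.
nra.
Qed.

(** With U(n) the partial sums of eta, the hyperbola identity minus eta^2 rearranges to 2 sum_j u_j
    (U(N/j) - eta) - (U(q) - eta)^2. The factor j^(-Re s) and the error at N/j multiply to O(N^(-Re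
    s)), and there are q <= sqrt N such terms; this is where Re s > 1/2 enters. *)
Lemma altconv_psum_bound : 2^-1 < Re s -> exists K, forall N, (0 < N)%N ->
  normc (\sum_(1 <= m < N.+1) (altconv m)%:~R * rcpow (m%:R : R) (- s) - eta s ^+ 2)
    <= K * expR (- ((Re s - 2^-1) * ln N%:R)).
Proof.
move=> s_half; have [C C0 hC] := eta_psum.
exists (4 * C + 4 * C ^+ 2) => N N0.
have [q [qN Nq]] := exists_sqrtn N.
have q0 : (0 < q)%N by case: q Nq {qN} => //; rewrite exp1n ltnS leqn0 => /eqP N0'; rewrite N0' in N0.
pose U n := \sum_(1 <= k < n.+1) u k.
have -> : \sum_(1 <= m < N.+1) (altconv m)%:~R * rcpow (m%:R : R) (- s) - eta s ^+ 2 =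
    2 * \sum_(1 <= j < q.+1) u j * (U (N %/ j)%N - eta s) - (U q - eta s) ^+ 2.
  rewrite (sum_altconv N (fun m => rcpow (m%:R : R) (- s))).
  transitivity (\sum_(1 <= j < N.+1) \sum_(1 <= k < N.+1)
     (if (j * k <= N)%N then u j * u k else 0) - eta s ^+ 2).
    congr (_ - _); apply: eq_big_nat => j /andP[j0 _]; apply: eq_big_nat => k /andP[k0 _].
    case: ifP => // _; rewrite /u natrM rcpowM ?ltr0n//; ring.
  rewrite (hyperbola u qN Nq) -/(U q).
  under [in RHS]eq_bigr do rewrite mulrBr.
  rewrite sumrB -mulr_suml -/(U q).
  by rewrite /U; ring.
have jN j : (0 < j)%N -> (j <= q)%N -> (0 < N %/ j)%N /\ (N <= 2 * (j * (N %/ j)))%N.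
  move=> j0 jq.
  have jleN : (j <= N)%N.
    by apply: (leq_trans jq); apply: leq_trans qN; rewrite expnS expn1 leq_pmulr.
  have d0 : (0 < N %/ j)%N by rewrite divn_gt0.
  split => //; rewrite {1}(divn_eq N j).
  have := ltn_pmod N j0; rewrite (mulnC j).
  have : (j <= N %/ j * j)%N by rewrite leq_pmull.
  lia.
rewrite (le_trans (normcB_le _ _))// expr2 !Normc.normcM.
have -> : normc 2 = 2 by rewrite -(rmorph_nat (real_complex R)) normc_real ger0_norm.
have b1 : normc (\sum_(1 <= j < q.+1) u j * (U (N %/ j)%N - eta s)) <= q%:R * (2 * C * pw N).
  rewrite (le_trans (normc_sum_le _ _ _))//.
  apply: (@le_trans _ _ (\sum_(1 <= j < q.+1) (2 * C * pw N))); last first.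
    by rewrite sumr_const_nat subn1/= [leRHS]mulr_natl.
  rewrite big_nat_cond [leRHS]big_nat_cond.
  apply: ler_sum => j /andP[/andP[j0 jq] _].
  have [d0 Nd] := jN j j0 jq.
  rewrite Normc.normcM normc_u.
  apply: (le_trans (ler_wpM2l (ltW (pw_gt0 j)) (hC _ d0))).
  have -> : pw j * (C * pw (N %/ j)) = C * pw (j * (N %/ j)) by rewrite pwM//; ring.
  rewrite [2 * C]mulrC -mulrA ler_wpM2l//; apply: pw_half => //.
  by rewrite muln_gt0 j0.
have b2 : normc (U q - eta s) * normc (U q - eta s) <= C ^+ 2 * (4 * pw N).
  apply: (@le_trans _ _ (C * pw q * (C * pw q))).
    have := hC _ q0; rewrite -/(U q) => h; by apply: ler_pM; rewrite ?normc_ge0.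
  have -> : C * pw q * (C * pw q) = C ^+ 2 * pw (q * q) by rewrite pwM//; ring.
  rewrite ler_wpM2l ?sqr_ge0//.
  apply: (@le_trans _ _ (2 * pw (2 * (q * q)))).
    by apply: pw_half; rewrite ?muln_gt0 ?q0.
  have -> : 4 * pw N = 2 * (2 * pw N) by ring.
  rewrite ler_wpM2l//; apply: pw_half; rewrite ?muln_gt0 ?q0//.
  move: Nq; rewrite expnS expn1; nia.
have qp : q%:R * pw N <= expR (- ((Re s - 2^-1) * ln N%:R)).
  rewrite -(@lnK _ q%:R) ?posrE ?ltr0n// /pw -expRD ler_expR.
  have : ln (q%:R ^+ 2) <= ln N%:R :> R.
    by rewrite ler_ln ?posrE ?exprn_gt0 ?ltr0n// -natrX ler_nat.
  rewrite lnXn ?ltr0n//; lra.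
have pq : pw N <= q%:R * pw N.
  by rewrite ler_peMl ?ler1n// ltW.
have C2 : 0 <= C ^+ 2 by rewrite sqr_ge0.
have P0 := pw_gt0 N.
apply: (@le_trans _ _ ((4 * C + 4 * C ^+ 2) * (q%:R * pw N))); last first.
  by rewrite ler_wpM2l// addr_ge0// mulr_ge0.
apply: (le_trans (lerD (ler_wpM2l _ b1) b2)) => //.
have : C ^+ 2 * pw N <= C ^+ 2 * (q%:R * pw N) by rewrite ler_wpM2l.
lra.
Qed.

Lemma altconv_psum_cvg : 2^-1 < Re s ->
  (fun N => normc (\sum_(1 <= m < N.+1) (altconv m)%:~R * rcpow (m%:R : R) (- s)
     - eta s ^+ 2)) @ \oo --> (0 : R).
Proof.
move=> s_half; have [K hK] := altconv_psum_bound s_half.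
have s2 : 0 < Re s - 2^-1 by rewrite subr_gt0.
apply: (@squeeze_cvgr _ _ _ _ (cst 0) (fun N => K * expR (- ((Re s - 2^-1) * ln N%:R)))).
- near=> N; rewrite normc_ge0/=; apply: hK.
  by near: N; exact: nbhs_infty_gt.
- exact: cvg_cst.
- by rewrite -(mulr0 K); apply: cvgMr; exact: cvg_expRN_lnn.
Unshelve. all: by end_near. Qed.

End EtaFunction.

(** The extra factor can vanish only where |2^(1-s)| = 1, that is on Re s = 1. *)
Lemma eta_neq0 (R : realType) (s : R[i]) : complex.Re s < 1 -> zeta s <> 0 -> eta s != 0.
Proof.
move=> s_lt1 /eqP zs; rewrite mulf_neq0// subr_eq0 eq_sym.
apply/eqP => /(congr1 (@Normc.normc R)).
rewrite Normc.normcM Normc.normc1 normc_rcpow.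
have -> : Normc.normc 2 = 2 :> R by rewrite -(rmorph_nat (real_complex R)) normc_real ger0_norm.
have e2 : expR (ln 2) = 2 :> R by rewrite lnK ?posrE.
have l2 : 0 < ln 2 :> R by rewrite ln_gt0// ltr1n.
rewrite -[X in X * _]e2 -expRD ReN => /(congr1 (@ln R)); rewrite expRK ln1.
nra.
Qed.

(** * Fourier transforms of exponentially decaying functions *)

Section RealLineIntegrability.
Context {R : realType}.
Local Notation mu := (@lebesgue_measure R).
Local Notation L1 f := (mu.-integrable setT (EFin \o f)).
Implicit Types f g h : R -> R.

Lemma integrable_even f : (forall x, 0 <= f x) -> continuous f ->
  (forall x, f (- x) = f x) -> (\int[mu]_(x in `[0%R, +oo[) (f x)%:E < +oo)%E -> L1 f.
Proof.
move=> f0 cf fe fi; apply/integrableP; split.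
  by apply/measurable_EFinP; exact: continuous_measurable_fun.
have -> : (\int[mu]_x `|(EFin \o f) x| = \int[mu]_x (f x)%:E)%E.
  by apply: eq_integral => x _ /=; rewrite ger0_norm.
rewrite ge0_symfun_integralT//; last by move=> x /=; rewrite fe.
by rewrite -set_itvcy lte_mul_pinfty.
Qed.

Lemma integrable_expR_abs (e : R) : 0 < e -> L1 (fun x => expR (- (e * `|x|))).
Proof.
move=> e0; apply: integrable_even.
- by move=> x; exact: expR_ge0.
- move=> x; apply: continuous_comp; last exact: continuous_expR.
  apply: cvgN; apply: cvgM; first exact: cvg_cst.
  exact: norm_continuous.
- by move=> x; rewrite normrN.
have -> : (\int[mu]_(x in `[0%R, +oo[) (expR (- (e * `|x|)))%:E =
    \int[mu]_(x in `[0%R, +oo[) (expR (- (e * x)))%:E)%E.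
  by apply: eq_integral => x; rewrite inE/= in_itv/= andbT => x0; rewrite ger0_norm.
have dF (x : R) : is_derive x 1 (fun x => - (expR (- (e * x)) / e)) (expR (- (e * x))).
  have dz : is_derive x 1 (fun y => (- e) * y) (- e * 1) by exact: is_deriveZ.
  have de := is_derive1_comp (is_derive_expR _) dz.
  have dk := is_deriveZ (- e^-1) de.
  have -> : (fun x => - (expR (- (e * x)) / e)) = (fun y => - e^-1 * expR (- e * y)).
    by apply/funext => y; rewrite !mulNr [_ / e]mulrC.
  apply: (is_derive_eq dk); rewrite /GRing.scale/= !mulNr.
  by field; rewrite gt_eqF.
rewrite (@ge0_continuous_FTC2y _ _ (fun x => - (expR (- (e * x)) / e)) _ 0).
- by rewrite -EFinB ltry.
- by move=> x _; exact: expR_ge0.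
- apply: continuous_subspaceT => x.
  apply: continuous_comp; last exact: continuous_expR.
  by apply: cvgN; apply: cvgM; [exact: cvg_cst|exact: cvg_id].
- rewrite -oppr0; apply: cvgN; rewrite -(mul0r e^-1); apply: cvgM; last exact: cvg_cst.
  apply/cvgr0Pnorm_le => d d0; near=> x.
  rewrite ger0_norm ?expR_ge0// -(@lnK _ d)// ler_expR lerNl.
  rewrite -ler_pdivrMl//; near: x; apply: nbhs_pinfty_ge; exact: num_real.
- by move=> x _; have [] := dF x.
- by apply: cvg_at_right_filter; exact: is_derive_continuous (dF 0).
- by move=> x _; rewrite derive1E; have [_ ->] := dF x.
Unshelve. all: by end_near. Qed.

Lemma integrable_oneDsqr : L1 (fun x => (1 + x ^+ 2)^-1).
Proof.
apply: integrable_even.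
- by move=> x; rewrite invr_ge0 addr_ge0// sqr_ge0.
- exact: continuous_oneDsqrV.
- by move=> x; rewrite sqrrN.
- have -> : (\int[mu]_(x in `[0%R, +oo[) ((1 + x ^+ 2)^-1)%:E = (pi / 2)%:E)%E.
    exact: integral0y_oneDsqr.
  by rewrite ltry.
Qed.

(* Stable under multiplication by the variable, so every moment is integrable. *)
Definition exp_decay h := measurable_fun setT h /\
  exists2 e, 0 < e & exists K, forall x, `|h x| <= K * expR (- (e * `|x|)).

Lemma exp_decay_L1 h : exp_decay h -> L1 h.
Proof.
move=> [mh [e e0 [K hK]]]; apply: L1_le hK => //.
by apply: L1Zl; exact: integrable_expR_abs.
Qed.

Lemma exp_decay_mul h : exp_decay h -> exp_decay (fun x => x * h x).
Proof.
move=> [mh [e e0 [K hK]]]; split; first exact: measurable_funM.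
exists (e / 2); first by rewrite divr_gt0.
exists (2 / e * K) => x.
have e2 : 0 < e / 2 by rewrite divr_gt0.
have K0 : 0 <= K.
  by have := le_trans (normr_ge0 _) (hK 0); rewrite pmulr_lge0// expR_gt0.
have hx : `|x| <= 2 / e * expR (e / 2 * `|x|).
  have := expR_ge1Dx (e / 2 * `|x|) => h1.
  rewrite -ler_pdivrMl ?divr_gt0//.
  have -> : (2 / e)^-1 * `|x| = e / 2 * `|x| by rewrite invf_div.
  by apply: le_trans h1; rewrite lerDr.
rewrite normrM (le_trans (ler_pM _ _ hx (hK x)))//.
have -> : - (e * `|x|) = - (e / 2 * `|x|) + - (e / 2 * `|x|) by field.
rewrite expRD; have -> : 2 / e * expR (e / 2 * `|x|) *
  (K * (expR (- (e / 2 * `|x|)) * expR (- (e / 2 * `|x|)))) =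
  2 / e * K * expR (- (e / 2 * `|x|)) * (expR (e / 2 * `|x|) * expR (- (e / 2 * `|x|))).
  by ring.
by rewrite expRxMexpNx_1 mulr1.
Qed.

Lemma mfun_cos (a : R) : measurable_fun setT (fun t : R => cos (a * t)).
Proof.
apply: measurableT_comp; first by apply: continuous_measurable_fun; exact: continuous_cos.
exact: measurable_funM.
Qed.

Lemma mfun_sin (a : R) : measurable_fun setT (fun t : R => sin (a * t)).
Proof.
apply: measurableT_comp; first by apply: continuous_measurable_fun; exact: continuous_sin.
exact: measurable_funM.
Qed.

Lemma L1_cos h (a : R) : L1 h -> L1 (fun t => h t * cos (a * t)).
Proof.
move=> ih; apply: (@L1_bounded_mul _ _ _ 1) => //; first exact: mfun_cos.
by move=> x; exact: cos_max.
Qed.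

Lemma L1_sin h (a : R) : L1 h -> L1 (fun t => h t * sin (a * t)).
Proof.
move=> ih; apply: (@L1_bounded_mul _ _ _ 1) => //; first exact: mfun_sin.
by move=> x; exact: sin_max.
Qed.

(** The real and, in [sinT], the imaginary part of the integral of h(t) e^(ixt). *)
Definition cosT h (x : R) := \int[mu]_t (h t * cos (x * t)).
Definition sinT h (x : R) := \int[mu]_t (h t * sin (x * t)).

Lemma is_derive_under_Rintegral (F G : R -> R -> R) (P : R -> R) (a : R) :
  (forall x, L1 (F x)) -> (forall (x : R) t, is_derive x 1 (F ^~ t) (G x t)) ->
  L1 P -> (forall x t, `|G x t| <= P t) ->
  is_derive a 1 (fun x => \int[mu]_t F x t) (\int[mu]_t G a t).
Proof.
move=> iF dF iP GP.
have aI : `]a - 1, a + 1[%classic a.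
  by rewrite /= in_itv/=; apply/andP; split; [rewrite ltrBlDr ltrDl|rewrite ltrDl].
have iF' (x : R) : `]a - 1, a + 1[%classic x -> mu.-integrable setT (EFin \o F x) by [].
have dE (x t : R) : derive1 (F ^~ t) x = G x t.
  by rewrite derive1E; have [_ ->] := dF x t.
have dF' (x t : R) : `]a - 1, a + 1[%classic x -> setT t -> derivable (F ^~ t) x 1.
  by move=> _ _; have [] := dF x t.
have P0 t : 0 <= P t by exact: le_trans (normr_ge0 _) (GP 0 t).
have GP' (x t : R) : `]a - 1, a + 1[%classic x -> setT t -> `|derive1 (F ^~ t) x| <= P t.
  by move=> _ _; rewrite dE.
apply: DeriveDef.
  exact: (derivable_under_integral measurableT aI iF' dF' P0 iP GP').
rewrite -derive1E.
rewrite (differentiation_under_integral measurableT aI iF' dF' P0 iP GP').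
by apply: eq_Rintegral => t _; exact: dE.
Qed.

Lemma is_derive_cosT h (a : R) : L1 h -> L1 (fun t => t * h t) ->
  is_derive a 1 (cosT h) (- sinT (fun t => t * h t) a).
Proof.
move=> ih ith.
have -> : - sinT (fun t => t * h t) a = \int[mu]_t (- (t * h t * sin (a * t))).
  rewrite /sinT -mulN1r -RintegralZl//; last exact: L1_sin.
  by apply: eq_Rintegral => t _; rewrite mulN1r.
apply: (@is_derive_under_Rintegral (fun x t => h t * cos (x * t))
  (fun x t => - (t * h t * sin (x * t))) (fun t => `|t * h t|)).
- by move=> x; exact: L1_cos.
- move=> x t.
  have dz : is_derive x 1 (fun y => y * t) t.
    have := is_deriveZ t (is_derive_id x (1 : R)); rewrite /GRing.scale/= mulr1.
    by move=> d; apply: is_derive_eq; rewrite ?/GRing.scale/= ?mulr1 ?mulr0 ?add0r.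
  have dc := is_deriveZ (h t) (is_derive1_comp (is_derive_cos _) dz).
  by apply: (is_derive_eq dc); rewrite /GRing.scale/=; ring.
- exact: integrable_norm.
- move=> x t; rewrite normrN normrM -[leRHS]mulr1 ler_wpM2l//; exact: sin_max.
Qed.

Lemma is_derive_sinT h (a : R) : L1 h -> L1 (fun t => t * h t) ->
  is_derive a 1 (sinT h) (cosT (fun t => t * h t) a).
Proof.
move=> ih ith.
apply: (@is_derive_under_Rintegral (fun x t => h t * sin (x * t))
  (fun x t => t * h t * cos (x * t)) (fun t => `|t * h t|)).
- by move=> x; exact: L1_sin.
- move=> x t.
  have dz : is_derive x 1 (fun y => y * t) t.
    have := is_deriveZ t (is_derive_id x (1 : R)); rewrite /GRing.scale/= mulr1.
    by move=> d; apply: is_derive_eq; rewrite ?/GRing.scale/= ?mulr1 ?mulr0 ?add0r.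
  have dc := is_deriveZ (h t) (is_derive1_comp (is_derive_sin _) dz).
  by apply: (is_derive_eq dc); rewrite /GRing.scale/=; ring.
- exact: integrable_norm.
- move=> x t; rewrite normrM -[leRHS]mulr1 ler_wpM2l//; exact: cos_max.
Qed.

(** The derivatives are explicit witnesses on the whole line, so closure under products and inverses
    is plain [is_derive] calculus, and the end points of a window need no one-sided derivatives. *)
Definition C2 f := exists f1 f2 : R -> R,
  [/\ forall x : R, is_derive x 1 f (f1 x), forall x : R, is_derive x 1 f1 (f2 x) &
      continuous f2].

Lemma is_derive_continuousT f f1 : (forall x : R, is_derive x 1 f (f1 x)) -> continuous f.
Proof. by move=> df x; exact: is_derive_continuous (df x). Qed.

Lemma C2_cosT h : exp_decay h -> C2 (cosT h).
Proof.
move=> h0; have h1 := exp_decay_mul h0; have h2 := exp_decay_mul h1.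
have h3 := exp_decay_mul h2.
have [i0 i1 i2 i3] := And4 (exp_decay_L1 h0) (exp_decay_L1 h1) (exp_decay_L1 h2) (exp_decay_L1 h3).
exists (fun a => - sinT (fun t => t * h t) a), (fun a => - cosT (fun t => t * (t * h t)) a).
split=> [x|x|].
- exact: is_derive_cosT.
- exact: is_deriveN (is_derive_sinT x i1 i2).
- apply: is_derive_continuousT => x.
  exact: is_deriveN (is_derive_cosT x i2 i3).
Qed.

Lemma C2_sinT h : exp_decay h -> C2 (sinT h).
Proof.
move=> h0; have h1 := exp_decay_mul h0; have h2 := exp_decay_mul h1.
have h3 := exp_decay_mul h2.
have [i0 i1 i2 i3] := And4 (exp_decay_L1 h0) (exp_decay_L1 h1) (exp_decay_L1 h2) (exp_decay_L1 h3).
exists (fun a => cosT (fun t => t * h t) a), (fun a => - sinT (fun t => t * (t * h t)) a).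
split=> [x|x|].
- exact: is_derive_sinT.
- exact: is_derive_cosT.
- apply: is_derive_continuousT => x.
  exact: is_deriveN (is_derive_sinT x i2 i3).
Qed.

Lemma C2_add f g : C2 f -> C2 g -> C2 (fun x => f x + g x).
Proof.
move=> [f1 [f2 [df df1 cf]]] [g1 [g2 [dg dg1 cg]]].
exists (fun x => f1 x + g1 x), (fun x => f2 x + g2 x); split=> [x|x|x].
- exact: is_deriveD.
- exact: is_deriveD.
- by apply: cvgD; [exact: cf|exact: cg].
Qed.

Lemma C2_mul f g : C2 f -> C2 g -> C2 (fun x => f x * g x).
Proof.
move=> [f1 [f2 [df df1 cf]]] [g1 [g2 [dg dg1 cg]]].
have M (a a1 b b1 : R -> R) : (forall x : R, is_derive x 1 a (a1 x)) -> (forall x : R, is_derive x 1 b (b1 x)) ->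
    forall x : R, is_derive x (1 : R) (fun x => a x * b x : R) (a x * b1 x + b x * a1 x).
  by move=> da db x; exact: is_deriveM (da x) (db x).
exists (fun x => f x * g1 x + g x * f1 x).
exists (fun x => (f x * g2 x + g1 x * f1 x) + (g x * f2 x + f1 x * g1 x)); split=> [x|x|].
- exact: M.
- exact: is_deriveD (M _ _ _ _ df dg1 x) (M _ _ _ _ dg df1 x).
- have [Cf Cg] := (is_derive_continuousT df, is_derive_continuousT dg).
  have [Cf1 Cg1] := (is_derive_continuousT df1, is_derive_continuousT dg1).
  by move=> x; apply: cvgD; apply: cvgD; apply: cvgM;
    solve [exact: Cf|exact: Cg|exact: Cf1|exact: Cg1|exact: cf|exact: cg].
Qed.

Lemma C2_inv f : (forall x, f x != 0) -> C2 f -> C2 (fun x => (f x)^-1).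
Proof.
move=> f0 [f1 [f2 [df df1 cf]]].
have V (x : R) : is_derive x 1 (fun x => (f x)^-1) (- (f x) ^- 2 * f1 x).
  exact: is_deriveV (f0 x) (df x).
have Cf := is_derive_continuousT df.
have Cf1 := is_derive_continuousT df1.
have CV := is_derive_continuousT V.
exists (fun x => - ((f x)^-1 * ((f x)^-1 * f1 x))).
exists (fun x => - ((f x)^-1 * ((f x)^-1 * f2 x + f1 x * (- (f x) ^- 2 * f1 x)) +
                    ((f x)^-1 * f1 x) * (- (f x) ^- 2 * f1 x))).
split=> [x|x|x].
- by apply: (is_derive_eq (V x)); field; exact: f0.
- have d1 := is_deriveM (V x) (df1 x).
  have d2 := is_deriveN (is_deriveM (V x) d1).
  exact: (is_derive_eq d2).
- have cM (a b : R -> R) : {for x, continuous a} -> {for x, continuous b} ->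
    {for x, continuous (fun y => a y * b y)} by move=> ca cb; exact: cvgM.
  have cA (a b : R -> R) : {for x, continuous a} -> {for x, continuous b} ->
    {for x, continuous (fun y => a y + b y)} by move=> ca cb; exact: cvgD.
  have cN (a : R -> R) : {for x, continuous a} ->
    {for x, continuous (fun y => - a y)} by move=> ca; exact: cvgN.
  have cV2 : {for x, continuous (fun y => - (f y) ^- 2 * f1 y)}.
    apply: (cM); last exact: Cf1.
    have -> : (fun y => - (f y) ^- 2) = (fun y => - ((f y)^-1 * (f y)^-1)).
      by apply/funext => y; rewrite expr2 invfM.
    by apply: (cN); apply: (cM); exact: CV.
  apply: (cN); apply: (cA).
    apply: (cM); first exact: CV.
    by apply: (cA); apply: (cM) => //; [exact: CV|exact: cf|exact: Cf1].
  by apply: (cM) => //; apply: (cM); [exact: CV|exact: Cf1].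
Qed.

Lemma C2_affine (a b : R) : C2 (fun x => a + b * x).
Proof.
exists (fun=> b), (fun=> 0); split=> [x|x|x].
- have := is_deriveD (is_derive_cst a x (1 : R)) (is_deriveZ b (is_derive_id x (1 : R))).
  by move=> d; apply: (is_derive_eq d); rewrite /GRing.scale/= mulr1 add0r.
- exact: is_derive_cst.
- exact: cvg_cst.
Qed.

Lemma abs_sin_le (x : R) : `|sin x| <= `|x|.
Proof.
have pos (y : R) : 0 < y -> `|sin y| <= y.
  move=> y0.
  have dS (z : R) : z \in `]0, y[ -> is_derive z 1 sin (cos z) by move=> _; exact: is_derive_sin.
  have cS : {within `[0, y], continuous (@sin R)}.
    by apply: continuous_subspaceT => z; exact: continuous_sin.
  have [c _] := MVT y0 dS cS.
  rewrite sin0 !subr0 => ->; by rewrite normrM (gtr0_norm y0) ler_piMl ?cos_max// ltW.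
have [x0|x0|->] := ltgtP x 0.
- by rewrite -normrN -sinN (ltr0_norm x0) pos// oppr_gt0.
- by rewrite (gtr0_norm x0) pos.
- by rewrite sin0 normr0.
Qed.

Lemma cos_ge (x : R) : 1 - x ^+ 2 / 2 <= cos x.
Proof.
have [y ->] : exists y, x = y *+ 2 by exists (x / 2); rewrite mulr2n; field.
rewrite cos_mulr2n cos2sin2.
have : sin y ^+ 2 <= y ^+ 2.
  by rewrite -(real_normK (num_real (sin y))) -(real_normK (num_real y)) lerXn2r ?nnegrE// abs_sin_le.
have -> : (y *+ 2) ^+ 2 / 2 = 2 * y ^+ 2 by rewrite [y *+ 2]mulr2n; field.
move: (sin y ^+ 2) (y ^+ 2) => a b h; lra.
Qed.

End RealLineIntegrability.

(** * Wiener's theorem for exponentially decaying kernels *)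

Section SpectralSynthesis.
Context {R : realType}.
Local Notation mu := (@lebesgue_measure R).
Local Notation L1 f := (mu.-integrable setT (EFin \o f)).
Implicit Types f g h : R -> R.

Lemma L1_restrict f (D : set R) : measurable D -> mu.-integrable D (EFin \o f) -> L1 (f \_ D).
Proof.
move=> mD fi; rewrite -restrict_EFin.
exact: ((integrable_mkcond (mu := mu) (EFin \o f) mD).1 fi).
Qed.

Lemma continuous_L1_itv f (a b : R) : continuous f -> mu.-integrable `[a, b] (EFin \o f).
Proof.
move=> cf; apply: continuous_compact_integrable; first exact: segment_compact.
exact: continuous_subspaceT.
Qed.

Lemma L1_window f (a b : R) : continuous f -> L1 (f \_ `[a, b]).
Proof. by move=> cf; apply: L1_restrict => //; exact: continuous_L1_itv. Qed.

Lemma L1_window_mul f (a b : R) : continuous f -> L1 (fun t => t * (f \_ `[a, b]) t).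
Proof.
move=> cf.
have -> : (fun t => t * (f \_ `[a, b]) t) = (fun t => t * f t) \_ `[a, b].
  by apply/funext => t; rewrite !patchE; case: ifP; rewrite ?mulr0.
by apply: L1_window => x; apply: cvgM; [exact: cvg_id|exact: cf].
Qed.

Lemma window_transformE (G1 G2 : R -> R) (L t : R) : continuous G1 -> continuous G2 ->
  cosT (G1 \_ `[0, L]) t - sinT (G2 \_ `[0, L]) t =
  \int[mu]_(x in `[0, L]) (G1 x * cos (t * x) - G2 x * sin (t * x)).
Proof.
move=> c1 c2; rewrite /cosT /sinT -RintegralB//; last 2 first.
- by apply: L1_cos; exact: L1_window.
- by apply: L1_sin; exact: L1_window.
rewrite [RHS]Rintegral_mkcond; apply: eq_Rintegral => x _.
by rewrite !patchE; case: ifP; rewrite ?mul0r ?subr0.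
Qed.

(* Two integrations by parts; the boundary terms of order [t^-1] cancel. *)
Lemma window_transform_decay (G1 G2 : R -> R) (L : R) : 0 < L -> C2 G1 -> C2 G2 ->
  G1 L = 0 -> G2 L = 0 -> G2 0 = 0 ->
  exists K, forall t,
    `|cosT (G1 \_ `[0, L]) t - sinT (G2 \_ `[0, L]) t| <= K * (1 + t ^+ 2)^-1.
Proof.
move=> L0 [g1 [h1 [dG1 dg1 ch1]]] [g2 [h2 [dG2 dg2 ch2]]] G1L G2L G20.
have c1 := is_derive_continuousT dG1; have c2 := is_derive_continuousT dG2.
pose K0 := \int[mu]_(x in `[0, L]) (`|G1 x| + `|G2 x|).
pose K2 := \int[mu]_(x in `[0, L]) (`|h1 x| + `|h2 x|).
pose K1 := `|g1 L| + `|g2 L| + `|g1 0|.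
have cosc (t : R) : continuous (fun x : R => cos (t * x)).
  move=> x; apply: (@continuous_comp _ _ _ (fun x => t * x) cos); last exact: continuous_cos.
  by apply: cvgM; [exact: cvg_cst|exact: cvg_id].
have sinc (t : R) : continuous (fun x : R => sin (t * x)).
  move=> x; apply: (@continuous_comp _ _ _ (fun x => t * x) sin); last exact: continuous_sin.
  by apply: cvgM; [exact: cvg_cst|exact: cvg_id].
have cc (a b : R -> R) (t : R) : continuous a -> continuous b ->
    continuous (fun x : R => a x * cos (t * x) - b x * sin (t * x)).
  move=> ca cb x; apply: cvgB; apply: cvgM.
  - exact: ca.
  - exact: cosc.
  - exact: cb.
  - exact: sinc.
have bound (a b : R -> R) t : continuous a -> continuous b ->
    `|\int[mu]_(x in `[0, L]) (a x * cos (t * x) - b x * sin (t * x))| <=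
    \int[mu]_(x in `[0, L]) (`|a x| + `|b x|).
  move=> ca cb.
  have i1 := @continuous_L1_itv _ 0 L (cc a b t ca cb).
  apply: (le_trans (le_normr_Rintegral _ i1)) => //.
  apply: le_Rintegral => //.
  - exact: integrable_norm.
  - apply: continuous_L1_itv => x; apply: cvgD.
      by apply: cvg_norm; exact: ca.
    by apply: cvg_norm; exact: cb.
  - move=> x _; rewrite (le_trans (ler_normB _ _))// !normrM.
    by apply: lerD; rewrite ler_piMr ?cos_max ?sin_max.
exists (K0 + (K1 + K2)) => t.
rewrite window_transformE//.
set psi := \int[mu]_(x in _) _.
rewrite ler_pdivlMr; last by rewrite ltr_pwDl// sqr_ge0.
rewrite mulrDr mulr1; apply: lerD; first exact: bound.
rewrite -[t ^+ 2]ger0_norm ?sqr_ge0// -normrM.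
pose k x := t ^+ 2 * (G1 x * cos (t * x) - G2 x * sin (t * x)).
pose l x := h1 x * cos (t * x) - h2 x * sin (t * x).
(* Both integrations by parts at once: [F] has derivative [k + l], so t^2 psi is a boundary term
   minus the integral of [l]. The summands of [F] with a factor t die at the end points by G1 L = G2
   L = G2 0 = 0 and sin 0 = 0. *)
pose F x := t * (G1 x * sin (t * x)) + g1 x * cos (t * x) + t * (G2 x * cos (t * x)) -
  g2 x * sin (t * x).
have dF (x : R) : 0 <= x <= L -> is_derive x 1 F (k x + l x).
  move=> _.
  have dt : is_derive x 1 (fun y : R => t * y) (t * 1) by exact: is_deriveZ.
  have dc := is_derive1_comp (is_derive_cos (t * x)) dt.
  have ds := is_derive1_comp (is_derive_sin (t * x)) dt.
  have e1 := is_deriveZ t (is_deriveM (dG1 x) ds).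
  have e2 := is_deriveM (dg1 x) dc.
  have e3 := is_deriveZ t (is_deriveM (dG2 x) dc).
  have e4 := is_deriveM (dg2 x) ds.
  apply: (is_derive_eq (is_deriveB (is_deriveD (is_deriveD e1 e2) e3) e4)).
  rewrite /k /l /GRing.scale/=; ring.
have ck : continuous k.
  by move=> x; apply: cvgM; [exact: cvg_cst|exact: cc].
have cl : continuous l by exact: cc.
have ckl (x : R) : 0 <= x <= L -> {for x, continuous (fun x => k x + l x)}.
  by move=> _; apply: cvgD; [exact: ck|exact: cl].
have := Rintegral_FTC L0 dF ckl.
rewrite RintegralD//; [|exact: continuous_L1_itv..].
have -> : \int[mu]_(x in `[0, L]) k x = t ^+ 2 * psi.
  rewrite /k RintegralZl//; apply: continuous_L1_itv; exact: cc.
move=> /(canRL (addrK _)) e; rewrite mulrC e.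
rewrite /F G1L G2L G20 !mulr0 cos0 sin0 !mul0r !mulr0 mulr1 add0r !addr0 subr0.
rewrite (le_trans (ler_normB _ _))//; apply: lerD; last exact: bound.
rewrite (le_trans (ler_normB _ _))// /K1; apply: lerD => //.
rewrite (le_trans (ler_normB _ _))// !normrM; apply: lerD.
  by rewrite ler_piMr ?cos_max.
by rewrite ler_piMr ?sin_max.
by rewrite add0r.
Qed.

(** Half the Fourier transform of the triangle function on [-L, L], which is even, so that the
    window [0, L] carries all of it. Unlike the closed form in [fejerE], this one also makes sense
    at t = 0. *)
Definition fejer (L : R) : R -> R := cosT ((fun x => 1 + (- L^-1) * x) \_ `[0, L]).

Lemma fejerE (L t : R) : 0 < L -> t ^+ 2 * fejer L t = (1 - cos (L * t)) / L.
Proof.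
move=> L0; pose W x : R := 1 + (- L^-1) * x.
have cW : continuous W.
  by move=> x; apply: cvgD; [exact: cvg_cst|apply: cvgM; [exact: cvg_cst|exact: cvg_id]].
have cosc : continuous (fun x : R => cos (t * x)).
  move=> x; apply: (@continuous_comp _ _ _ (fun x => t * x) cos); last exact: continuous_cos.
  by apply: cvgM; [exact: cvg_cst|exact: cvg_id].
have -> : fejer L t = \int[mu]_(x in `[0, L]) (W x * cos (t * x)).
  rewrite /fejer /cosT [RHS]Rintegral_mkcond; apply: eq_Rintegral => x _.
  by rewrite !patchE; case: ifP; rewrite ?mul0r.
have cWc : continuous (fun x => W x * cos (t * x)).
  by move=> x; apply: cvgM; [exact: cW|exact: cosc].
rewrite -RintegralZl//; last exact: continuous_L1_itv.
have dF (x : R) : 0 <= x <= L -> is_derive x 1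
    (fun x => t * (W x * sin (t * x)) - L^-1 * cos (t * x)) (t ^+ 2 * (W x * cos (t * x))).
  move=> _.
  have dt : is_derive x 1 (fun y : R => t * y) (t * 1) by exact: is_deriveZ.
  have dW : is_derive x 1 W (- L^-1).
    have := is_deriveD (is_derive_cst (1 : R) x (1 : R)) (is_deriveZ (- L^-1) (is_derive_id x (1 : R))).
    by move=> d; apply: (is_derive_eq d); rewrite /GRing.scale/= mulr1 add0r.
  have dc := is_derive1_comp (is_derive_cos (t * x)) dt.
  have ds := is_derive1_comp (is_derive_sin (t * x)) dt.
  have e1 := is_deriveZ t (is_deriveM dW ds).
  apply: (is_derive_eq (is_deriveB e1 (is_deriveZ (L^-1) dc))).
  rewrite /GRing.scale/=; ring.
rewrite (Rintegral_FTC L0 dF); last first.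
  by move=> x _; apply: cvgM; [exact: cvg_cst|exact: cWc].
rewrite /W !mulr0 sin0 cos0 mulNr mulVf ?gt_eqF// subrr (mulrC L t).
by rewrite mul0r !mulr0 mulr1; ring.
Qed.

(** For |t| <= 1 / L and 0 <= x <= L the phase tx is at most 1 in absolute value, so its cosine is
    at least 1/2; the half triangle has area L / 2. *)
Lemma fejer_ge (L t : R) : 0 < L -> `|t| <= L^-1 -> L / 4 <= fejer L t.
Proof.
move=> L0 tL.
have cW : continuous (fun x : R => 1 + (- L^-1) * x).
  by move=> x; apply: cvgD; [exact: cvg_cst|apply: cvgM; [exact: cvg_cst|exact: cvg_id]].
have -> : L / 4 = \int[mu]_x (2^-1 * ((fun x => 1 + (- L^-1) * x) \_ `[0, L]) x).
  rewrite RintegralZl//; last exact: L1_window.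
  rewrite -Rintegral_mkcond.
  have dF (x : R) : 0 <= x <= L -> is_derive x 1 (fun x => x + (- (2 * L)^-1) * (x * x)) (1 + (- L^-1) * x).
    move=> _; have di := is_derive_id x (1 : R).
    apply: (is_derive_eq (is_deriveD di (is_deriveZ (- (2 * L)^-1) (is_deriveM di di)))).
    by rewrite /GRing.scale/=; field; rewrite gt_eqF.
  rewrite (Rintegral_FTC L0 dF); last by move=> x _; exact: cW.
  by field; rewrite gt_eqF.
rewrite /fejer /cosT; apply: le_Rintegral => //.
- by apply: L1Zl; exact: L1_window.
- by apply: L1_cos; exact: L1_window.
move=> x _; rewrite patchE; case: ifP; last by rewrite mulr0 mul0r.
rewrite inE/= in_itv/= => /andP[x0 xL].
rewrite mulrC ler_wpM2l//.
  by rewrite mulNr subr_ge0 ler_pdivrMl// mulr1.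
apply: le_trans (cos_ge _).
have : (t * x) ^+ 2 <= 1.
  rewrite -(real_normK (num_real (t * x))) expr_le1// normrM (ger0_norm x0).
  rewrite -(mulVf (lt0r_neq0 L0)); exact: ler_pM.
lra.
Qed.

Lemma fejer_ge0 (L t : R) : 0 < L -> 0 <= fejer L t.
Proof.
move=> L0; have [->|t0] := eqVneq t 0.
  by apply: le_trans (fejer_ge L0 _); rewrite ?normr0 ?divr_ge0 ?invr_ge0 ?ltW.
have t2 : 0 < t ^+ 2 by rewrite exprn_even_gt0.
by rewrite -(pmulr_rge0 _ t2) fejerE// divr_ge0 ?subr_ge0 ?cos_le1 ?ltW.
Qed.

Lemma fejer_le (L t : R) : 0 < L -> t ^+ 2 * fejer L t <= 2 / L.
Proof.
move=> L0; rewrite fejerE// ler_wpM2r ?invr_ge0 ?(ltW L0)//.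
by have := cos_geN1 (L * t); lra.
Qed.

Lemma fejer_bound (L : R) : 0 < L -> exists K, forall t, `|fejer L t| <= K * (1 + t ^+ 2)^-1.
Proof.
move=> L0.
have [|||||K hK] := @window_transform_decay (fun x => 1 + (- L^-1) * x) (fun x => 0 + 0 * x) L L0.
- exact: C2_affine.
- exact: C2_affine.
- by rewrite mulNr mulVf ?gt_eqF// subrr.
- by rewrite mul0r addr0.
- by rewrite mul0r addr0.
exists K => t; have := hK t.
suff -> : sinT ((fun x => 0 + 0 * x) \_ `[0, L]) t = 0 by rewrite subr0.
rewrite /sinT; transitivity (\int[mu]_(x in setT) (0 : R)).
  by apply: eq_Rintegral => x _; rewrite patchE mul0r addr0; case: ifP; rewrite mul0r.
by rewrite Rintegral_cst// mul0r.
Qed.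

Lemma measurable_cosT h : L1 h -> L1 (fun t => t * h t) -> measurable_fun setT (cosT h).
Proof.
move=> ih ith; apply: continuous_measurable_fun.
by apply: (@is_derive_continuousT _ _ (fun a => - sinT (fun t => t * h t) a)) => x; exact: is_derive_cosT.
Qed.

Lemma measurable_sinT h : L1 h -> L1 (fun t => t * h t) -> measurable_fun setT (sinT h).
Proof.
move=> ih ith; apply: continuous_measurable_fun.
by apply: (@is_derive_continuousT _ _ (fun a => cosT (fun t => t * h t) a)) => x; exact: is_derive_sinT.
Qed.

Lemma measurable_fejer (L : R) : measurable_fun setT (fejer L).
Proof.
have cW : continuous (fun x : R => 1 + (- L^-1) * x).
  by move=> x; apply: cvgD; [exact: cvg_cst|apply: cvgM; [exact: cvg_cst|exact: cvg_id]].
by apply: measurable_cosT; [exact: L1_window|exact: L1_window_mul].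
Qed.

Lemma L1_fejer (L : R) : 0 < L -> L1 (fejer L).
Proof.
move=> L0; have [K hK] := fejer_bound L0.
apply: (L1_le (measurable_fejer L) _ hK); apply: L1Zl; exact: integrable_oneDsqr.
Qed.

(** Height L / 4 from [fejer_ge] over an interval of length 2 / L, and nonnegativity elsewhere. *)
Lemma Rintegral_fejer_ge (L : R) : 0 < L -> 2^-1 <= \int[mu]_x fejer L x.
Proof.
move=> L0.
have Li : 0 < L^-1 by rewrite invr_gt0.
apply: (@le_trans _ _ (\int[mu]_x ((fun=> L / 4) \_ `[- L^-1, L^-1]) x)).
  rewrite -Rintegral_mkcond Rintegral_cst//= lebesgue_measure_itv/= lte_fin.
  rewrite (_ : - L^-1 < L^-1); last by lra.
  by rewrite -EFinB/= le_eqVlt; apply/orP; left; apply/eqP; field; rewrite gt_eqF.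
apply: le_Rintegral => //.
- by apply: L1_window => x; exact: cvg_cst.
- exact: L1_fejer.
move=> x _; rewrite patchE; case: ifP => [|_]; last exact: fejer_ge0.
rewrite inE/= in_itv/= => xL; apply: fejer_ge => //.
by rewrite ler_norml.
Qed.

(* The Fejer kernels concentrate at the origin while keeping mass at least 1/2. *)
Lemma fejer_conv_eq0 (F : R -> R) (M x : R) : measurable_fun setT F ->
  (forall u, `|F u| <= M) -> {for x, continuous F} ->
  (forall L, 0 < L -> \int[mu]_u (fejer L (x - u) * F u) = 0) -> F x = 0.
Proof.
move=> mF FM cF F0; apply/eqP; apply: contraT => Fx.
have Fx0 : 0 < `|F x| by rewrite normr_gt0.
have [r r0 hr] : exists2 r : R, 0 < r & forall y, `|y| < r -> `|F x - F (x - y)| <= `|F x| / 2.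
  move/cvgrPdist_le : cF => /(_ (`|F x| / 2)); rewrite divr_gt0// => /(_ isT).
  case=> r /= r0 hr; exists r => // y yr; apply: hr => /=.
  by rewrite opprB addrC subrK.
have M0 : 0 < M by exact: lt_le_trans (FM x).
(* For |u| >= r one has 1 + u^2 <= (1 + r^-2) u^2, and [fejer_le] bounds u^2 [fejer L u] by 2 / L;
   hence c / L times (1 + u^2)^-1 bounds the kernel there. *)
pose c := (1 + (r ^+ 2)^-1) * 2.
have r2 : 0 < r ^+ 2 by rewrite exprn_gt0.
have c0 : 0 < c by rewrite mulr_gt0// ltr_pwDl// invr_ge0 ltW.
pose J := \int[mu]_t (1 + t ^+ 2)^-1.
have J0 : 0 <= J by apply: Rintegral_ge0 => t _; rewrite invr_ge0 addr_ge0// sqr_ge0.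
(* Makes the far part 2 M c J / L less than |F x| / 4. The near part costs at most half of |F x|
   times the mass, and the mass is at least 1/2, so a nonzero F x is contradictory. *)
pose L := 8 * M * c * (J + 1) / `|F x|.
have J1 : 0 < J + 1 by rewrite ltr_wpDl.
have L0 : 0 < L.
  apply: divr_gt0 => //; apply: mulr_gt0 => //.
  by apply: mulr_gt0 => //; apply: mulr_gt0.
have mFx : measurable_fun setT (fun u : R => F (x - u)).
  by apply: (measurableT_comp mF); apply: measurable_funB.
have i1 : L1 (fun u => fejer L u * F (x - u)).
  exact: (L1_bounded_mul (L1_fejer L0) mFx (fun u => FM (x - u))).
have z : \int[mu]_u (fejer L u * F (x - u)) = 0.
  rewrite -(F0 L L0) -(Rintegral_sub x i1); apply: eq_Rintegral => u _.
  by rewrite subKr.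
have iF := L1_fejer L0.
have e : `|F x| * (\int[mu]_u fejer L u) <=
    \int[mu]_u (`|F x| / 2 * fejer L u + 2 * M * c / L * (1 + u ^+ 2)^-1).
  have I0 : 0 <= \int[mu]_u fejer L u by apply: Rintegral_ge0 => u _; exact: fejer_ge0.
  rewrite -[X in _ * X]ger0_norm// -normrM.
  have -> : F x * (\int[mu]_u fejer L u) = \int[mu]_u (F x * fejer L u - fejer L u * F (x - u)).
    by rewrite RintegralB// ?RintegralZl ?z ?subr0//; exact: L1Zl.
  apply: Rintegral_le_norm.
  - by apply: L1B => //; exact: L1Zl.
  - by apply: L1D; apply: L1Zl => //; exact: integrable_oneDsqr.
  move=> u.
  have f0 := fejer_ge0 u L0.
  have -> : F x * fejer L u - fejer L u * F (x - u) = fejer L u * (F x - F (x - u)) by ring.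
  rewrite normrM (ger0_norm f0).
  have s0 : 0 < 1 + u ^+ 2 by rewrite ltr_pwDl// sqr_ge0.
  have Cp : 0 <= 2 * M * c / L * (1 + u ^+ 2)^-1.
    have K0 : 0 < 2 * M * c / L.
      by apply: divr_gt0 => //; apply: mulr_gt0 => //; apply: mulr_gt0.
    by apply: mulr_ge0; [exact: ltW|rewrite invr_ge0 ltW].
  have [ur|ru] := ltP `|u| r.
    rewrite mulrC; apply: (@le_trans _ _ (`|F x| / 2 * fejer L u)); last by rewrite lerDl.
    by rewrite ler_wpM2r// hr.
  apply: (@le_trans _ _ (2 * M * c / L * (1 + u ^+ 2)^-1)); last by rewrite lerDr mulr_ge0// divr_ge0.
  have d : `|F x - F (x - u)| <= 2 * M.
    by rewrite (le_trans (ler_normB _ _))//; have := FM x; have := FM (x - u); lra.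
  have u2 : r ^+ 2 <= u ^+ 2.
    by rewrite -(real_normK (num_real u)) lerXn2r ?nnegrE// ltW.
  have u20 : 0 < u ^+ 2 by exact: lt_le_trans u2.
  have fl : fejer L u <= c / L * (1 + u ^+ 2)^-1.
    rewrite ler_pdivlMr//; apply: (@le_trans _ _ ((1 + (r ^+ 2)^-1) * (u ^+ 2 * fejer L u))).
      rewrite mulrA [fejer L u * _]mulrC ler_wpM2r//.
      rewrite mulrDl mul1r addrC lerD2l.
      by rewrite mulrC ler_pdivlMr// mul1r.
    have -> : c / L = (1 + (r ^+ 2)^-1) * (2 / L) by rewrite /c; ring.
    by apply: ler_wpM2l; [rewrite addr_ge0// invr_ge0 ltW|exact: fejer_le].
  apply: (le_trans (ler_pM f0 (normr_ge0 _) fl d)).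
  by rewrite le_eqVlt; apply/orP; left; apply/eqP; ring.
rewrite RintegralD// in e; last 2 first.
- exact: L1Zl.
- by apply: L1Zl; exact: integrable_oneDsqr.
rewrite !RintegralZl// in e; last exact: integrable_oneDsqr.
have h := Rintegral_fejer_ge L0.
rewrite -/J in e.
have eL : 2 * M * c / L = `|F x| / (4 * (J + 1)).
  rewrite /L; field; rewrite !gt_eqF ?ltr_wpDl//.
rewrite eL in e.
set I := \int[mu]_u fejer L u in e h.
have e' : `|F x| * 4^-1 <= `|F x| * (J / (4 * (J + 1))).
  have : `|F x| / 2 * 2^-1 <= `|F x| / 2 * I by rewrite ler_wpM2l// divr_ge0.
  have -> : `|F x| * (J / (4 * (J + 1))) = `|F x| / (4 * (J + 1)) * J by ring.
  lra.
move: e'; rewrite ler_pM2l// ler_pdivlMr ?mulr_gt0 ?ltr_wpDl//.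
lra.
Qed.

End SpectralSynthesis.

(** * Uniqueness for bounded solutions of a convolution equation *)

Section WienerUniqueness.
Context {R : realType}.
Local Notation mu := (@lebesgue_measure R).
Local Notation L1 f := (mu.-integrable setT (EFin \o f)).
Implicit Types f g h : R -> R.

Lemma measurable_comp_subr f (x : R) : measurable_fun setT f ->
  measurable_fun setT (fun u : R => f (x - u)).
Proof. by move=> mf; apply: (measurableT_comp mf); apply: measurable_funB. Qed.

Variables (H : R -> R).
Hypothesis dH : exp_decay H.
Hypothesis H_neq0 : forall x, cosT H x ^+ 2 + sinT H x ^+ 2 != 0.

Let iH : L1 H. Proof. exact: exp_decay_L1. Qed.
Let mH : measurable_fun setT H. Proof. exact: L1_measurable. Qed.

Let cos_conv (y t : R) :
  \int[mu]_v (H (y - v) * cos (v * t)) = cos (y * t) * cosT H t + sin (y * t) * sinT H t.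
Proof.
have ih : L1 (fun v => cos (y * t) * (H v * cos (t * v)) + sin (y * t) * (H v * sin (t * v))).
  by apply: L1D; apply: L1Zl; [exact: L1_cos|exact: L1_sin].
transitivity (\int[mu]_v (cos (y * t) * (H v * cos (t * v)) + sin (y * t) * (H v * sin (t * v)))).
  rewrite -[RHS](Rintegral_sub y ih); apply: eq_Rintegral => v _.
  have {1}-> : v * t = y * t - t * (y - v) by ring.
  by rewrite cosB; ring.
rewrite RintegralD//; [|by apply: L1Zl; exact: L1_cos|by apply: L1Zl; exact: L1_sin].
by rewrite !RintegralZl//; [exact: L1_sin|exact: L1_cos].
Qed.

Let sin_conv (y t : R) :
  \int[mu]_v (H (y - v) * sin (v * t)) = sin (y * t) * cosT H t - cos (y * t) * sinT H t.
Proof.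
have ih : L1 (fun v => sin (y * t) * (H v * cos (t * v)) - cos (y * t) * (H v * sin (t * v))).
  by apply: L1B; apply: L1Zl; [exact: L1_cos|exact: L1_sin].
transitivity (\int[mu]_v (sin (y * t) * (H v * cos (t * v)) - cos (y * t) * (H v * sin (t * v)))).
  rewrite -[RHS](Rintegral_sub y ih); apply: eq_Rintegral => v _.
  have {1}-> : v * t = y * t - t * (y - v) by ring.
  by rewrite sinB; ring.
rewrite RintegralB//; [|by apply: L1Zl; exact: L1_cos|by apply: L1Zl; exact: L1_sin].
by rewrite !RintegralZl//; [exact: L1_sin|exact: L1_cos].
Qed.

(* The Fourier transform of [psi] is that of the Fejer kernel divided by that of [H]. *)
Let fejer_factor (L : R) : 0 < L -> exists psi : R -> R,
  [/\ measurable_fun setT psi, L1 psi, exists K, forall t, `|psi t| <= K &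
      forall x, \int[mu]_v (H (x - v) * psi v) = fejer L x].
Proof.
move=> L0.
pose Q x := cosT H x * cosT H x + sinT H x * sinT H x.
have Q0 x : Q x != 0 by have := H_neq0 x; rewrite !expr2.
have cC := C2_cosT dH; have cS := C2_sinT dH.
have cQ : C2 (fun x => (Q x)^-1).
  by apply: C2_inv => //; apply: C2_add; apply: C2_mul.
have cW : C2 (fun x => 1 + (- L^-1) * x) by exact: C2_affine.
(* With C + iS the transform of [H], G1 + i G2 is the triangle divided by C - iS. As C is even and S
   odd, the real part over [0, L] is half of the transform over [-L, L], and S(0) = 0 is the
   condition that [window_transform_decay] puts on [G2] at 0. *)
pose G1 x := (1 + (- L^-1) * x) * (cosT H x * (Q x)^-1).
pose G2 x := (1 + (- L^-1) * x) * (sinT H x * (Q x)^-1).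
have C2G1 : C2 G1 by apply: C2_mul => //; apply: C2_mul.
have C2G2 : C2 G2 by apply: C2_mul => //; apply: C2_mul.
have [g1 [h1 [dG1 _ _]]] := C2G1; have [g2 [h2 [dG2 _ _]]] := C2G2.
have cG1 := is_derive_continuousT dG1; have cG2 := is_derive_continuousT dG2.
have W0 : 1 + (- L^-1) * L = 0 by rewrite mulNr mulVf ?gt_eqF// subrr.
have sinT0 : sinT H 0 = 0.
  rewrite /sinT; transitivity (\int[mu]_(x in setT) (0 : R)).
    by apply: eq_Rintegral => x _; rewrite mul0r sin0 mulr0.
  by rewrite Rintegral_cst// mul0r.
have [K hK] : exists K, forall t,
    `|cosT (G1 \_ `[0, L]) t - sinT (G2 \_ `[0, L]) t| <= K * (1 + t ^+ 2)^-1.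
  apply: window_transform_decay => //.
  - by rewrite /G1 W0 mul0r.
  - by rewrite /G2 W0 mul0r.
  - by rewrite /G2 sinT0 mul0r mulr0.
pose w1 := G1 \_ `[0, L]; pose w2 := G2 \_ `[0, L].
have i1 : L1 w1 by exact: L1_window.
have i2 : L1 w2 by exact: L1_window.
pose psi t := cosT w1 t - sinT w2 t.
have mpsi : measurable_fun setT psi.
  apply: measurable_funB.
    by apply: measurable_cosT => //; exact: L1_window_mul.
  by apply: measurable_sinT => //; exact: L1_window_mul.
have ipsi : L1 psi.
  by apply: (L1_le mpsi _ hK); apply: L1Zl; exact: integrable_oneDsqr.
exists psi; split => //.
  have K0 : 0 <= K.
    have := le_trans (normr_ge0 _) (hK 0).
    by rewrite expr0n/= addr0 invr1 mulr1.
  exists K => t; rewrite (le_trans (hK t))// ler_piMr// invf_le1.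
    by rewrite lerDl sqr_ge0.
  by rewrite ltr_pwDl// sqr_ge0.
move=> x.
pose F (p : R * R) := H (x - p.1) * (w1 p.2 * cos (p.1 * p.2) - w2 p.2 * sin (p.1 * p.2)).
have mF : measurable_fun setT F.
  have m12 : measurable_fun setT (fun p : R * R => p.1 * p.2).
    by apply: measurable_funM; [exact: measurable_fst|exact: measurable_snd].
  have mcos : measurable_fun setT (@cos R).
    by apply: continuous_measurable_fun; exact: continuous_cos.
  have msin : measurable_fun setT (@sin R).
    by apply: continuous_measurable_fun; exact: continuous_sin.
  have mw1 := L1_measurable i1; have mw2 := L1_measurable i2.
  apply: measurable_funM.
    exact: (measurableT_comp (measurable_comp_subr x mH) measurable_fst).
  apply: measurable_funB; apply: measurable_funM.
  - exact: (measurableT_comp mw1 measurable_snd).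
  - exact: (measurableT_comp mcos m12).
  - exact: (measurableT_comp mw2 measurable_snd).
  - exact: (measurableT_comp msin m12).
have iw (v : R) : L1 (fun t => w1 t * cos (v * t) - w2 t * sin (v * t)).
  by apply: L1B; [exact: L1_cos|exact: L1_sin].
have iwn : L1 (fun t => `|w1 t| + `|w2 t|) by apply: L1D; exact: integrable_norm.
have iHx : L1 (fun v => H (x - v)) by exact: integrable_sub.
have iHc t : L1 (fun v => H (x - v) * cos (v * t)).
  apply: (L1_bounded_mul iHx _ (fun v => cos_max (v * t))).
  have -> : (fun v => cos (v * t)) = (fun v => cos (t * v)).
    by apply/funext => v; rewrite mulrC.
  exact: mfun_cos.
have iHs t : L1 (fun v => H (x - v) * sin (v * t)).
  apply: (L1_bounded_mul iHx _ (fun v => sin_max (v * t))).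
  have -> : (fun v => sin (v * t)) = (fun v => sin (t * v)).
    by apply/funext => v; rewrite mulrC.
  exact: mfun_sin.
have FE v t : F (v, t) = w1 t * (H (x - v) * cos (v * t)) - w2 t * (H (x - v) * sin (v * t)).
  by rewrite /F/=; ring.
have [||||_ swap] := @Rintegral_fubini R F
    (fun v => (\int[mu]_t (`|w1 t| + `|w2 t|)) * `|H (x - v)|) mF.
- by move=> v; rewrite /F/=; apply: L1Zl; exact: iw.
- move=> t; have -> : (fun v => F (v, t)) = (fun v => w1 t * (H (x - v) * cos (v * t)) -
      w2 t * (H (x - v) * sin (v * t))) by apply/funext => v; exact: FE.
  by apply: L1B; apply: L1Zl.
- by apply: L1Zl; exact: integrable_norm.
- move=> v.
  have -> : \int[mu]_t `|F (v, t)| =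
      \int[mu]_t (`|H (x - v)| * `|w1 t * cos (v * t) - w2 t * sin (v * t)|).
    by apply: eq_Rintegral => t _; rewrite /F/= normrM.
  rewrite RintegralZl//; last exact: integrable_norm.
  rewrite mulrC ler_wpM2r//; apply: le_Rintegral => //; first exact: integrable_norm.
  move=> t _; rewrite (le_trans (ler_normB _ _))// !normrM.
  by apply: lerD; rewrite ler_piMr ?cos_max ?sin_max.
transitivity (\int[mu]_v (\int[mu]_t F (v, t))).
  apply: eq_Rintegral => v _.
  have -> : psi v = \int[mu]_t (w1 t * cos (v * t) - w2 t * sin (v * t)).
    exact/esym/(RintegralB measurableT (L1_cos v i1) (L1_sin v i2)).
  by rewrite -RintegralZl.
rewrite swap /fejer {1}/cosT; apply: eq_Rintegral => t _.
have -> : \int[mu]_v F (v, t) = w1 t * (cos (x * t) * cosT H t + sin (x * t) * sinT H t) -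
    w2 t * (sin (x * t) * cosT H t - cos (x * t) * sinT H t).
  transitivity (\int[mu]_v (w1 t * (H (x - v) * cos (v * t)) -
      w2 t * (H (x - v) * sin (v * t)))).
    by apply: eq_Rintegral => v _; exact: FE.
  rewrite (RintegralB measurableT (L1Zl (w1 t) (iHc t)) (L1Zl (w2 t) (iHs t))).
  rewrite (RintegralZl _ measurableT (iHc t)) (RintegralZl _ measurableT (iHs t)).
  by rewrite cos_conv sin_conv.
rewrite /w1 /w2 !patchE; case: ifP => _; last by rewrite !mul0r subr0.
rewrite /G1 /G2; set q := (Q t)^-1.
(* The terms with sin (xt) cancel and cos (xt) is left with the factor C^2 + S^2 = Q. *)
transitivity ((1 + - L^-1 * t) * cos (x * t) * Q t * q); last by rewrite /q mulfK.
rewrite /Q; ring.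
Qed.

(** By associativity of convolution: the Fejer kernel is H * psi by [fejer_factor], so its
    convolution with [f] is psi * (H * f) = 0. Fubini applies since [H] and [psi] are integrable and
    [f] is bounded. *)
Let solution_fejer (f : R -> R) (M : R) : measurable_fun setT f -> (forall u, `|f u| <= M) ->
  (forall x, \int[mu]_u (H (x - u) * f u) = 0) ->
  forall L x, 0 < L -> \int[mu]_u (fejer L (x - u) * f u) = 0.
Proof.
move=> mf fM Hf L x L0.
have M0 : 0 <= M by exact: le_trans (normr_ge0 _) (fM 0).
have [psi [mpsi ipsi [K hK] psiE]] := fejer_factor L0.
pose F (p : R * R) := psi p.1 * (H (x - p.1 - p.2) * f p.2).
have mF : measurable_fun setT F.
  apply: measurable_funM; first exact: (measurableT_comp mpsi measurable_fst).
  apply: measurable_funM; last exact: (measurableT_comp mf measurable_snd).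
  apply: (measurableT_comp mH); apply: measurable_funB; last exact: measurable_snd.
  by apply: measurable_funB => //; exact: measurable_fst.
have iHf (y : R) : L1 (fun u => H (y - u) * f u).
  by apply: (L1_bounded_mul (integrable_sub y iH) mf fM).
have [||||_ swap] := @Rintegral_fubini R F (fun v => (M * \int[mu]_u `|H u|) * `|psi v|) mF.
- by move=> v; rewrite /F/=; apply: L1Zl.
- move=> u; rewrite /F/=.
  have -> : (fun v => psi v * (H (x - v - u) * f u)) = (fun v => f u * (H (x - u - v) * psi v)).
    by apply/funext => v; rewrite addrAC; ring.
  by apply: L1Zl; exact: (L1_bounded_mul (integrable_sub _ iH) mpsi hK).
- by apply: L1Zl; exact: integrable_norm.
- move=> v.
  have -> : \int[mu]_u `|F (v, u)| = \int[mu]_u (`|psi v| * `|H (x - v - u) * f u|).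
    by apply: eq_Rintegral => u _; rewrite /F/= normrM.
  rewrite RintegralZl//; last exact: integrable_norm.
  rewrite mulrC ler_wpM2r//.
  have iHn : L1 (fun u => `|H u|) by exact: integrable_norm.
  rewrite -(Rintegral_sub (x - v) iHn) -RintegralZl//; last exact: (integrable_sub _ iHn).
  apply: le_Rintegral => //.
  + exact: integrable_norm.
  + by apply: L1Zl; exact: (integrable_sub _ iHn).
  + by move=> u _; rewrite normrM mulrC ler_wpM2r.
transitivity (\int[mu]_u (\int[mu]_v F (v, u))).
  apply: eq_Rintegral => u _; rewrite -psiE mulrC -RintegralZl//.
    by apply: eq_Rintegral => v _; rewrite /F/= [x - v - u]addrAC; ring.
  exact: (L1_bounded_mul (integrable_sub _ iH) mpsi hK).
rewrite -swap; transitivity (\int[mu]_(v in setT) (0 : R)).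
  apply: eq_Rintegral => v _; rewrite /F/= RintegralZl//.
  by rewrite Hf mulr0.
by rewrite Rintegral_cst// mul0r.
Qed.

(* One-sided exponential: convolving with it turns [f] into a continuous solution,
   [fun x => expR (- x) * \int_(-oo)^x expR u * f u]. *)
Let onesided (v : R) : R := if 0 <= v then expR (- v) else 0.

Let onesided_le v : `|onesided v| <= expR (- (1 * `|v|)).
Proof.
rewrite /onesided mul1r; case: (leP 0 v) => v0.
  by rewrite !ger0_norm ?expR_ge0.
by rewrite normr0 expR_ge0.
Qed.

Let monesided : measurable_fun setT onesided.
Proof.
have -> : onesided = (fun v => expR (- v)) \_ `[0, +oo[.
  apply/funext => v; rewrite patchE /onesided; case: ifPn => v0.
    by rewrite mem_set//= in_itv/= v0.
  by rewrite memNset//= in_itv/= andbT; exact/negP.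
apply/(measurable_restrictT _ _).1 => //.
apply: measurable_funTS; apply: (measurableT_comp (@measurable_expR R)).
exact: measurable_funN.
Qed.

Let ionesided : L1 onesided.
Proof. exact: (L1_le monesided (integrable_expR_abs ltr01) onesided_le). Qed.

(** [fejer_conv_eq0] works only at points of continuity, so it is applied to F = onesided * f. The
    one-sided exponential can be undone: exp(x) F(x) is a primitive of exp(u) f(u), and once F = 0
    Lebesgue differentiation gives f = 0 almost everywhere. *)
Theorem wiener_uniqueness (f : R -> R) (M : R) : measurable_fun setT f ->
  (forall u, `|f u| <= M) -> (forall x, \int[mu]_u (H (x - u) * f u) = 0) ->
  {ae mu, forall u, f u = 0}.
Proof.
move=> mf fM Hf.
have M0 : 0 <= M by exact: le_trans (normr_ge0 _) (fM 0).
pose g u := expR u * f u.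
have mg : measurable_fun setT g by apply: measurable_funM => //; exact: measurable_expR.
pose Phi (x : R) := \int[mu]_(u in `]-oo, x]) g u.
pose F x := \int[mu]_u (onesided (x - u) * f u).
have ikf (x : R) : L1 (fun u => onesided (x - u) * f u).
  exact: (L1_bounded_mul (integrable_sub x ionesided) mf fM).
have gE (x : R) : g \_ `]-oo, x] = (fun u => expR x * (onesided (x - u) * f u)).
  apply/funext => u; rewrite patchE /onesided subr_ge0; case: ifPn => ux.
    have -> : u <= x by move: ux; rewrite inE/= in_itv.
    by rewrite mulrA -expRD opprB addrC subrK.
  have -> : (u <= x) = false.
    by apply/negbTE; apply: contra ux => ux; rewrite inE/= in_itv.
  by rewrite mul0r mulr0.
have ig (x : R) : mu.-integrable `]-oo, x] (EFin \o g).
  apply/(integrable_mkcond (mu := mu) (EFin \o g)) => //.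
  by rewrite restrict_EFin gE; exact: L1Zl.
have PhiE x : Phi x = expR x * F x.
  by rewrite /Phi Rintegral_mkcond gE RintegralZl.
have FE x : F x = expR (- x) * Phi x.
  by rewrite PhiE mulrA -expRD addNr expR0 mul1r.
have Phi_lip (x y : R) : x <= y -> `|Phi y - Phi x| <= expR y * M * (y - x).
  rewrite le_eqVlt => /predU1P[->|xy]; first by rewrite !subrr normr0 mulr0.
  rewrite /Phi Rintegral_itvB ?bnd_simp//; last exact: ltW.
  have i' : mu.-integrable `]x, y] (EFin \o g) by apply: integrableS (ig y) => //; exact: subset_itvr.
  apply: (le_trans (le_normr_Rintegral _ i')) => //.
  apply: (@le_trans _ _ (\int[mu]_(u in `]x, y]) (expR y * M))).
    apply: le_Rintegral => //; first exact: integrable_norm.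
      have ic : mu.-integrable `[x, y] (EFin \o (fun=> expR y * M)).
        by apply: continuous_L1_itv => z; exact: cvg_cst.
      by apply: integrableS ic => //; apply: subset_itvr; rewrite bnd_simp.
    move=> u; rewrite /= in_itv/= => /andP[_ uy]; rewrite /g normrM (ger0_norm (expR_ge0 _)).
    by apply: ler_pM => //; rewrite ler_expR.
  by rewrite Rintegral_cst//= lebesgue_measure_itv/= lte_fin xy.
have cPhi : continuous Phi.
  move=> x; apply/cvgrPdist_le => e e0.
  pose K := expR (x + 1) * M + 1.
  have K0 : 0 < K by rewrite ltr_wpDl// mulr_ge0 ?expR_ge0.
  near=> y.
  have y1 : `|x - y| <= 1 by near: y; apply: cvgr_dist_le => //; exact: cvg_id.
  have ye : `|x - y| <= e / K.
    by near: y; apply: cvgr_dist_le; [exact: cvg_id|rewrite divr_gt0].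
  have step : `|Phi x - Phi y| <= expR (x + 1) * M * `|x - y|.
    have /ler_normlP[h1 h2] := y1.
    have [xy|yx] := leP x y.
      have -> : `|x - y| = y - x by rewrite distrC ger0_norm// subr_ge0.
      rewrite distrC; apply: (le_trans (Phi_lip _ _ xy)).
      by rewrite ler_wpM2r ?subr_ge0// ler_wpM2r// ler_expR; lra.
    have -> : `|x - y| = x - y by rewrite ger0_norm// subr_ge0 ltW.
    apply: (le_trans (Phi_lip _ _ (ltW yx))).
    rewrite ler_wpM2r// ?ler_wpM2r// ?ler_expR ?lerDl// subr_ge0; exact: ltW.
  apply: (le_trans step).
  have : K * `|x - y| <= e by rewrite mulrC -ler_pdivlMr.
  by have := normr_ge0 (x - y); rewrite /K mulrDl mul1r; lra.
have cF : continuous F.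
  have -> : F = fun x => expR (- x) * Phi x by apply/funext => x; exact: FE.
  move=> x; apply: cvgM; last exact: cPhi.
  by apply: continuous_comp; [exact: cvgN|exact: continuous_expR].
have mF : measurable_fun setT F by exact: continuous_measurable_fun.
have ikn : L1 (fun u => `|onesided u|) by exact: integrable_norm.
have FM' x : `|F x| <= M * \int[mu]_u `|onesided u|.
  have ikx : L1 (fun u => `|onesided (x - u)|) by exact: (integrable_sub x ikn).
  rewrite -(Rintegral_sub x ikn) -RintegralZl//.
  apply: Rintegral_le_norm => //; first exact: L1Zl.
  by move=> u; rewrite normrM mulrC ler_wpM2r.
have iHn : L1 (fun u => `|H u|) by exact: integrable_norm.
have mfs (v : R) : measurable_fun setT (fun w : R => f (w - v)).
  by apply: (measurableT_comp mf); apply: measurable_funB.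
have HF x : \int[mu]_w (H (x - w) * F w) = 0.
  (* Convolution with [H] commutes with the smoothing: for fixed v the integral over w is the
     equation for [f] at the point x - v, hence 0. *)
  pose G (p : R * R) := onesided p.1 * (H (x - p.2) * f (p.2 - p.1)).
  have mG : measurable_fun setT G.
    apply: measurable_funM; first exact: (measurableT_comp monesided measurable_fst).
    apply: measurable_funM.
      exact: (measurableT_comp (measurable_comp_subr x mH) measurable_snd).
    apply: (measurableT_comp mf).
    by apply: measurable_funB; [exact: measurable_snd|exact: measurable_fst].
  have iHf (v : R) : L1 (fun w => H (x - w) * f (w - v)).
    exact: (L1_bounded_mul (integrable_sub x iH) (mfs v) (fun w => fM (w - v))).
  have iof (w : R) : L1 (fun v => onesided v * f (w - v)).
    exact: (L1_bounded_mul ionesided (measurable_comp_subr w mf) (fun v => fM (w - v))).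
  have [||||_ swap] := @Rintegral_fubini R G
      (fun v => (M * \int[mu]_u `|H u|) * `|onesided v|) mG.
  - by move=> v; rewrite /G/=; exact: L1Zl.
  - move=> w; rewrite /G/=.
    have -> : (fun v => onesided v * (H (x - w) * f (w - v))) =
        (fun v => H (x - w) * (onesided v * f (w - v))) by apply/funext => v; ring.
    exact: L1Zl.
  - exact: L1Zl.
  - move=> v.
    have -> : \int[mu]_w `|G (v, w)| = \int[mu]_w (`|onesided v| * `|H (x - w) * f (w - v)|).
      by apply: eq_Rintegral => w _; rewrite /G/= normrM.
    rewrite RintegralZl//; last exact: integrable_norm.
    rewrite mulrC ler_wpM2r//.
    rewrite -(Rintegral_sub x iHn) -RintegralZl//; last exact: (integrable_sub _ iHn).
    apply: le_Rintegral => //.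
    + exact: integrable_norm.
    + by apply: L1Zl; exact: (integrable_sub _ iHn).
    + by move=> w _; rewrite normrM mulrC ler_wpM2r.
  transitivity (\int[mu]_w (\int[mu]_v G (v, w))).
    apply: eq_Rintegral => w _.
    have -> : F w = \int[mu]_v (onesided v * f (w - v)).
      rewrite /F -(Rintegral_sub w (ikf w)); apply: eq_Rintegral => v _.
      by rewrite subKr.
    by rewrite -RintegralZl//; apply: eq_Rintegral => v _; rewrite /G/=; ring.
  rewrite -swap; transitivity (\int[mu]_(v in setT) (0 : R)).
    apply: eq_Rintegral => v _; rewrite /G/= RintegralZl//.
    rewrite -(Rintegral_translate v (iHf v)) -[RHS](mulr0 (onesided v)); congr (_ * _).
    rewrite -(Hf (x - v)); apply: eq_Rintegral => w _.
    by rewrite addrK opprD addrCA addrC.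
  by rewrite Rintegral_cst// mul0r.
have F0 x : F x = 0.
  apply: (fejer_conv_eq0 mF FM' (cF x)) => L L0.
  exact: (solution_fejer mF FM' HF).
have Phi0 : Phi = cst 0 by apply/funext => x; rewrite PhiE F0 mulr0.
have locg : locally_integrable setT g.
  split => //; first exact: openT.
  move=> K _ cK; have [N [_ hN]] := compact_bounded cK.
  have mK : measurable K by exact: compact_measurable.
  have KN : K `<=` `]-oo, N + 1].
    move=> y Ky; rewrite /= in_itv/=.
    have N1 : N < N + 1 by rewrite ltrDl.
    by have /ler_normlP[] := hN (N + 1) N1 y Ky.
  have iK : mu.-integrable K (EFin \o g).
    by apply: integrableS (ig (N + 1)) => //; exact: mK.
  by have /integrableP[] := iK.
have := FTC1Ny ig locg.
apply: filterS; first exact: (ae_filter_ringOfSetsType mu).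
move=> x [_]; rewrite -/Phi Phi0 derive1_cst => /esym/eqP.
by rewrite mulf_eq0 expR_eq0/= => /eqP.
Unshelve. all: by end_near. Qed.

End WienerUniqueness.

(** * The Gamma and Bessel kernels *)

Section GammaIntegral.
Context {R : realType}.
Local Notation mu := (@lebesgue_measure R).
Local Notation L1 f := (mu.-integrable setT (EFin \o f)).
Implicit Types (a b t : R).

(* Euler's integrand y^(a-1) e^(-y) dy in the variable y = expR t, so that
   [cosT (gam a) b +i* sinT (gam a) b] is Gamma(a + ib). *)
Definition gam (a t : R) : R := expR (a * t - expR t).

Lemma gam_ge0 a t : 0 <= gam a t. Proof. exact: expR_ge0. Qed.

Lemma gamD a c t : gam (a + c) t = expR (c * t) * gam a t.
Proof. by rewrite /gam -expRD; congr expR; ring. Qed.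

(** With y = exp v this bounds y^p e^(-y) by its maximum (p / e)^p, taken at y = p. The exponent [p]
    is free, so double exponential decay beats any exponential. *)
Lemma expR_expR_le (p v : R) : 0 < p ->
  expR (- expR v) <= expR (p * ln p - p) * expR (- (p * v)).
Proof.
move=> p0; rewrite -expRD ler_expR.
have : p * (1 + (v - ln p)) <= expR v.
  rewrite -{1}(@lnK _ p)// -{2}(subrK (ln p) v) [_ + ln p]addrC expRD.
  by rewrite ler_wpM2l ?expR_ge0// expR_ge1Dx.
lra.
Qed.

Lemma continuous_gam a : continuous (gam a).
Proof.
move=> x; apply: (@continuous_comp _ _ _ (fun t => a * t - expR t) expR); last exact: continuous_expR.
apply: cvgB; last exact: continuous_expR.
by apply: cvgM; [exact: cvg_cst|exact: cvg_id].
Qed.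

Lemma is_derive_gam a t : is_derive t 1 (gam a) (a * gam a t - gam (a + 1) t).
Proof.
have dz : is_derive t 1 (fun y : R => a * y) (a * 1) by exact: is_deriveZ.
have d0 : is_derive t 1 (fun t : R => a * t - expR t) (a * 1 - expR t).
  exact: (is_deriveB dz (is_derive_expR t)).
have d := @is_derive1_comp R expR (fun t => a * t - expR t) t _ _ (is_derive_expR _) d0.
apply: (is_derive_eq d); rewrite gamD mul1r mulr1 /gam; ring.
Qed.

Lemma exp_decay_gam a : 0 < a -> exp_decay (gam a).
Proof.
move=> a0; split; first by apply: continuous_measurable_fun; exact: continuous_gam.
(* The exponent 2a outweighs the growth of exp (a t) for t >= 0; for t < 0 that factor itself is the
   decay. *)
have a2 : 0 < 2 * a by rewrite mulr_gt0.
exists a => //; exists (1 + expR (2 * a * ln (2 * a) - 2 * a)) => t.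
rewrite ger0_norm ?gam_ge0// mulrDl mul1r /gam expRD.
have [t0|t0] := leP 0 t.
  rewrite (ger0_norm t0).
  apply: (@le_trans _ _ (expR (2 * a * ln (2 * a) - 2 * a) * expR (- (a * t)))); last first.
    by rewrite lerDr expR_ge0.
  apply: (le_trans (ler_wpM2l (expR_ge0 _) (expR_expR_le t a2))).
  rewrite mulrCA ler_wpM2l ?expR_ge0// -expRD ler_expR; lra.
rewrite (ltr0_norm t0).
apply: (@le_trans _ _ (expR (- (a * - t)))); last first.
  by rewrite lerDl mulr_ge0 ?expR_ge0.
rewrite mulrN opprK -[leRHS]mulr1 ler_wpM2l ?expR_ge0//.
Qed.

(** Integration by parts on the whole line: the boundary values at -n and n tend to 0. *)
Lemma Rintegral_derive_eq0 (F f : R -> R) : exp_decay F -> continuous f -> L1 f ->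
  (forall x : R, is_derive x 1 F (f x)) -> \int[mu]_x f x = 0.
Proof.
move=> [_ [e e0 [K hK]]] cf intf dF.
pose fn (n : nat) := f \_ `[- n%:R, n%:R].
have intn : L1 (fun x => `|f x|) by exact: integrable_norm.
have [_ c] : L1 f /\ ((fun n => \int[mu]_x fn n x) @ \oo --> \int[mu]_x f x).
  apply: (@Rintegral_dominated _ fn f (fun x => `|f x|)) => //.
  - move=> n; exact: (L1_measurable (L1_window _ _ cf)).
  - by move=> n x; rewrite /fn patchE; case: ifP; rewrite ?normr0.
  move=> x; apply: cvg_near_cst; near=> n.
  rewrite /fn patchE mem_set//= in_itv/= -ler_norml.
  by near: n; exact: nbhs_infty_ger.
have c0 : (fun n => \int[mu]_x fn n x) @ \oo --> (0 : R).
  have ge : (fun n : nat => K * expR (- (e * n%:R)) + K * expR (- (e * n%:R))) @ \oo --> (0 : R).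
    have h : (fun n : nat => expR (- (e * n%:R))) @ \oo --> (0 : R).
      apply/cvgr0Pnorm_le => d d0; near=> n.
      rewrite ger0_norm ?expR_ge0// -(@lnK _ d)// ler_expR lerNl -ler_pdivrMl//.
      by near: n; exact: nbhs_infty_ger.
    rewrite -(addr0 0) -(mulr0 K); apply: cvgD; exact: cvgMr.
  apply/norm_cvg0P; apply: (squeeze_cvgr _ (cvg_cst 0) ge).
  near=> n; rewrite normr_ge0/=.
  have n0 : 0 < n%:R :> R by rewrite ltr0n; near: n; exact: nbhs_infty_gt.
  have nn : - n%:R < n%:R :> R by lra.
  rewrite /fn -Rintegral_mkcond (Rintegral_FTC nn (fun x _ => dF x) (fun x _ => cf x)).
  have := hK n%:R; have := hK (- n%:R); rewrite normrN (gtr0_norm n0) => h1 h2.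
  by rewrite (le_trans (ler_normB _ _))// lerD.
exact: (cvg_unique _ c c0).
Unshelve. all: by end_near. Qed.

(** The real part of Gamma(s + 1) = s Gamma(s) at s = a + ib, from integrating the derivative of gam
    a t cos (bt); [sinT_gamS] is the imaginary part. *)
Lemma cosT_gamS a b : 0 < a ->
  cosT (gam (a + 1)) b = a * cosT (gam a) b - b * sinT (gam a) b.
Proof.
move=> a0; have a1 : 0 < a + 1 by rewrite addr_gt0.
have ia := exp_decay_L1 (exp_decay_gam a0); have ia1 := exp_decay_L1 (exp_decay_gam a1).
pose f t := a * (gam a t * cos (b * t)) - b * (gam a t * sin (b * t)) - gam (a + 1) t * cos (b * t).
have if1 : L1 (fun t => a * (gam a t * cos (b * t)) - b * (gam a t * sin (b * t))).
  by apply: L1B; apply: L1Zl; [exact: L1_cos|exact: L1_sin].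
have dz t : is_derive t 1 (fun y : R => b * y) (b * 1) by exact: is_deriveZ.
have cz (t : R) : {for t, continuous (fun y : R => b * y)} := is_derive_continuous (dz t).
have ccos : continuous (fun t => cos (b * t)).
  by move=> t; apply: continuous_comp; [exact: cz|exact: continuous_cos].
have csin : continuous (fun t => sin (b * t)).
  by move=> t; apply: continuous_comp; [exact: cz|exact: continuous_sin].
have : \int[mu]_t f t = 0.
  apply: (@Rintegral_derive_eq0 (fun t => gam a t * cos (b * t))).
  - have [mg [e e0 [K hK]]] := exp_decay_gam a0; split.
      by apply: measurable_funM => //; exact: mfun_cos.
    exists e => //; exists K => x; rewrite normrM (le_trans _ (hK x))//.
    by rewrite ler_piMr// cos_max.
  - move=> t; apply: cvgB; first apply: cvgB.
    + apply: cvgM; first exact: cvg_cst.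
      by apply: cvgM; [exact: continuous_gam|exact: ccos].
    + apply: cvgM; first exact: cvg_cst.
      by apply: cvgM; [exact: continuous_gam|exact: csin].
    + by apply: cvgM; [exact: continuous_gam|exact: ccos].
  - by apply: L1B => //; exact: L1_cos.
  - move=> t; have d := is_deriveM (is_derive_gam a t) (is_derive1_comp (is_derive_cos (b * t)) (dz t)).
    by apply: (is_derive_eq d); rewrite /f /GRing.scale/=; ring.
rewrite /f (RintegralB measurableT if1 (L1_cos b ia1)).
rewrite (RintegralB measurableT (L1Zl a (L1_cos b ia)) (L1Zl b (L1_sin b ia))).
rewrite (RintegralZl _ measurableT (L1_cos b ia)) (RintegralZl _ measurableT (L1_sin b ia)).
by move/eqP; rewrite subr_eq0 => /eqP.
Qed.

Lemma sinT_gamS a b : 0 < a ->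
  sinT (gam (a + 1)) b = a * sinT (gam a) b + b * cosT (gam a) b.
Proof.
move=> a0; have a1 : 0 < a + 1 by rewrite addr_gt0.
have ia := exp_decay_L1 (exp_decay_gam a0); have ia1 := exp_decay_L1 (exp_decay_gam a1).
pose f t := a * (gam a t * sin (b * t)) + b * (gam a t * cos (b * t)) - gam (a + 1) t * sin (b * t).
have if1 : L1 (fun t => a * (gam a t * sin (b * t)) + b * (gam a t * cos (b * t))).
  by apply: L1D; apply: L1Zl; [exact: L1_sin|exact: L1_cos].
have dz t : is_derive t 1 (fun y : R => b * y) (b * 1) by exact: is_deriveZ.
have cz (t : R) : {for t, continuous (fun y : R => b * y)} := is_derive_continuous (dz t).
have ccos : continuous (fun t => cos (b * t)).
  by move=> t; apply: continuous_comp; [exact: cz|exact: continuous_cos].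
have csin : continuous (fun t => sin (b * t)).
  by move=> t; apply: continuous_comp; [exact: cz|exact: continuous_sin].
have : \int[mu]_t f t = 0.
  apply: (@Rintegral_derive_eq0 (fun t => gam a t * sin (b * t))).
  - have [mg [e e0 [K hK]]] := exp_decay_gam a0; split.
      by apply: measurable_funM => //; exact: mfun_sin.
    exists e => //; exists K => x; rewrite normrM (le_trans _ (hK x))//.
    by rewrite ler_piMr// sin_max.
  - move=> t; apply: cvgB; first apply: cvgD.
    + apply: cvgM; first exact: cvg_cst.
      by apply: cvgM; [exact: continuous_gam|exact: csin].
    + apply: cvgM; first exact: cvg_cst.
      by apply: cvgM; [exact: continuous_gam|exact: ccos].
    + by apply: cvgM; [exact: continuous_gam|exact: csin].
  - by apply: L1B => //; exact: L1_sin.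
  - move=> t; have d := is_deriveM (is_derive_gam a t) (is_derive1_comp (is_derive_sin (b * t)) (dz t)).
    by apply: (is_derive_eq d); rewrite /f /GRing.scale/=; ring.
rewrite /f (RintegralB measurableT if1 (L1_sin b ia1)).
rewrite (RintegralD measurableT (L1Zl a (L1_sin b ia)) (L1Zl b (L1_cos b ia))).
rewrite (RintegralZl _ measurableT (L1_cos b ia)) (RintegralZl _ measurableT (L1_sin b ia)).
by move/eqP; rewrite subr_eq0 => /eqP.
Qed.

(** Replaces the square in cos x >= 1 - x^2 / 2 by exponentials, whose integrals against [gam a] are
    exact: they only shift [a] by 1 up or down. *)
Lemma sqr_le_expR (v : R) : v ^+ 2 <= expR v + expR (- v) - 2.
Proof.
have sinh_ge (x : R) : 0 < x -> 2 * x <= expR x - expR (- x).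
  move=> x0; pose g y : R := expR y - expR (- y).
  have dg (y : R) : is_derive y 1 g (expR y + expR (- y)).
    have dN : is_derive y 1 (fun y : R => - y) (- 1) by exact: is_deriveNid.
    have d := is_deriveB (is_derive_expR y) (is_derive1_comp (is_derive_expR (- y)) dN).
    by apply: (is_derive_eq d); ring.
  have cg : {within `[0, x], continuous g}.
    by apply: continuous_subspaceT => y; exact: is_derive_continuous (dg y).
  have [c _] := MVT x0 (fun y _ => dg y) cg.
  rewrite /g oppr0 subrr !subr0 => ->; rewrite addr0 ler_wpM2r ?(ltW x0)//.
  have := expR_ge1Dx c; have := expR_ge1Dx (- c); lra.
have pos (x : R) : 0 < x -> x ^+ 2 <= expR x + expR (- x) - 2.
  move=> x0; have := sinh_ge (x / 2); rewrite divr_gt0// => /(_ isT).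
  have -> : 2 * (x / 2) = x by field.
  have -> : expR x = expR (x / 2) * expR (x / 2) by rewrite -expRD; congr expR; field.
  have -> : expR (- x) = expR (- (x / 2)) * expR (- (x / 2)) by rewrite -expRD; congr expR; field.
  have := expRxMexpNx_1 (x / 2).
  move: (expR (x / 2)) (expR (- (x / 2))) => A B AB xAB.
  have : x ^+ 2 <= (A - B) ^+ 2 by rewrite lerXn2r ?nnegrE ?(ltW x0) ?(le_trans (ltW x0) xAB).
  have -> : (A - B) ^+ 2 = A * A + B * B - 2 * (A * B) by ring.
  by rewrite AB; lra.
have [v0|v0|->] := ltgtP v 0.
- have := pos (- v); rewrite oppr_gt0 => /(_ v0); rewrite sqrrN opprK; lra.
- exact: pos.
- by rewrite oppr0 expR0 expr0n/=; lra.
Qed.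

Lemma Rintegral_gamS a : 0 < a -> \int[mu]_t gam (a + 1) t = a * \int[mu]_t gam a t.
Proof.
move=> a0.
have e c : cosT (gam c) 0 = \int[mu]_t gam c t.
  by apply: eq_Rintegral => t _; rewrite mul0r cos0 mulr1.
by rewrite -!e cosT_gamS// mul0r subr0.
Qed.

Lemma Rintegral_gam_gt0 a : 0 < a -> 0 < \int[mu]_t gam a t.
Proof.
move=> a0; apply: (@lt_le_trans _ _ (\int[mu]_t ((fun=> expR (- expR 1)) \_ `[0, 1]) t)).
  rewrite -Rintegral_mkcond Rintegral_cst//= lebesgue_measure_itv/= lte_fin ltr01.
  by rewrite sube0/= mulr1 expR_gt0.
apply: le_Rintegral => //.
- by apply: L1_window => x; exact: cvg_cst.
- exact: exp_decay_L1 (exp_decay_gam a0).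
move=> t _; rewrite patchE; case: ifP => [|_]; last exact: gam_ge0.
rewrite inE/= in_itv/= => /andP[t0 t1]; rewrite /gam ler_expR.
have : expR t <= expR 1 by rewrite ler_expR.
have : 0 <= a * t by rewrite mulr_ge0// ltW.
lra.
Qed.

(* For large a the Gamma distribution concentrates around a - 1 on a logarithmic
   scale, so the phase e^(ibt) is nearly constant on it. *)
Lemma gam_transform_neq0_large a b : 1 + b ^+ 2 < a ->
  cosT (gam a) b ^+ 2 + sinT (gam a) b ^+ 2 != 0.
Proof.
move=> ba; have b2 := sqr_ge0 b.
have [c ac] : exists c, a = c + 1 by exists (a - 1); rewrite subrK.
have c0 : 0 < c by lra.
have a0 : 0 < a by lra.
have a1 : 0 < a + 1 by lra.
have ia := exp_decay_L1 (exp_decay_gam a0); have ia1 := exp_decay_L1 (exp_decay_gam a1).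
have ic := exp_decay_L1 (exp_decay_gam c0).
apply/negP => /eqP e.
have [C0 S0] : cosT (gam a) b = 0 /\ sinT (gam a) b = 0.
  have := sqr_ge0 (cosT (gam a) b); have := sqr_ge0 (sinT (gam a) b) => h1 h2.
  by split; apply/eqP; rewrite -sqrf_eq0; apply/eqP; lra.
(* With exp t0 = c, the integrals of exp (t - t0) and exp (t0 - t) against [gam a] are (1 + 1/c) I
   and I. The integral of gam a t cos (b (t - t0)) is then at least (1 - d / c) I with d = b^2 / 2,
   which is positive as c > b^2; a zero of the transform would make it 0. *)
pose t0 := ln c.
pose I := \int[mu]_t gam a t.
have I0 : 0 < I by exact: Rintegral_gam_gt0.
have z : \int[mu]_t (cos (b * t0) * (gam a t * cos (b * t)) + sin (b * t0) * (gam a t * sin (b * t))) = 0.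
  rewrite (RintegralD measurableT (L1Zl _ (L1_cos b ia)) (L1Zl _ (L1_sin b ia))).
  rewrite (RintegralZl _ measurableT (L1_cos b ia)) (RintegralZl _ measurableT (L1_sin b ia)).
  by rewrite [X in _ * X]C0 [X in _ + _ * X]S0 !mulr0 addr0.
pose d := b ^+ 2 / 2.
have low : (1 + 2 * d) * I - d * (expR (- t0) * (a * I) + expR t0 * (I / c)) <= 0.
  have Ic : \int[mu]_t gam c t = I / c.
    by rewrite /I ac (Rintegral_gamS c0) mulrC mulKf// gt_eqF.
  have i1 : L1 (fun t => (1 + 2 * d) * gam a t) by exact: L1Zl.
  have i2 : L1 (fun t => d * expR (- t0) * gam (a + 1) t) by exact: L1Zl.
  have i3 : L1 (fun t => d * expR t0 * gam c t) by exact: L1Zl.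
  have i23 := L1D i2 i3.
  rewrite -z.
  apply: (@le_trans _ _ (\int[mu]_t ((1 + 2 * d) * gam a t -
      (d * expR (- t0) * gam (a + 1) t + d * expR t0 * gam c t)))).
    rewrite (RintegralB measurableT i1 i23) (RintegralD measurableT i2 i3).
    rewrite (RintegralZl _ measurableT ia) (RintegralZl _ measurableT ia1).
    rewrite (RintegralZl _ measurableT ic) (Rintegral_gamS a0) Ic -/I.
    by rewrite le_eqVlt; apply/orP; left; apply/eqP; ring.
  apply: le_Rintegral => //.
  - exact: L1B.
  - by apply: L1D; apply: L1Zl; [exact: L1_cos|exact: L1_sin].
  move=> t _.
  have -> : cos (b * t0) * (gam a t * cos (b * t)) + sin (b * t0) * (gam a t * sin (b * t)) =
      gam a t * cos (b * (t - t0)).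
    by rewrite mulrBr cosB; ring.
  have gc : gam c t = expR (- t) * gam a t.
    have -> : c = a + - 1 by lra.
    by rewrite gamD mulN1r.
  rewrite gamD gc mul1r.
  have -> : (1 + 2 * d) * gam a t - (d * expR (- t0) * (expR t * gam a t) +
      d * expR t0 * (expR (- t) * gam a t)) =
      gam a t * (1 - d * (expR t * expR (- t0) + expR (- t) * expR t0 - 2)) by ring.
  rewrite -!expRD ler_wpM2l ?gam_ge0//; apply: le_trans (cos_ge _).
  have := sqr_le_expR (t - t0); rewrite opprB [t0 - t]addrC exprMn /d => h.
  have : b ^+ 2 * (t - t0) ^+ 2 <= b ^+ 2 * (expR (t - t0) + expR (- t + t0) - 2).
    by rewrite ler_wpM2l.
  lra.
have et : expR t0 = c by rewrite /t0 lnK.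
move: low; rewrite expRN et.
have -> : (1 + 2 * d) * I - d * (c^-1 * (a * I) + c * (I / c)) = I * (1 - d / c).
  by rewrite ac; field; rewrite gt_eqF.
rewrite pmulr_rle0// subr_le0 ler_pdivlMr// mul1r /d; lra.
Qed.

(** A zero at a + ib spreads to a + n + ib for every n by the functional equation, and reaches the
    range of [gam_transform_neq0_large]. *)
Lemma gam_transform_neq0 a b : 0 < a ->
  cosT (gam a) b ^+ 2 + sinT (gam a) b ^+ 2 != 0.
Proof.
move=> a0; apply/negP => /eqP e.
have up (n : nat) : cosT (gam (a + n%:R)) b = 0 /\ sinT (gam (a + n%:R)) b = 0.
  elim: n => [|n [IC IS]].
    rewrite addr0; have := sqr_ge0 (cosT (gam a) b); have := sqr_ge0 (sinT (gam a) b) => h1 h2.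
    by split; apply/eqP; rewrite -sqrf_eq0; apply/eqP; lra.
  have an : 0 < a + n%:R by rewrite ltr_pwDl.
  have -> : a + n.+1%:R = a + n%:R + 1 by rewrite -natr1 addrA.
  by rewrite (cosT_gamS _ an) (sinT_gamS _ an) IC IS !mulr0 subr0 addr0.
have [n hn] : exists n : nat, 1 + b ^+ 2 < n%:R.
  exists (Num.truncn (1 + b ^+ 2)).+1; exact: truncnS_gt.
have h : 1 + b ^+ 2 < a + n%:R by lra.
have := gam_transform_neq0_large h; have [-> ->] := up n.
by rewrite expr0n/= addr0 eqxx.
Qed.

End GammaIntegral.

(** * The Macdonald function in a logarithmic variable *)

Section BesselKernel.
Context {R : realType}.
Local Notation mu := (@lebesgue_measure R).
Local Notation L1 f := (mu.-integrable setT (EFin \o f)).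
Implicit Types (a b t : R).

(** K_0(2 sqrt y) with y = exp t. In this variable sqrt n e^((x-u)/2) becomes e^((x-u+ln n)/2), so
    the factor n is a translation by ln n. *)
Definition bessel (t : R) : R := BesselK0 (2 * expR (t / 2)).

Let I t u : R := expR (- (2 * expR (t / 2) * cosh u)).

Let IE t u : I t u = expR (- expR (u + t / 2) - expR (t - (u + t / 2))).
Proof.
rewrite /I /cosh; congr expR.
have -> : t - (u + t / 2) = t / 2 + - u by field.
by rewrite [u + _]addrC !expRD; field.
Qed.

Let I_le q t u : 0 < q -> I t u <=
  expR (2 * q * ln (2 * q) - 2 * q) * expR (- (q * t)) * expR (- (2 * q * `|u|)).
Proof.
move=> q0; have q2 : 0 < 2 * q by rewrite mulr_gt0.
apply: (@le_trans _ _ (expR (- expR (`|u| + t / 2)))).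
  rewrite IE ler_expR; have [u0|u0] := leP 0 u.
    by rewrite (ger0_norm u0) lerBlDr lerDl expR_ge0.
  rewrite (ltr0_norm u0); have -> : t - (u + t / 2) = - u + t / 2 by field.
  by rewrite addrC lerBlDr lerDl expR_ge0.
apply: (le_trans (expR_expR_le _ q2)).
rewrite -[leRHS]mulrA -[X in _ <= _ * X]expRD.
by have -> : - (2 * q * (`|u| + t / 2)) = - (q * t) - 2 * q * `|u| by field.
Qed.

Let I_cont t : continuous (I t).
Proof.
move=> u.
apply: (@continuous_comp _ _ _ (fun u => - (2 * expR (t / 2) * cosh u)) expR); last exact: continuous_expR.
apply: cvgN; apply: cvgM; first exact: cvg_cst.
apply: cvgM; last exact: cvg_cst.
apply: cvgD; first exact: continuous_expR.
by apply: continuous_comp; [exact: cvgN|exact: continuous_expR].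
Qed.

Let I_L1 t : L1 (I t).
Proof.
have mI : measurable_fun setT (I t) by exact: continuous_measurable_fun.
apply: (L1_le mI (g := fun u => expR (2 * 1 * ln (2 * 1) - 2 * 1) * expR (- (1 * t)) *
  expR (- (2 * 1 * `|u|)))).
  by apply: L1Zl; apply: integrable_expR_abs; lra.
by move=> u; rewrite ger0_norm ?expR_ge0//; exact: I_le.
Qed.

Let besselI t : bessel t = 2^-1 * \int[mu]_u I t u.
Proof.
have e : (\int[mu]_u (I t u)%:E = 2%:E * \int[mu]_(u in [set u | (0 <= u)%R]) (I t u)%:E)%E.
  apply: ge0_symfun_integralT => [u||u /=]; [exact: expR_ge0|exact: I_cont|].
  by rewrite /I /cosh opprK [expR u + _]addrC.
have fin : (\int[mu]_(u in [set u | (0 <= u)%R]) (I t u)%:E)%E \is a fin_num.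
  rewrite -set_itvcy; apply: integrable_fin_num => //.
  exact: (integrableS _ _ _ (I_L1 t)).
rewrite /Rintegral e fineM//= mulrA mulVf// mul1r.
by rewrite /bessel /BesselK0 /Rintegral set_itvcy.
Qed.

(** The integrand of K_0 is even in u, hence the 1/2, and r = u + t / 2 turns 2 e^(t/2) cosh u into
    e^r + e^(t-r). This exhibits K_0 as a convolution of two copies of exp (- exp r), the source of
    the square of Gamma. *)
Lemma besselE t : bessel t = 2^-1 * \int[mu]_r expR (- expR r - expR (t - r)).
Proof.
rewrite besselI; congr (_ * _).
have i : L1 (fun r => expR (- expR r - expR (t - r))).
  have := integrable_translate (- (t / 2)) (I_L1 t).
  by apply: eq_integrable => // r _ /=; rewrite IE subrK.
rewrite -(Rintegral_translate (t / 2) i); apply: eq_Rintegral => u _.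
exact: IE.
Qed.

Let L1_kernel t : L1 (fun r => expR (- expR r - expR (t - r))).
Proof.
have := integrable_translate (- (t / 2)) (I_L1 t).
by apply: eq_integrable => // r _ /=; rewrite IE subrK.
Qed.

Local Opaque BesselK0.

Lemma bessel_ge0 t : 0 <= bessel t.
Proof.
by rewrite besselE mulr_ge0//; apply: Rintegral_ge0 => u _; exact: expR_ge0.
Qed.

Lemma bessel_nonincreasing (s t : R) : s <= t -> bessel t <= bessel s.
Proof.
move=> st.
have le_kernel r : expR (- expR r - expR (t - r)) <= expR (- expR r - expR (s - r)).
  by rewrite ler_expR lerD2l lerN2 ler_expR lerD2r.
clear st; have h := le_Rintegral measurableT (L1_kernel t) (L1_kernel s) (fun r _ => le_kernel r).
rewrite (besselE t) (besselE s).
exact: (@ler_wpM2l R 2^-1 (ltac:(by [])) _ _ h).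
Qed.

Lemma measurable_bessel : measurable_fun setT bessel.
Proof.
apply: nonincreasing_measurable; first exact: measurableT.
exact: bessel_nonincreasing.
Qed.

(** K_0 has only a logarithmic singularity at 0 and decays exponentially at infinity, so any q > 0
    will do. A [q] below a given exponent serves t < 0, one above it serves t >= 0. *)
Lemma bessel_le q : 0 < q -> exists2 D, 0 <= D & forall t, bessel t <= D * expR (- (q * t)).
Proof.
move=> q0; pose c := expR (2 * q * ln (2 * q) - 2 * q).
pose J := \int[mu]_u expR (- (2 * q * `|u|)).
have iJ : L1 (fun u => expR (- (2 * q * `|u|))) by apply: integrable_expR_abs; lra.
have J0 : 0 <= J by apply: Rintegral_ge0 => u _; exact: expR_ge0.
exists (2^-1 * c * J).
  by rewrite !mulr_ge0// expR_ge0.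
move=> t; rewrite besselI.
have -> : 2^-1 * c * J * expR (- (q * t)) = 2^-1 * (c * expR (- (q * t)) * J) by ring.
rewrite ler_wpM2l// -RintegralZl//; apply: le_Rintegral => //; first exact: L1Zl.
by move=> u _; exact: I_le.
Qed.

Lemma exp_decay_bessel a : 0 < a -> exp_decay (fun t => expR (a * t) * bessel t).
Proof.
move=> a0; split.
  apply: measurable_funM; last exact: measurable_bessel.
  by apply: (measurableT_comp (@measurable_expR R)); exact: measurable_funM.
have a2 : 0 < a / 2 by rewrite divr_gt0.
have [D D0 hD] := bessel_le a2; have [E E0 hE] : exists2 E, 0 <= E & forall t, bessel t <= E * expR (- (2 * a * t)).
  by apply: bessel_le; rewrite mulr_gt0.
exists (a / 2) => //; exists (D + E) => t.
rewrite ger0_norm ?mulr_ge0 ?expR_ge0 ?bessel_ge0//.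
have P0 := expR_ge0 (- (a / 2 * `|t|)).
have [t0|t0] := leP 0 t.
  apply: (@le_trans _ _ (E * expR (- (a / 2 * `|t|)))); last by rewrite ler_wpM2r// lerDr.
  apply: (le_trans (ler_wpM2l (expR_ge0 _) (hE t))).
  rewrite mulrCA ler_wpM2l// -expRD ler_expR (ger0_norm t0).
  have : 0 <= a * t by rewrite mulr_ge0// ltW.
  lra.
apply: (@le_trans _ _ (D * expR (- (a / 2 * `|t|)))); last by rewrite ler_wpM2r// lerDl.
apply: (le_trans (ler_wpM2l (expR_ge0 _) (hD t))).
by rewrite mulrCA ler_wpM2l// -expRD ler_expR (ltr0_norm t0); lra.
Qed.

(** By [besselE], exp (a t) [bessel t] is half the convolution of [gam a] with itself. The weight
    [w] stands for a cosine or a sine, whose addition formulas then separate the two variables. *)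
Lemma bessel_transform a (w : R -> R) : 0 < a -> measurable_fun setT w ->
  (forall t, `|w t| <= 1) ->
  \int[mu]_t (expR (a * t) * bessel t * w t) =
  2^-1 * \int[mu]_r (gam a r * \int[mu]_t (gam a t * w (t + r))).
Proof.
move=> a0 mw w1.
have ig := exp_decay_L1 (exp_decay_gam a0).
have mg := L1_measurable ig.
have [K hK] : exists K, forall t, `|gam a t| <= K.
  have [_ [e e0 [K hK]]] := exp_decay_gam a0; exists K => t.
  apply: (le_trans (hK t)); rewrite ler_piMr//.
    by have := le_trans (normr_ge0 _) (hK 0); rewrite pmulr_lge0// expR_gt0.
  by rewrite -expR0 ler_expR oppr_le0 mulr_ge0// ltW.
pose F (p : R * R) := gam a p.1 * (gam a (p.2 - p.1) * w p.2).
have mF : measurable_fun setT F.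
  apply: measurable_funM; first exact: (measurableT_comp mg measurable_fst).
  apply: measurable_funM; last exact: (measurableT_comp mw measurable_snd).
  apply: (measurableT_comp mg).
  by apply: measurable_funB; [exact: measurable_snd|exact: measurable_fst].
have iw (r : R) : L1 (fun t => gam a (t - r) * w t).
  exact: (L1_bounded_mul (integrable_translate (- r) ig) mw w1).
have igg (t : R) : L1 (fun r => gam a r * gam a (t - r)).
  exact: (L1_bounded_mul ig (measurable_comp_subr t mg) (fun r => hK (t - r))).
have gg t r : gam a r * gam a (t - r) = expR (a * t) * expR (- expR r - expR (t - r)).
  by rewrite /gam -!expRD; congr expR; ring.
have [||||_ swap] := @Rintegral_fubini R F (fun r => (\int[mu]_t gam a t) * gam a r) mF.
- by move=> r; rewrite /F/=; exact: L1Zl.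
- move=> t; rewrite /F/=.
  have -> : (fun r => gam a r * (gam a (t - r) * w t)) = (fun r => w t * (gam a r * gam a (t - r))).
    by apply/funext => r; ring.
  exact: L1Zl.
- exact: L1Zl.
- move=> r.
  have -> : \int[mu]_t `|F (r, t)| = \int[mu]_t (gam a r * `|gam a (t - r) * w t|).
    by apply: eq_Rintegral => t _; rewrite /F/= normrM (ger0_norm (gam_ge0 _ _)).
  rewrite RintegralZl//; last exact: integrable_norm.
  rewrite mulrC ler_wpM2r ?gam_ge0//.
  rewrite -(Rintegral_translate (- r) ig); apply: le_Rintegral => //.
  + exact: integrable_norm.
  + exact: integrable_translate.
  + move=> t _; rewrite normrM (ger0_norm (gam_ge0 _ _)) ler_piMr ?gam_ge0//.
transitivity (2^-1 * \int[mu]_t (\int[mu]_r F (r, t))).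
  rewrite -RintegralZl//; last first.
    have iB : L1 (fun t => 2 * (expR (a * t) * bessel t * w t)).
      apply: L1Zl; exact: (L1_bounded_mul (exp_decay_L1 (exp_decay_bessel a0)) mw w1).
    move: iB; apply: eq_integrable => // t _ /=; congr (_%:E).
    rewrite besselE /F/=.
    transitivity (\int[mu]_r (w t * expR (a * t) * expR (- expR r - expR (t - r)))).
      by rewrite RintegralZl//; field.
    by apply: eq_Rintegral => r _; rewrite -mulrA -gg; ring.
  apply: eq_Rintegral => t _; rewrite besselE /F/=.
  have -> : \int[mu]_r (gam a r * (gam a (t - r) * w t)) =
      \int[mu]_r (w t * expR (a * t) * expR (- expR r - expR (t - r))).
    by apply: eq_Rintegral => r _; rewrite -[w t * _ * _]mulrA -gg; ring.
  by rewrite RintegralZl//; ring.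
congr (_ * _); rewrite -swap; apply: eq_Rintegral => r _.
rewrite /F/= RintegralZl//; congr (_ * _).
rewrite -(Rintegral_translate r (iw r)); apply: eq_Rintegral => t _.
by rewrite addrK.
Qed.

Lemma bessel_cosT a b : 0 < a -> cosT (fun t => expR (a * t) * bessel t) b =
  2^-1 * (cosT (gam a) b ^+ 2 - sinT (gam a) b ^+ 2).
Proof.
move=> a0; have ig := exp_decay_L1 (exp_decay_gam a0).
have icg := L1_cos b ig; have isg := L1_sin b ig.
rewrite /cosT (@bessel_transform a (fun t => cos (b * t)))//; [|exact: mfun_cos|by move=> t; exact: cos_max].
congr (_ * _).
transitivity (\int[mu]_r (cosT (gam a) b * (gam a r * cos (b * r)) -
    sinT (gam a) b * (gam a r * sin (b * r)))).
  apply: eq_Rintegral => r _.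
  transitivity (gam a r * \int[mu]_t (cos (b * r) * (gam a t * cos (b * t)) -
      sin (b * r) * (gam a t * sin (b * t)))).
    congr (_ * _); apply: eq_Rintegral => t _; rewrite mulrDr cosD; ring.
  rewrite (RintegralB measurableT (L1Zl _ icg) (L1Zl _ isg)).
  rewrite (RintegralZl _ measurableT icg) (RintegralZl _ measurableT isg) -/(cosT _ _) -/(sinT _ _).
  ring.
rewrite (RintegralB measurableT (L1Zl _ icg) (L1Zl _ isg)).
by rewrite (RintegralZl _ measurableT icg) (RintegralZl _ measurableT isg) -/(cosT _ _) -/(sinT _ _) !expr2.
Qed.

Lemma bessel_sinT a b : 0 < a -> sinT (fun t => expR (a * t) * bessel t) b =
  cosT (gam a) b * sinT (gam a) b.
Proof.
move=> a0; have ig := exp_decay_L1 (exp_decay_gam a0).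
have icg := L1_cos b ig; have isg := L1_sin b ig.
rewrite /sinT (@bessel_transform a (fun t => sin (b * t)))//; [|exact: mfun_sin|by move=> t; exact: sin_max].
transitivity (2^-1 * \int[mu]_r (sinT (gam a) b * (gam a r * cos (b * r)) +
    cosT (gam a) b * (gam a r * sin (b * r)))).
  congr (_ * _); apply: eq_Rintegral => r _.
  transitivity (gam a r * \int[mu]_t (sin (b * r) * (gam a t * cos (b * t)) +
      cos (b * r) * (gam a t * sin (b * t)))).
    congr (_ * _); apply: eq_Rintegral => t _; rewrite mulrDr sinD; ring.
  rewrite (RintegralD measurableT (L1Zl _ icg) (L1Zl _ isg)).
  rewrite (RintegralZl _ measurableT icg) (RintegralZl _ measurableT isg) -/(cosT _ _) -/(sinT _ _).
  ring.
rewrite (RintegralD measurableT (L1Zl _ icg) (L1Zl _ isg)).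
rewrite (RintegralZl _ measurableT icg) (RintegralZl _ measurableT isg) -/(cosT _ _) -/(sinT _ _).
by field.
Qed.

Lemma bessel_transform_neq0 a b : 0 < a ->
  cosT (fun t => expR (a * t) * bessel t) b ^+ 2 +
  sinT (fun t => expR (a * t) * bessel t) b ^+ 2 != 0.
Proof.
move=> a0; rewrite bessel_cosT// bessel_sinT//.
have := gam_transform_neq0 b a0; set C := cosT _ b; set S := sinT _ b => h.
have -> : (2^-1 * (C ^+ 2 - S ^+ 2)) ^+ 2 + (C * S) ^+ 2 = (2^-1 * (C ^+ 2 + S ^+ 2)) ^+ 2 by field.
by rewrite expf_neq0// mulf_neq0// invr_eq0.
Qed.

End BesselKernel.

(** * The kernel of the equation *)

Section Domination.
Context {R : realType}.
Local Notation mu := (@lebesgue_measure R).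
Local Notation L1 f := (mu.-integrable setT (EFin \o f)).

Lemma abel_summation (A k : nat -> R) (N : nat) : A 0%N = 0 ->
  \sum_(1 <= m < N.+2) (A m - A m.-1) * k m =
  A N.+1 * k N.+1 + \sum_(1 <= m < N.+1) A m * (k m - k m.+1).
Proof.
move=> A0; elim: N => [|N IH].
  by rewrite big_nat1 big_geq// A0 subr0 addr0.
by rewrite big_nat_recr//= IH [in RHS]big_nat_recr//=; ring.
Qed.

(** After summation by parts the weights k m - k m.+1 are nonnegative, so [A] may be replaced by its
    majorant [B]; summing by parts backwards leaves the increments of [B] as coefficients. *)
Lemma abel_bound (A B k : nat -> R) (N : nat) : A 0%N = 0 -> B 0%N = 0 ->
  (forall m, `|A m| <= B m) -> (forall m, 0 <= k m) ->
  (forall m, (0 < m)%N -> k m.+1 <= k m) ->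
  `|\sum_(1 <= m < N.+1) (A m - A m.-1) * k m| <=
  \sum_(1 <= m < N.+1) (B m - B m.-1) * k m.
Proof.
move=> A0 B0 AB k0 kd; case: N => [|N]; first by rewrite !big_geq// normr0.
rewrite !abel_summation// (le_trans (ler_normD _ _))//; apply: lerD.
  by rewrite normrM (ger0_norm (k0 _)) ler_wpM2r.
rewrite (le_trans (ler_norm_sum _ _ _))//.
rewrite big_nat_cond [leRHS]big_nat_cond; apply: ler_sum => m /andP[/andP[m0 _] _].
by rewrite normrM [X in _ * X]ger0_norm ?subr_ge0 ?kd// ler_wpM2r// subr_ge0 kd.
Qed.

Lemma sqrt_expR_ln (x : R) : 0 < x -> Num.sqrt x = expR (ln x / 2).
Proof.
move=> x0; rewrite -{1}(@lnK _ x)//.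
have {1}-> : ln x = ln x / 2 + ln x / 2 by field.
by rewrite expRD -expr2 sqrtr_sqr ger0_norm ?expR_ge0.
Qed.

Lemma sqrt_diff_le (m : nat) : (0 < m)%N ->
  Num.sqrt m%:R - Num.sqrt m.-1%:R <= expR (- (2^-1 * ln m%:R)) :> R.
Proof.
case: m => // m _ /=; have m1 : 0 < m.+1%:R :> R by rewrite ltr0n.
rewrite mulrC expRN -sqrt_expR_ln//.
set x := Num.sqrt m.+1%:R; set y := Num.sqrt m%:R.
have x0 : 0 < x by rewrite sqrtr_gt0.
have y0 : 0 <= y by rewrite sqrtr_ge0.
have yx : y <= x by rewrite ler_wsqrtr// ler_nat.
have x2 : x * x = m%:R + 1 by rewrite -expr2 sqr_sqrtr ?ltW// natr1.
have y2 : y * y = m%:R by rewrite -expr2 sqr_sqrtr// ler0n.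
rewrite -[leRHS]mul1r ler_pdivlMr//.
have : y * y <= y * x by rewrite ler_wpM2l.
have -> : (x - y) * x = x * x - y * x by ring.
lra.
Qed.

Lemma power_sum_le (e : R) (N : nat) : 0 < e ->
  \sum_(1 <= m < N.+1) expR (- ((1 + e) * ln m%:R)) <= 1 + e^-1.
Proof.
move=> e0; have [->|N0] := posnP N.
  by rewrite big_geq// addr_ge0// invr_ge0 ltW.
(* The comparison with the integral of x^(-1-e) over [1, N]: subtracting N^(-e) / e makes the bound
   inductive. *)
suff : \sum_(1 <= m < N.+1) expR (- ((1 + e) * ln m%:R)) <=
    1 + e^-1 - expR (- (e * ln N%:R)) / e.
  by move=> h; apply: (le_trans h); rewrite gerBl divr_ge0 ?expR_ge0 ?ltW.
elim: N N0 => // -[_ _|N IH _].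
  by rewrite big_nat1 ln1 !mulr0 oppr0 expR0 mul1r addrK.
rewrite big_nat_recr//=; apply: (le_trans (lerD (IH isT) (lexx _))).
set n : R := N.+1%:R; set n' : R := N.+2%:R.
have n0 : 0 < n by rewrite ltr0n.
have n'0 : 0 < n' by rewrite ltr0n.
have nE : n = n' * (1 - n'^-1).
  by rewrite mulrBr mulfV ?gt_eqF// mulr1 /n' -[N.+2%:R]natr1 addrK.
have q0 : 0 < 1 - n'^-1 by rewrite -(pmulr_rgt0 _ n'0) -nE.
clearbody n n'.
have lnn : ln n <= ln n' - n'^-1.
  by rewrite nE lnM// lerD2l; apply: le_ln1Dx; rewrite ltrN2 -subr_gt0.
have h1 : expR (- (e * ln n')) * expR (e * n'^-1) <= expR (- (e * ln n)).
  rewrite -expRD ler_expR.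
  have : e * ln n <= e * (ln n' - n'^-1) by rewrite ler_wpM2l// ltW.
  lra.
have h2 : expR (- ((1 + e) * ln n')) = expR (- (e * ln n')) * n'^-1.
  by rewrite mulrDl mul1r opprD expRD [expR (- ln n')]expRN lnK// mulrC.
rewrite h2.
have h3 := expR_ge1Dx (e * n'^-1).
have P0 := expR_ge0 (- (e * ln n')).
have h4 : expR (- (e * ln n')) * (1 + e * n'^-1) <= expR (- (e * ln n)).
  by apply: le_trans h1; rewrite ler_wpM2l.
have h5 : expR (- (e * ln n')) * n'^-1 <= (expR (- (e * ln n)) - expR (- (e * ln n'))) / e.
  rewrite ler_pdivlMr//.
  have -> : expR (- (e * ln n')) * n'^-1 * e = expR (- (e * ln n')) * (1 + e * n'^-1) - expR (- (e * ln n')).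
    by ring.
  by rewrite lerD2r.
move: h5; rewrite mulrBl; lra.
Qed.

Let A (m : nat) : R := \sum_(1 <= i < m.+1) (altconv i)%:~R.

Let AS m : (0 < m)%N -> (altconv m)%:~R = A m - A m.-1.
Proof. by case: m => // m _; rewrite /A/= [in RHS]big_nat_recr//= addrAC subrr add0r. Qed.

Lemma altconv_le (m : nat) : (0 < m)%N -> `|(altconv m)%:~R| <= 6 * m%:R :> R.
Proof.
move=> m0; rewrite AS// (le_trans (ler_normB _ _))//.
have s (n : nat) : (n <= m)%N -> 3 * Num.sqrt n%:R <= 3 * m%:R :> R.
  move=> nm; rewrite ler_wpM2l// (@le_trans _ _ (Num.sqrt m%:R))//.
    by rewrite ler_wsqrtr// ler_nat.
  rewrite -[leRHS]ger0_norm// -sqrtr_sqr ler_wsqrtr// expr2 -natrM ler_nat.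
  by rewrite leq_pmulr.
have h1 := le_trans (sum_altconv_le R m) (s m (leqnn m)).
have h2 := le_trans (sum_altconv_le R m.-1) (s m.-1 (leq_pred m)).
have := lerD h1 h2; rewrite /A; lra.
Qed.

(** [abel_bound] exchanges the coefficients for increments of 3 sqrt m, at most 3 m^(-1/2), and
    [bessel_le] supplies m^(-q). The resulting series of m^(-1/2-q) converges for q > 1/2, uniformly
    in [N]. *)
Lemma bessel_psum_le (q : R) : 2^-1 < q -> exists2 C, 0 <= C & forall N t,
  `|\sum_(1 <= m < N.+1) (altconv m)%:~R * bessel (t + ln m%:R)| <= C * expR (- (q * t)).
Proof.
move=> q2; have q0 : 0 < q by apply: lt_trans q2; rewrite invr_gt0.
have [D D0 hD] := bessel_le q0.
have e0 : 0 < q - 2^-1 by rewrite subr_gt0.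
exists (3 * D * (1 + (q - 2^-1)^-1)).
  by rewrite mulr_ge0 ?mulr_ge0// addr_ge0// invr_ge0 ltW.
move=> N t.
have -> : \sum_(1 <= m < N.+1) (altconv m)%:~R * bessel (t + ln m%:R) =
    \sum_(1 <= m < N.+1) (A m - A m.-1) * bessel (t + ln m%:R).
  by apply: eq_big_nat => m /andP[m0 _]; rewrite AS.
have ab := @abel_bound A (fun m => 3 * Num.sqrt m%:R) (fun m => bessel (t + ln m%:R)) N.
apply: (le_trans (ab _ _ _ _ _)).
- by rewrite /A big_geq.
- by rewrite sqrtr0 mulr0.
- by move=> m; exact: sum_altconv_le.
- by move=> m; exact: bessel_ge0.
- move=> m m0; apply: bessel_nonincreasing; rewrite lerD2l ler_ln ?posrE ?ltr0n//.
  by rewrite ler_nat.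
apply: (@le_trans _ _ (\sum_(1 <= m < N.+1) 3 * D * expR (- (q * t)) *
    expR (- ((1 + (q - 2^-1)) * ln m%:R)))); last first.
  rewrite -mulr_sumr -[X in _ <= X]mulrAC ler_wpM2l//.
    by rewrite !mulr_ge0 ?expR_ge0.
  exact: power_sum_le.
rewrite big_nat_cond [leRHS]big_nat_cond; apply: ler_sum => m /andP[/andP[m0 _] _].
rewrite -mulrBr.
have -> : 3 * D * expR (- (q * t)) * expR (- ((1 + (q - 2^-1)) * ln m%:R)) =
   (3 * expR (- (2^-1 * ln m%:R))) * (D * expR (- (q * (t + ln m%:R)))).
  have -> : - ((1 + (q - 2^-1)) * ln (m%:R : R)) = - (2^-1 * ln m%:R) + - (q * ln m%:R) by field.
  by rewrite [q * (t + _)]mulrDr opprD !expRD; ring.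
apply: ler_pM.
- by rewrite mulr_ge0// subr_ge0 ler_wsqrtr// ler_nat leq_pred.
- exact: bessel_ge0.
- by rewrite ler_wpM2l// sqrt_diff_le.
- exact: hD.
Qed.

Lemma bessel_series_cvg (t : R) :
  cvgn (fun N => \sum_(1 <= m < N.+1) (altconv m)%:~R * bessel (t + ln m%:R)).
Proof.
(* Against the crude bound 6 m of [altconv_le], decay m^(-3) makes the terms O(m^(-2)), enough for
   convergence at a fixed [t]. *)
have three : 0 < 3 :> R by [].
have [D D0 hD] := bessel_le three.
pose c := 6 * D * expR (- (3 * t)).
have c0 : 0 <= c by rewrite !mulr_ge0 ?expR_ge0.
pose u k : R := (altconv k.+1)%:~R * bessel (t + ln k.+1%:R).
pose v k : R := c * expR (- ((1 + 1) * ln k.+1%:R)).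
have uv k : `|u k| <= v k.
  rewrite normrM (ger0_norm (bessel_ge0 _)).
  apply: (le_trans (ler_pM (normr_ge0 _) (bessel_ge0 _) (altconv_le (ltn0Sn k)) (hD _))).
  have k0 : 0 < k.+1%:R :> R by rewrite ltr0n.
  rewrite -[X in 6 * X](@lnK _ k.+1%:R)//.
  rewrite /v /c le_eqVlt; apply/orP; left; apply/eqP.
  have -> : - ((1 + 1) * ln (k.+1%:R : R)) = ln k.+1%:R + - (3 * ln k.+1%:R) by ring.
  by rewrite [3 * (t + _)]mulrDr opprD !expRD; ring.
have v0 k : 0 <= v k by rewrite mulr_ge0 ?expR_ge0.
have cv : cvgn (series v).
  apply: nondecreasing_is_cvgn.
    by apply: nondecreasing_series => n _ _; exact: v0.
  exists (c * (1 + 1^-1)) => _ [n _ <-].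
  rewrite seriesEnat/= -mulr_sumr ler_wpM2l//.
  have := power_sum_le n (@ltr01 R).
  by rewrite big_add1.
have cu : cvgn (series u).
  apply: normed_cvg; apply: series_le_cvg cv => // n; exact: normr_ge0.
have -> : (fun N => \sum_(1 <= m < N.+1) (altconv m)%:~R * bessel (t + ln m%:R)) = series u.
  by apply/funext => N; rewrite seriesEnat/= big_add1.
exact: cu.
Qed.

End Domination.

(** * The limit kernel and its Fourier transform *)

Section SeriesKernel.
Context {R : realType}.
Local Notation mu := (@lebesgue_measure R).
Local Notation L1 f := (mu.-integrable setT (EFin \o f)).
Local Notation normc := (@Normc.normc R).
Variable delta : R.
Hypothesis delta_gt : 2^-1 < delta.
Hypothesis delta_lt : delta < 1.

Let d0 : 0 < delta. Proof. by apply: lt_trans delta_gt; rewrite invr_gt0. Qed.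

Let h0 (t : R) : R := expR (delta * t) * bessel t.

(** The kernel of K_m as a function of t = x - u, after e^(-delta u) = e^(-delta x) e^(delta (x-u))
    has released its factor in x. *)
Definition mkernel (m : nat) (t : R) : R := expR (delta * t) * bessel (t + ln m%:R).

Lemma mkernelE m t : mkernel m t = expR (- (delta * ln m%:R)) * h0 (t + ln m%:R).
Proof. by rewrite /mkernel /h0 mulrA -expRD; congr (expR _ * _); ring. Qed.

Let ih0 : L1 h0. Proof. exact: exp_decay_L1 (exp_decay_bessel d0). Qed.

Lemma L1_mkernel m : L1 (mkernel m).
Proof.
have -> : mkernel m = fun t => expR (- (delta * ln m%:R)) * h0 (t + ln m%:R).
  by apply/funext => t; exact: mkernelE.
by apply: L1Zl; exact: integrable_translate.
Qed.

Definition pkernel (N : nat) (t : R) : R :=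
  \sum_(1 <= m < N.+1) (altconv m)%:~R * mkernel m t.

Lemma L1_pkernel N : L1 (pkernel N).
Proof. by apply: L1_sum => m; apply: L1Zl; exact: L1_mkernel. Qed.

Lemma pkernelE N t : pkernel N t =
  expR (delta * t) * \sum_(1 <= m < N.+1) (altconv m)%:~R * bessel (t + ln m%:R).
Proof.
by rewrite mulr_sumr; apply: eq_bigr => m _; rewrite /mkernel; ring.
Qed.

Definition skernel (t : R) : R := limn (pkernel ^~ t).

Lemma pkernel_cvg t : pkernel ^~ t @ \oo --> skernel t.
Proof.
suff : cvgn (pkernel ^~ t) by [].
have /cvg_ex[l hl] := @bessel_series_cvg R t.
apply/cvg_ex; exists (expR (delta * t) * l).
have -> : pkernel ^~ t = fun N => expR (delta * t) *
    \sum_(1 <= m < N.+1) (altconv m)%:~R * bessel (t + ln m%:R).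
  by apply/funext => N; exact: pkernelE.
by apply: cvgM; [exact: cvg_cst|exact: hl].
Qed.

(** Exponents delta - e and delta + e, both above 1/2, handle t < 0 and t >= 0. Uniformity in [N]
    makes the bound a dominating function for all limits below. *)
Lemma pkernel_le : exists2 e, 0 < e & exists K, forall N t,
  `|pkernel N t| <= K * expR (- (e * `|t|)).
Proof.
pose e := (delta - 2^-1) / 2.
have e0 : 0 < e by rewrite divr_gt0// subr_gt0.
have q1 : 2^-1 < delta - e by move: delta_gt => h; rewrite /e; lra.
have q2 : 2^-1 < delta + e by move: delta_gt => h; rewrite /e; lra.
have [C C0 hC] := bessel_psum_le q1; have [D D0 hD] := bessel_psum_le q2.
exists e => //; exists (C + D) => N t; rewrite pkernelE normrM (ger0_norm (expR_ge0 _)).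
have P0 := expR_ge0 (- (e * `|t|)).
have [t0|t0] := leP 0 t.
  apply: (@le_trans _ _ (D * expR (- (e * `|t|)))); last by rewrite ler_wpM2r// lerDr.
  apply: (le_trans (ler_wpM2l (expR_ge0 _) (hD N t))).
  by rewrite mulrCA ler_wpM2l// -expRD ler_expR (ger0_norm t0); lra.
apply: (@le_trans _ _ (C * expR (- (e * `|t|)))); last by rewrite ler_wpM2r// lerDl.
apply: (le_trans (ler_wpM2l (expR_ge0 _) (hC N t))).
by rewrite mulrCA ler_wpM2l// -expRD ler_expR (ltr0_norm t0); lra.
Qed.

Lemma exp_decay_skernel : exp_decay skernel.
Proof.
split.
  apply: (@measurable_fun_cvg _ _ _ _ pkernel); last by move=> t _; exact: pkernel_cvg.
  by move=> N; exact: (L1_measurable (L1_pkernel N)).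
have [e e0 [K hK]] := pkernel_le; exists e => //; exists K => t.
have c : (fun N => `|pkernel N t|) @ \oo --> `|skernel t| by apply: cvg_norm; exact: pkernel_cvg.
rewrite -(cvg_lim _ c)//; apply: limr_le; first by apply/cvg_ex; exists `|skernel t|.
by apply: nearW => N; exact: hK.
Qed.

(** The parameter [y] of the weight is the frequency when the limit is a transform, and the point x
    when it is a convolution. *)
Lemma pkernel_integral_cvg (w : R -> R -> R) (y M : R) :
  measurable_fun setT (w y) -> (forall t, `|w y t| <= M) ->
  (fun N => \int[mu]_t (pkernel N t * w y t)) @ \oo --> \int[mu]_t (skernel t * w y t).
Proof.
move=> mw wM; have [e e0 [K hK]] := pkernel_le.
have M0 : 0 <= M by exact: le_trans (normr_ge0 _) (wM 0).
have [] // := @Rintegral_dominated R (fun N t => pkernel N t * w y t)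
  (fun t => skernel t * w y t) (fun t => M * K * expR (- (e * `|t|))).
- by move=> N; apply: measurable_funM => //; exact: (L1_measurable (L1_pkernel N)).
- move=> N t; rewrite normrM mulrC -mulrA; apply: ler_pM => //.
- by apply: L1Zl; exact: integrable_expR_abs.
- by move=> t; apply: cvgM; [exact: pkernel_cvg|exact: cvg_cst].
Qed.

Variable b : R.
Let s : R[i] := delta +i* b.
Let M0 : R[i] := cosT h0 b +i* sinT h0 b.

(** [mkernel m] is m^(-delta) times [h0] translated by ln m, and the translation contributes e^(-ib
    ln m); together this is m^(-s). *)
Lemma mkernel_transform (m : nat) : (0 < m)%N ->
  cosT (mkernel m) b +i* sinT (mkernel m) b = rcpow m%:R (- s) * M0.
Proof.
move=> m0; set l := ln (m%:R : R).
have key (X Y C S : R) : X = expR (- (delta * l)) * (cos (b * l) * C + sin (b * l) * S) ->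
    Y = expR (- (delta * l)) * (cos (b * l) * S - sin (b * l) * C) ->
    X +i* Y = rcpow m%:R (- s) * (C +i* S).
  move=> -> ->.
  by apply: complex_ext; rewrite /rcpow /s !(ReM, ImM)/= -/l !mulNr cosN sinN; ring.
have ihc := L1_cos b ih0; have ihs := L1_sin b ih0.
have tr (w : R -> R) : L1 (fun v => h0 v * w (v - l)) ->
    \int[mu]_t (mkernel m t * w t) = expR (- (delta * l)) * \int[mu]_v (h0 v * w (v - l)).
  move=> i; rewrite -(Rintegral_translate l i) -RintegralZl//; last first.
    exact: (integrable_translate l i).
  by apply: eq_Rintegral => t _; rewrite mkernelE addrK; ring.
have cE : cosT (mkernel m) b = expR (- (delta * l)) * (cos (b * l) * cosT h0 b + sin (b * l) * sinT h0 b).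
  have e v : h0 v * cos (b * (v - l)) = cos (b * l) * (h0 v * cos (b * v)) + sin (b * l) * (h0 v * sin (b * v)).
    by rewrite mulrBr cosB; ring.
  have i : L1 (fun v => h0 v * cos (b * (v - l))).
    have -> : (fun v => h0 v * cos (b * (v - l))) =
      (fun v => cos (b * l) * (h0 v * cos (b * v)) + sin (b * l) * (h0 v * sin (b * v))).
      by apply/funext => v; exact: e.
    exact: (L1D (L1Zl _ ihc) (L1Zl _ ihs)).
  have t1 := tr (fun t => cos (b * t)) i.
  transitivity (expR (- (delta * l)) * \int[mu]_v (h0 v * cos (b * (v - l)))); first exact: t1.
  congr (_ * _); transitivity (\int[mu]_v (cos (b * l) * (h0 v * cos (b * v)) + sin (b * l) * (h0 v * sin (b * v)))).
    by apply: eq_Rintegral => v _; exact: e.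
  rewrite (RintegralD measurableT (L1Zl _ ihc) (L1Zl _ ihs)).
  by rewrite (RintegralZl _ measurableT ihc) (RintegralZl _ measurableT ihs).
have sE : sinT (mkernel m) b = expR (- (delta * l)) * (cos (b * l) * sinT h0 b - sin (b * l) * cosT h0 b).
  have e v : h0 v * sin (b * (v - l)) = cos (b * l) * (h0 v * sin (b * v)) - sin (b * l) * (h0 v * cos (b * v)).
    by rewrite mulrBr sinB; ring.
  have i : L1 (fun v => h0 v * sin (b * (v - l))).
    have -> : (fun v => h0 v * sin (b * (v - l))) =
      (fun v => cos (b * l) * (h0 v * sin (b * v)) - sin (b * l) * (h0 v * cos (b * v))).
      by apply/funext => v; exact: e.
    exact: (L1B (L1Zl _ ihs) (L1Zl _ ihc)).
  have t1 := tr (fun t => sin (b * t)) i.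
  transitivity (expR (- (delta * l)) * \int[mu]_v (h0 v * sin (b * (v - l)))); first exact: t1.
  congr (_ * _); transitivity (\int[mu]_v (cos (b * l) * (h0 v * sin (b * v)) - sin (b * l) * (h0 v * cos (b * v)))).
    by apply: eq_Rintegral => v _; exact: e.
  rewrite (RintegralB measurableT (L1Zl _ ihs) (L1Zl _ ihc)).
  by rewrite (RintegralZl _ measurableT ihs) (RintegralZl _ measurableT ihc).
exact: (key _ _ _ _ cE sE).
Qed.

Lemma Re_sum_int (I : Type) (r : seq I) (P : pred I) (a : I -> int) (F : I -> R[i]) :
  complex.Re (\sum_(i <- r | P i) (a i)%:~R * F i) = \sum_(i <- r | P i) (a i)%:~R * complex.Re (F i).
Proof.
elim/big_rec2 : _ => [//|i x y _ <-]; rewrite ReD; congr (_ + _).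
by rewrite -(rmorph_int (real_complex R)) Re_real.
Qed.

Lemma Im_sum_int (I : Type) (r : seq I) (P : pred I) (a : I -> int) (F : I -> R[i]) :
  complex.Im (\sum_(i <- r | P i) (a i)%:~R * F i) = \sum_(i <- r | P i) (a i)%:~R * complex.Im (F i).
Proof.
elim/big_rec2 : _ => [//|i x y _ <-]; rewrite ImD; congr (_ + _).
by rewrite -(rmorph_int (real_complex R)) Im_real.
Qed.

Lemma pkernel_transform (N : nat) :
  cosT (pkernel N) b +i* sinT (pkernel N) b =
  (\sum_(1 <= m < N.+1) (altconv m)%:~R * rcpow (m%:R : R) (- s)) * M0.
Proof.
have -> : (\sum_(1 <= m < N.+1) (altconv m)%:~R * rcpow (m%:R : R) (- s)) * M0 =
    \sum_(1 <= m < N.+1) (altconv m)%:~R * (cosT (mkernel m) b +i* sinT (mkernel m) b).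
  rewrite mulr_suml; apply: eq_big_nat => m /andP[m0 _].
  by rewrite (mkernel_transform m0) -mulrA.
apply: complex_ext; rewrite ?Re_sum_int ?Im_sum_int/=.
  rewrite /cosT; transitivity (\int[mu]_t (\sum_(1 <= m < N.+1) (altconv m)%:~R * (mkernel m t * cos (b * t)))).
    by apply: eq_Rintegral => t _; rewrite /pkernel mulr_suml; apply: eq_bigr => m _; rewrite -mulrA.
  rewrite Rintegral_sum; last by move=> m; apply: L1Zl; apply: L1_cos; exact: L1_mkernel.
  by apply: eq_bigr => m _; rewrite RintegralZl//; apply: L1_cos; exact: L1_mkernel.
rewrite /sinT; transitivity (\int[mu]_t (\sum_(1 <= m < N.+1) (altconv m)%:~R * (mkernel m t * sin (b * t)))).
  by apply: eq_Rintegral => t _; rewrite /pkernel mulr_suml; apply: eq_bigr => m _; rewrite -mulrA.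
rewrite Rintegral_sum; last by move=> m; apply: L1Zl; apply: L1_sin; exact: L1_mkernel.
by apply: eq_bigr => m _; rewrite RintegralZl//; apply: L1_sin; exact: L1_mkernel.
Qed.

(** The transforms of the partial kernels have two limits: the transform of [skernel] by domination,
    and eta(s)^2 M0 by [pkernel_transform] and the Dirichlet series. If the first is 0, so is the
    second, against eta(s) and M0 being nonzero. *)
Lemma skernel_transform_neq0 : zeta s <> 0 ->
  cosT skernel b ^+ 2 + sinT skernel b ^+ 2 != 0.
Proof.
move=> zs; apply/negP => /eqP e.
have [C0 S0] : cosT skernel b = 0 /\ sinT skernel b = 0.
  have := sqr_ge0 (cosT skernel b); have := sqr_ge0 (sinT skernel b) => h1 h2.
  by split; apply/eqP; rewrite -sqrf_eq0; apply/eqP; lra.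
have eta0 : eta s != 0 by exact: eta_neq0.
have M00 : M0 != 0.
  apply/eqP => M0E.
  have hC : cosT h0 b = 0 := congr1 (@complex.Re R) M0E.
  have hS : sinT h0 b = 0 := congr1 (@complex.Im R) M0E.
  have /negP := bessel_transform_neq0 b d0; apply.
  rewrite [X in X ^+ 2 + _]hC [X in _ + X ^+ 2]hS.
  by rewrite expr0n/= addr0.
have cC := @pkernel_integral_cvg (fun y t => cos (y * t)) b 1 (mfun_cos b) (fun t => cos_max (b * t)).
have cS := @pkernel_integral_cvg (fun y t => sin (y * t)) b 1 (mfun_sin b) (fun t => sin_max (b * t)).
rewrite -/(cosT skernel b) C0 in cC; rewrite -/(sinT skernel b) S0 in cS.
have cP : (fun N => `|cosT (pkernel N) b| + `|sinT (pkernel N) b|) @ \oo --> (0 : R).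
  rewrite -[X in _ --> X]addr0 -{1}(normr0 R) -{2}(normr0 R).
  by apply: cvgD; apply: cvg_norm.
have s_gt0 : 0 < complex.Re s by exact: d0.
have cE := @altconv_psum_cvg R s s_gt0 delta_lt delta_gt.
have cEM : (fun N => normc M0 * normc (\sum_(1 <= m < N.+1) (altconv m)%:~R *
    rcpow (m%:R : R) (- s) - eta s ^+ 2)) @ \oo --> (0 : R).
  by rewrite -(mulr0 (normc M0)); apply: cvgM; [exact: cvg_cst|exact: cE].
have c : (fun N => normc M0 * normc (\sum_(1 <= m < N.+1) (altconv m)%:~R *
    rcpow (m%:R : R) (- s) - eta s ^+ 2) + (`|cosT (pkernel N) b| + `|sinT (pkernel N) b|))
    @ \oo --> (0 : R).
  by rewrite -[X in _ --> X]addr0; apply: cvgD.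
have nz : 0 < normc (eta s ^+ 2 * M0).
  rewrite lt_neqAle normc_ge0 andbT eq_sym.
  apply/eqP => /Normc.eq0_normc/eqP.
  by rewrite mulf_eq0 expf_eq0/= (negbTE eta0) (negbTE M00).
have step N : normc (eta s ^+ 2 * M0) <= normc M0 * normc (\sum_(1 <= m < N.+1)
    (altconv m)%:~R * rcpow (m%:R : R) (- s) - eta s ^+ 2) +
    (`|cosT (pkernel N) b| + `|sinT (pkernel N) b|).
  have tN := pkernel_transform N; set S := \sum_(_ <= _ < _) _ in tN *.
  have -> : eta s ^+ 2 * M0 = S * M0 - (M0 * (S - eta s ^+ 2)) by ring.
  rewrite (le_trans (normcB_le _ _))// [normc (M0 * _)]Normc.normcM addrC lerD2l.
  by rewrite -tN (le_trans (normc_ReIm _)).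
have : normc (eta s ^+ 2 * M0) <= 0.
  by apply: (cvgr_to_ge c); apply: nearW => N; exact: step.
by rewrite leNgt nz.
Qed.

End SeriesKernel.

(** * The equation and its solutions *)

Section Equation.
Context {R : realType}.
Local Notation mu := (@lebesgue_measure R).
Local Notation L1 f := (mu.-integrable setT (EFin \o f)).
Local Notation normc := (@Normc.normc R).
Variable delta : R.
Hypothesis delta_gt : 2^-1 < delta.

Let d0 : 0 < delta. Proof. by apply: lt_trans delta_gt; rewrite invr_gt0. Qed.

Lemma opKE (m : nat) (f : R -> R[i]) (x : R) : (0 < m)%N ->
  opK delta m f x =
  (\int[mu]_u (expR (- (delta * x)) * (mkernel delta m (x - u) * complex.Re (f u)))) +i*
  (\int[mu]_u (expR (- (delta * x)) * (mkernel delta m (x - u) * complex.Im (f u)))).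
Proof.
move=> m0.
have kE u : expR (- (delta * u)) * BesselK0 (2 * Num.sqrt m%:R * expR ((x - u) / 2)) =
    expR (- (delta * x)) * mkernel delta m (x - u).
  have -> : expR (- (delta * u)) = expR (- (delta * x)) * expR (delta * (x - u)).
    by rewrite -expRD; congr expR; ring.
  have -> : 2 * Num.sqrt m%:R * expR ((x - u) / 2) = 2 * expR ((x - u + ln m%:R) / 2) :> R.
    rewrite sqrt_expR_ln ?ltr0n// -mulrA -expRD; congr (2 * expR _).
    by rewrite -mulrDl addrC.
  by rewrite /mkernel /bessel; move: (BesselK0 _) => B; rewrite mulrA.
rewrite /opK /cintegral; congr (_ +i* _); apply: eq_Rintegral => u _.
  by rewrite Re_real kE mulrA.
by rewrite Im_real kE mulrA.
Qed.

Lemma eqn_psumE (f : R -> R[i]) (x : R) (N : nat) :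
  eqn_psum delta f x N = \sum_(1 <= m < N.+1) (altconv m)%:~R * opK delta m f x.
Proof.
apply: (@sum_altconvE _ N (fun m => opK delta m f x) (fun m => opK_upto delta N m f x)).
  by move=> n Nn; rewrite /opK_upto ifN// -ltnNge.
by move=> n nN; rewrite /opK_upto ifT.
Qed.

Lemma pkernel_conv (f : R -> R) (M x : R) (N : nat) : measurable_fun setT f ->
  (forall u, `|f u| <= M) ->
  \sum_(1 <= m < N.+1) (altconv m)%:~R *
    (\int[mu]_u (expR (- (delta * x)) * (mkernel delta m (x - u) * f u))) =
  expR (- (delta * x)) * \int[mu]_u (pkernel delta N (x - u) * f u).
Proof.
move=> mf fM.
have im m : L1 (fun u => mkernel delta m (x - u) * f u).
  exact: (L1_bounded_mul (integrable_sub x (L1_mkernel delta_gt m)) mf fM).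
have -> : \int[mu]_u (pkernel delta N (x - u) * f u) =
    \int[mu]_u (\sum_(1 <= m < N.+1) (altconv m)%:~R * (mkernel delta m (x - u) * f u)).
  by apply: eq_Rintegral => u _; rewrite /pkernel mulr_suml; apply: eq_bigr => m _; rewrite -mulrA.
rewrite Rintegral_sum; last by move=> m; exact: L1Zl.
rewrite mulr_sumr; apply: eq_bigr => m _.
by rewrite !(RintegralZl _ measurableT (im m)); ring.
Qed.

(** [g] stands for the real or the imaginary part of [f]; the first hypothesis says that its part of
    the partial sum is controlled by the modulus of the whole. Domination then passes from the
    partial kernels to the limit kernel. *)
Lemma solves_real (f : R -> R[i]) (g : R -> R) (M : R) :
  (forall N x, expR (- (delta * x)) * `|\int[mu]_u (pkernel delta N (x - u) * g u)| <=
     normc (eqn_psum delta f x N)) ->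
  measurable_fun setT g -> (forall u, `|g u| <= M) -> solves_eqn delta f ->
  forall x, \int[mu]_u (skernel delta (x - u) * g u) = 0.
Proof.
move=> le mg gM sol x.
have swap (h : R -> R) : L1 h ->
    \int[mu]_u (h (x - u) * g u) = \int[mu]_t (h t * g (x - t)).
  move=> ih; have i := L1_bounded_mul (integrable_sub x ih) mg gM.
  rewrite -(Rintegral_sub x i); apply: eq_Rintegral => t _.
  by rewrite subKr.
have c1 := @pkernel_integral_cvg R delta delta_gt (fun y t => g (y - t)) x M
  (measurable_comp_subr x mg) (fun t => gM (x - t)).
have c2 : (fun N => \int[mu]_t (pkernel delta N t * g (x - t))) @ \oo --> (0 : R).
  have cb : (fun N => expR (delta * x) * normc (eqn_psum delta f x N)) @ \oo --> (0 : R).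
    by rewrite -(mulr0 (expR (delta * x))); apply: cvgM; [exact: cvg_cst|exact: sol].
  apply/norm_cvg0P; apply: (squeeze_cvgr _ (cvg_cst 0) cb).
  apply: nearW => N; rewrite normr_ge0/= -swap; last exact: L1_pkernel.
  have := ler_wpM2l (expR_ge0 (delta * x)) (le N x).
  by rewrite mulrA expRxMexpNx_1 mul1r.
rewrite (swap _ (exp_decay_L1 (exp_decay_skernel delta_gt))).
exact: (cvg_unique _ c1 c2).
Qed.

(** One [delta] uses the Riemann hypothesis on the whole line Re s = delta, since the transform has
    to be nonzero at every frequency b. *)
Lemma solution_trivial (f : R -> R[i]) : delta < 1 -> RiemannHypothesis R ->
  bounded_measurable f -> solves_eqn delta f -> trivial_fun f.
Proof.
move=> delta_lt RH [mRe mIm [M fM]] sol.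
have ReM u : `|complex.Re (f u)| <= M := le_trans (Re_le_normc _) (fM u).
have ImM u : `|complex.Im (f u)| <= M := le_trans (Im_le_normc _) (fM u).
have psum N x : eqn_psum delta f x N =
    (expR (- (delta * x)) * \int[mu]_u (pkernel delta N (x - u) * complex.Re (f u))) +i*
    (expR (- (delta * x)) * \int[mu]_u (pkernel delta N (x - u) * complex.Im (f u))).
  rewrite eqn_psumE -!(pkernel_conv _ _ mRe ReM) -!(pkernel_conv _ _ mIm ImM).
  apply: complex_ext; [rewrite Re_sum_int|rewrite Im_sum_int];
    by apply: eq_big_nat => m /andP[m0 _]; rewrite opKE.
have nz b : cosT (skernel delta) b ^+ 2 + sinT (skernel delta) b ^+ 2 != 0.
  by apply: skernel_transform_neq0 => //; apply: RH; rewrite /= delta_gt.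
have solR := @solves_real f (fun u => complex.Re (f u)) M.
have solI := @solves_real f (fun u => complex.Im (f u)) M.
have decay := exp_decay_skernel delta_gt.
have aR : {ae mu, forall u, complex.Re (f u) = 0}.
  apply: (wiener_uniqueness decay nz mRe ReM); apply: solR => // N x.
  by rewrite psum (le_trans _ (Re_le_normc _))//= normrM (ger0_norm (expR_ge0 _)).
have aI : {ae mu, forall u, complex.Im (f u) = 0}.
  apply: (wiener_uniqueness decay nz mIm ImM); apply: solI => // N x.
  by rewrite psum (le_trans _ (Im_le_normc _))//= normrM (ger0_norm (expR_ge0 _)).
have aeF := ae_filter_ringOfSetsType mu.
by apply: (@filterS2 _ _ aeF _ _ _ _ aR aI) => u hR hI; exact: complex_ext.
Qed.

End Equation.

Lemma trivial_fun_neq0 (R : realType) (f : R -> R[i]) :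
  (forall u, f u != 0) -> ~ trivial_fun f.
Proof.
move=> f0 [A [mA A0 subA]].
have : (lebesgue_measure `[0%R, 1%R]%classic <= lebesgue_measure A)%E.
  apply: le_measure; rewrite ?inE//.
  move=> x _; apply: subA => /= fx; by have := f0 x; rewrite fx eqxx.
by rewrite A0 lebesgue_measure_itv/= lte_fin ltr01 leNgt lte_fin subr0 ltr01.
Qed.

(** A character is an eigenfunction of every convolution: K_m f is m^(-s) times a factor [w]
    independent of [m]. The partial sums of the equation are therefore [w] times those of the
    Dirichlet series of eta(s)^2 = 0, and the limit kernel does not enter. *)
Lemma zero_gives_solution (R : realType) (s : R[i]) :
  2^-1 < complex.Re s -> complex.Re s < 1 -> zeta s = 0 ->
  exists f : R -> R[i],
    [/\ bounded_measurable f, solves_eqn (complex.Re s) f & ~ trivial_fun f].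
Proof.
case: s => delta b /= delta_gt delta_lt zs.
pose f (u : R) : R[i] := cos (b * u) +i* - sin (b * u).
have nf u : Normc.normc (f u) = 1 by rewrite /f/= sqrrN cos2Dsin2 sqrtr1.
exists f; split.
- split.
  + exact: mfun_cos.
  + by apply: measurable_funN; exact: mfun_sin.
  + by exists 1 => u; rewrite nf.
- move=> x.
  have d0 : 0 < delta by apply: lt_trans delta_gt; rewrite invr_gt0.
  pose M0 : R[i] := cosT (fun t => expR (delta * t) * bessel t) b +i*
    sinT (fun t => expR (delta * t) * bessel t) b.
  pose w : R[i] := (expR (- (delta * x)))%:C * f x * M0.
  have opKf m : (0 < m)%N -> opK delta m f x = w * rcpow (m%:R : R) (- (delta +i* b)).
    move=> m0; rewrite (opKE delta f x m0).
    have im := L1_mkernel delta_gt m.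
    have mc := L1_cos b im; have ms := L1_sin b im.
    have sub (g : R -> R) : measurable_fun setT g -> (forall u, `|g u| <= 1) ->
        \int[lebesgue_measure]_u (expR (- (delta * x)) * (mkernel delta m (x - u) * g u)) =
        expR (- (delta * x)) * \int[lebesgue_measure]_t (mkernel delta m t * g (x - t)).
      move=> mg g1; have i := L1_bounded_mul (integrable_sub x im) mg g1.
      apply: etrans (RintegralZl _ measurableT i) _; congr (_ * _).
      apply: etrans (esym (Rintegral_sub x i)) _.
      by apply: eq_Rintegral => t _; rewrite subKr.
    rewrite (sub (fun u => cos (b * u)) (mfun_cos b) (fun u => cos_max (b * u))).
    rewrite (sub (fun u => - sin (b * u))); last 2 first.
    + by apply: measurable_funN; exact: mfun_sin.
    + by move=> u; rewrite normrN; exact: sin_max.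
    have -> : \int[lebesgue_measure]_t (mkernel delta m t * cos (b * (x - t))) =
        cos (b * x) * cosT (mkernel delta m) b + sin (b * x) * sinT (mkernel delta m) b.
      rewrite -(RintegralZl _ measurableT mc) -(RintegralZl _ measurableT ms).
      rewrite -(RintegralD measurableT (L1Zl _ mc) (L1Zl _ ms)).
      by apply: eq_Rintegral => t _; rewrite mulrBr cosB; ring.
    have -> : \int[lebesgue_measure]_t (mkernel delta m t * - sin (b * (x - t))) =
        cos (b * x) * sinT (mkernel delta m) b - sin (b * x) * cosT (mkernel delta m) b.
      rewrite -(RintegralZl _ measurableT mc) -(RintegralZl _ measurableT ms).
      rewrite -(RintegralB measurableT (L1Zl _ ms) (L1Zl _ mc)).
      by apply: eq_Rintegral => t _; rewrite mulrBr sinB; ring.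
    have tr : cosT (mkernel delta m) b +i* sinT (mkernel delta m) b =
      rcpow (m%:R : R) (- (delta +i* b)) * M0 := mkernel_transform delta_gt b m0.
    move: (cosT (mkernel delta m) b) (sinT (mkernel delta m) b) tr => C S tr.
    have -> : w * rcpow (m%:R : R) (- (delta +i* b)) = (expR (- (delta * x)))%:C * f x * (C +i* S).
      by rewrite tr /w; ring.
    by apply: complex_ext; rewrite /f !(ReM, ImM)/=; ring.
  have pE N : eqn_psum delta f x N = w *
      (\sum_(1 <= m < N.+1) (altconv m)%:~R * rcpow (m%:R : R) (- (delta +i* b)) -
       eta (delta +i* b) ^+ 2).
    rewrite /eta zs mulr0 expr0n/= subr0 eqn_psumE mulr_sumr.
    by apply: eq_big_nat => m /andP[m0 _]; rewrite opKf//; ring.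
  have -> : (fun N => Normc.normc (eqn_psum delta f x N)) = (fun N => Normc.normc w *
      Normc.normc (\sum_(1 <= m < N.+1) (altconv m)%:~R * rcpow (m%:R : R) (- (delta +i* b)) -
       eta (delta +i* b) ^+ 2)).
    by apply/funext => N; rewrite pE Normc.normcM.
  rewrite -(mulr0 (Normc.normc w)); apply: cvgM; first exact: cvg_cst.
  exact: altconv_psum_cvg.
- apply: trivial_fun_neq0 => u; apply/eqP => fu.
  by have := nf u; rewrite fu Normc.normc0 => /eqP; rewrite eq_sym oner_eq0.
Qed.

Theorem theorem8 (R : realType) :
  RiemannHypothesis R <->
  (forall delta : R, 2^-1 < delta < 1 ->
     ~ exists f : R -> R[i],
         [/\ bounded_measurable f, solves_eqn delta f & ~ trivial_fun f]).
Proof.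
split=> [RH delta /andP[delta_gt delta_lt] [f [bf sf nf]]|H s /andP[s_gt s_lt] zs].
  by apply: nf; exact: (solution_trivial delta_gt delta_lt RH bf sf).
by apply: (H (complex.Re s)); rewrite ?s_gt//; exact: zero_gives_solution.
Qed.
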